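(* Let $Q\subset\mathbf{C}^4$ (coordinates $(z_1,z_2,\zeta,w=u+iv)$) be the hypersurface $v=2\mathrm{Re}(z_1\bar\zeta+z_2\bar\zeta^2)$. Identify a germ at $0$ of a vector field $X=2\mathrm{Re}\big(f\partial_{z_1}+g\partial_{z_2}+h\partial_\zeta+e\partial_w\big)$ ($f,g,h,e$ holomorphic near $0$) with the tuple $(f,g,h,e)$, and let $\mathrm{aut}\,Q$ be the real Lie algebra of such germs tangent to $Q$. (a) $\mathrm{aut}\,Q=g_{-3}\oplus g_{-2}\oplus g_{-1}\oplus g_0\oplus g_1$, where $g_{-3}=\{(0,0,0,d):d\in\mathbf{R}\}$; $g_{-2}=\{(a,0,0,2i\bar a\zeta):a\in\mathbf{C}\}$; $g_{-1}=\{(-2\bar c z_2+ik\zeta,\ b,\ c,\ 2i\bar c z_1+2i\bar b\zeta^2):b,c\in\mathbf{C},k\in\mathbf{R}\}$; $g_0=\{(Mz_1+m\zeta^2,\ (2M-3l)z_2-\bar m\zeta,\ (3l-\bar M)\zeta,\ 3lw):M,m\in\mathbf{C},l\in\mathbf{R}\}$; $g_1=\{(2i\bar N z_1\zeta+Nw,\ 2i\bar N z_2\zeta-iNz_1+in\zeta^2,\ i\bar N\zeta^2,\ 2i\bar N\zeta w):N\in\mathbf{C},n\in\mathbf{R}\}$; and $\dim\mathrm{aut}\,Q=16$. (b) The stabilizer $\mathrm{aut}_0\,Q$ of the origin (fields vanishing at $0$) equals $g''_{-1}\oplus g_0\oplus g_1$, where $g''_{-1}=\{(ik\zeta,0,0,0):k\in\mathbf{R}\}$;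 its dimension is $9$. (c) If $\Gamma_0$ is a germ at $0$ of a real-analytic hypersurface of the form $v=2\mathrm{Re}(z_1\bar\zeta+z_2\bar\zeta^2)+O(4)$, where $O(4)$ denotes terms of weight at least $4$ with respect to the weights $[z_1]=2$, $[z_2]=[\zeta]=1$, $[w]=[u]=3$, then $\dim\mathrm{aut}\,\Gamma_0\le 16$ and $\dim\mathrm{aut}_0\,\Gamma_0\le 9$.
   Context: $\mathrm{aut}\,\Gamma_0$ denotes the Lie algebra of germs at $0$ of real-analytic vector fields of the form $2\mathrm{Re}(f\partial_{z_1}+g\partial_{z_2}+h\partial_\zeta+e\partial_w)$ with holomorphic coefficients, tangent to $\Gamma_0$; $\mathrm{aut}_0\,\Gamma_0$ is its subalgebra of fields vanishing at $0$. *)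

(* Defs.v *)
From mathcomp Require Import all_boot all_order all_algebra.
From mathcomp Require Import complex.
From mathcomp Require Import all_classical all_reals all_analysis.
Set Implicit Arguments. Unset Strict Implicit. Unset Printing Implicit Defensive.
Import Order.TTheory GRing.Theory Num.Theory.
Import numFieldNormedType.Exports.
Local Open Scope ring_scope.
Local Open Scope complex_scope.
Local Open Scope classical_set_scope.
Local Open Scope ring_scope.

Definition cnorm (R : realType) (x : R[i]) : R :=
  Num.sqrt (complex.Re x ^+ 2 + complex.Im x ^+ 2).

Definition cj (R : realType) (x : R[i]) : R[i] := conjc x.
Definition ci (R : realType) : R[i] := Complex 0 1.

Definition pt (R : realType) := 'I_4 -> R[i].
Definition iz1 : 'I_4 := @Ordinal 4 0 isT.
Definition iz2 : 'I_4 := @Ordinal 4 1 isT.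
Definition izeta : 'I_4 := @Ordinal 4 2 isT.
Definition iw : 'I_4 := @Ordinal 4 3 isT.

Definition near0 (R : realType) (r : R) (p : pt R) : Prop :=
  forall j, cnorm (p j) < r.

(* A vector field 2Re(f d/dz1 + g d/dz2 + h d/dzeta + e d/dw) is
   identified with the tuple (f,g,h,e): component j evaluated at p. *)
Definition vf (R : realType) := 'I_4 -> pt R -> R[i].

Definition mkvf (R : realType) (f g h e : pt R -> R[i]) : vf R :=
  fun j p => match nat_of_ord j with
             | 0 => f p | 1 => g p | 2 => h p | _ => e p end.

Definition vf0 (R : realType) : vf R := fun _ _ => 0.
Definition vf_add (R : realType) (X Y : vf R) : vf R := fun j p => X j p + Y j p.
Definition vf_lincomb (R : realType) (n : nat) (lam : 'I_n -> R)
  (B : 'I_n -> vf R) : vf R :=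
  fun j p => \sum_(i < n) (lam i)%:C * B i j p.

Definition germ_eq (R : realType) (X Y : vf R) : Prop :=
  exists r : R, 0 < r /\ forall p, near0 r p -> forall j, X j p = Y j p.

Definition mexp (k N : nat) (a : {ffun 'I_k -> 'I_N}) : {ffun 'I_k -> nat} :=
  [ffun j => nat_of_ord (a j)].

Definition psum (R : realType) (k : nat) (c : {ffun 'I_k -> nat} -> R[i])
  (x : 'I_k -> R[i]) (N : nat) : R[i] :=
  \sum_(a : {ffun 'I_k -> 'I_N})
     c (mexp a) * \prod_(j < k) x j ^+ (mexp a j).

Definition pabs (R : realType) (k : nat) (c : {ffun 'I_k -> nat} -> R[i])
  (x : 'I_k -> R[i]) (N : nat) : R :=
  \sum_(a : {ffun 'I_k -> 'I_N})
     cnorm (c (mexp a)) * \prod_(j < k) cnorm (x j) ^+ (mexp a j).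

Definition series_at (R : realType) (k : nat) (c : {ffun 'I_k -> nat} -> R[i])
  (x : 'I_k -> R[i]) (v : R[i]) : Prop :=
  (exists B : R, forall N, pabs c x N <= B) /\
  ((fun N => complex.Re (psum c x N)) @ \oo --> complex.Re v) /\
  ((fun N => complex.Im (psum c x N)) @ \oo --> complex.Im v).

Definition holo_germ (R : realType) (F : pt R -> R[i]) : Prop :=
  exists r : R, 0 < r /\ exists c : {ffun 'I_4 -> nat} -> R[i],
    forall p, near0 r p -> series_at c p (F p).

Definition holo_vf (R : realType) (X : vf R) : Prop := forall j, holo_germ (X j).

(* X is tangent near 0 to the real hypersurface {rho = 0}: at every point p
   of the hypersurface near 0, the real tangent vector X(p) lies in
   ker d rho_p, i.e. t |-> rho(p + t X(p)) has derivative 0 at t = 0. *)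
Definition tangent (R : realType) (rho : pt R -> R) (X : vf R) : Prop :=
  exists r : R, 0 < r /\ forall p, near0 r p -> rho p = 0 ->
    is_derive (0 : R) (1 : R) (fun t : R => rho (fun j => p j + t%:C * X j p)) 0.

Definition aut (R : realType) (rho : pt R -> R) (X : vf R) : Prop :=
  holo_vf X /\ tangent rho X.

Definition aut0 (R : realType) (rho : pt R -> R) (X : vf R) : Prop :=
  aut rho X /\ forall j, X j (fun _ => 0) = 0.

Definition rhoQ (R : realType) (p : pt R) : R :=
  complex.Im (p iw) - 2 * complex.Re (p iz1 * cj (p izeta) + p iz2 * cj (p izeta) ^+ 2).

Definition rhoG (R : realType) (phi : R[i] -> R[i] -> R[i] -> R -> R)
  (p : pt R) : R :=
  rhoQ p - phi (p iz1) (p iz2) (p izeta) (complex.Re (p iw)).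

Definition vars7 (R : realType) (z1 z2 zeta : R[i]) (u : R) : 'I_7 -> R[i] :=
  fun j => match nat_of_ord j with
           | 0 => z1 | 1 => z2 | 2 => zeta
           | 3 => cj z1 | 4 => cj z2 | 5 => cj zeta | _ => u%:C end.

Definition wt7 (j : 'I_7) : nat :=
  match nat_of_ord j with 0 => 2 | 3 => 2 | 6 => 3 | _ => 1 end.

Definition weight7 (a : {ffun 'I_7 -> nat}) : nat := \sum_(j < 7) wt7 j * a j.

Definition real_analytic_O4 (R : realType)
  (phi : R[i] -> R[i] -> R[i] -> R -> R) : Prop :=
  exists r : R, 0 < r /\ exists c : {ffun 'I_7 -> nat} -> R[i],
    (forall a, c a != 0 -> (4 <= weight7 a)%N) /\
    forall z1 z2 zeta u, cnorm z1 < r -> cnorm z2 < r -> cnorm zeta < r ->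
      `|u| < r -> series_at c (vars7 z1 z2 zeta u) (phi z1 z2 zeta u)%:C.

Definition germ_indep (R : realType) (n : nat) (B : 'I_n -> vf R) : Prop :=
  forall lam : 'I_n -> R, germ_eq (vf_lincomb lam B) (@vf0 R) ->
    forall i, lam i = 0.

Definition germ_dim_le (R : realType) (S : vf R -> Prop) (n : nat) : Prop :=
  forall B : 'I_n.+1 -> vf R, (forall i, S (B i)) -> ~ germ_indep B.

Definition germ_dim_eq (R : realType) (S : vf R -> Prop) (n : nat) : Prop :=
  (exists B : 'I_n -> vf R, (forall i, S (B i)) /\ germ_indep B) /\
  germ_dim_le S n.

Definition g_m3 (R : realType) (X : vf R) : Prop :=
  exists d : R, germ_eq X (mkvf (fun _ => 0) (fun _ => 0) (fun _ => 0)
                               (fun _ => d%:C)).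

Definition g_m2 (R : realType) (X : vf R) : Prop :=
  exists a : R[i], germ_eq X (mkvf (fun _ => a) (fun _ => 0) (fun _ => 0)
                   (fun p => 2 * ci R * cj a * p izeta)).

Definition g_m1 (R : realType) (X : vf R) : Prop :=
  exists (b c : R[i]) (k : R), germ_eq X (mkvf
     (fun p => - 2 * cj c * p iz2 + ci R * k%:C * p izeta)
     (fun _ => b)
     (fun _ => c)
     (fun p => 2 * ci R * cj c * p iz1 + 2 * ci R * cj b * p izeta ^+ 2)).

Definition g_m1'' (R : realType) (X : vf R) : Prop :=
  exists k : R, germ_eq X (mkvf (fun p => ci R * k%:C * p izeta)
                    (fun _ => 0) (fun _ => 0) (fun _ => 0)).

Definition g_0 (R : realType) (X : vf R) : Prop :=
  exists (M m : R[i]) (l : R), germ_eq X (mkvf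
     (fun p => M * p iz1 + m * p izeta ^+ 2)
     (fun p => (2 * M - 3 * l%:C) * p iz2 - cj m * p izeta)
     (fun p => (3 * l%:C - cj M) * p izeta)
     (fun p => 3 * l%:C * p iw)).

Definition g_1 (R : realType) (X : vf R) : Prop :=
  exists (N : R[i]) (n : R), germ_eq X (mkvf
     (fun p => 2 * ci R * cj N * p iz1 * p izeta + N * p iw)
     (fun p => 2 * ci R * cj N * p iz2 * p izeta - ci R * N * p iz1
               + ci R * n%:C * p izeta ^+ 2)
     (fun p => ci R * cj N * p izeta ^+ 2)
     (fun p => 2 * ci R * cj N * p izeta * p iw)).

(* Main.v *)
Require Import Defs.
From mathcomp Require Import all_boot all_order all_algebra.
From mathcomp Require Import complex.
From mathcomp Require Import all_classical all_reals all_analysis.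
From mathcomp Require Import ring lra zify.
Set Implicit Arguments. Unset Strict Implicit. Unset Printing Implicit Defensive.
Import Order.TTheory GRing.Theory Num.Theory.
Import numFieldNormedType.Exports.
Local Open Scope ring_scope.
Local Open Scope complex_scope.

(** Give the coordinates their weights. Pulling the tangency condition back along the
    weighted dilations shows that the lowest-weight component of a field tangent to
    [v = 2Re(z1 conj zeta + z2 conj zeta^2) + O(4)] is a polynomial field tangent to [Q].
    Polarizing the tangency equation of [Q] (conjugate variables become independent)
    and comparing coefficients, one finds that every polynomial field tangent to [Q]
    lies in the explicit 16-parameter family. Hence a tangent field whose 16 Taylor
    coefficients corresponding to these parameters vanish has no lowest-weight
    component, i.e. is zero; 7 of these 16 coefficients are values at the origin.
    This bounds both dimensions, and for [Q] itself the bound together with the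
    16 explicit fields gives the full description. *)

(** * Polynomial functions of one variable *)

(** Two obstacles shape the argument. Tangency is given as a directional derivative along each field
    separately, hence is not visibly additive in the field, whereas the dimension count combines 17
    fields linearly. It is therefore traded for [dphi_limit], where the termwise derivatives of the
    series of [phi] converge to [dQ p V], a condition linear in [V]. Secondly, the lowest-weight
    component is polynomial of unknown degree, so its classification is not a finite comparison of
    coefficients. It goes by induction on the degree in [w]: once [X (w + 1) - X w] is in the
    family, the slices of the polarized equation in which at most one conjugate variable is nonzero
    express [X] on [w = 0] by finitely many constants, and they kill every parameter of the
    difference that cannot come from the family. The dilation argument works because [Q] is
    homogeneous of weight 3 and the perturbation has weight at least 4: the spare factor [t] makes
    the perturbation disappear in the limit. The parameter counts are 16 = 1 + 2 + 5 + 5 + 3 for the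
    five graded pieces and 9 = 1 + 5 + 3 for the stabilizer. *)

Definition upoly (C : numFieldType) (r : C -> C) : Prop :=
  exists p : {poly C}, forall s, r s = p.[s].

Lemma upoly_const (C : numFieldType) (c : C) : upoly (fun=> c).
Proof. by exists c%:P => s; rewrite hornerC. Qed.

Lemma upoly_id (C : numFieldType) : upoly (fun s : C => s).
Proof. by exists 'X => s; rewrite hornerX. Qed.

Lemma upoly_add (C : numFieldType) (p q : C -> C) :
  upoly p -> upoly q -> upoly (fun s => p s + q s).
Proof. by move=> [P hP] [Q hQ]; exists (P + Q) => s; rewrite hornerD hP hQ. Qed.

Lemma upoly_mul (C : numFieldType) (p q : C -> C) :
  upoly p -> upoly q -> upoly (fun s => p s * q s).
Proof. by move=> [P hP] [Q hQ]; exists (P * Q) => s; rewrite hornerM hP hQ. Qed.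

Lemma upoly_opp (C : numFieldType) (p : C -> C) :
  upoly p -> upoly (fun s => - p s).
Proof. by move=> [P hP]; exists (- P) => s; rewrite hornerN hP. Qed.

Lemma poly_eq0_nat (C : numFieldType) (p : {poly C}) (a : C) : a != 0 ->
  (forall n : nat, p.[a / n.+1%:R] = 0) -> p = 0.
Proof.
move=> a0 H; apply: (@roots_geq_poly_eq0 _ _
  [seq a / n.+1%:R | n <- iota 0 (size p)]).
- by apply/allP => x /mapP[n _ ->]; rewrite /root H.
- rewrite map_inj_uniq ?iota_uniq // => m n /(mulfI a0)/invr_inj/eqP.
  by rewrite eqr_nat => /eqP[].
- by rewrite size_map size_iota.
Qed.

Lemma poly_eq0_horner (C : numFieldType) (p : {poly C}) :
  (forall s, p.[s] = 0) -> p = 0.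
Proof. by move=> H; apply: (poly_eq0_nat (oner_neq0 C)) => n; apply: H. Qed.

Lemma coef3_eq0 (C : numFieldType) (A B D : C) (r : C -> C) : upoly r ->
  (forall s, A + B * s + D * s ^+ 2 + s ^+ 3 * r s = 0) ->
  [/\ A = 0, B = 0 & D = 0].
Proof.
move=> [p hp] H.
have E : A%:P + B *: 'X + D *: 'X^2 + 'X^3 * p = 0.
  apply: poly_eq0_horner => s.
  by rewrite !(hornerD, hornerZ, hornerM, hornerC, hornerXn, hornerX) -hp -[RHS](H s).
have X n := congr1 (fun q : {poly C} => q`_n) E.
move: (X 0%N) (X 1%N) (X 2%N).
by rewrite !(coefD, coefXnM, coefC, coefZ, coefXn, coefX) /= !(coef0, mulr0, mulr1, addr0, add0r).
Qed.

Lemma coef2_eq0 (C : numFieldType) (A B : C) (r : C -> C) : upoly r ->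
  (forall s, A + B * s + s ^+ 2 * r s = 0) -> A = 0 /\ B = 0.
Proof.
move=> [p hp] H.
have E : A%:P + B *: 'X + 'X^2 * p = 0.
  apply: poly_eq0_horner => s.
  by rewrite !(hornerD, hornerZ, hornerM, hornerC, hornerXn, hornerX) -hp -[RHS](H s).
have X n := congr1 (fun q : {poly C} => q`_n) E.
move: (X 0%N) (X 1%N).
by rewrite !(coefD, coefXnM, coefC, coefZ, coefXn, coefX) /= !(coef0, mulr0, mulr1, addr0, add0r).
Qed.

Lemma upoly_taylor (C : numFieldType) (F : C -> C) : upoly F ->
  exists (x1 x2 : C) (q : C -> C), upoly q /\
    forall s, F s = F 0 + x1 * s + x2 * s ^+ 2 + s ^+ 3 * q s.
Proof.
move=> [p hp].
have dec (r : {poly C}) : exists q : {poly C}, forall s, r.[s] = r.[0] + s * q.[s].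
  elim/poly_ind: r => [|r c _]; first by exists 0 => s; rewrite !hornerE.
  by exists r => s; rewrite !hornerE; ring.
have [p1 h1] := dec p; have [p2 h2] := dec p1; have [p3 h3] := dec p2.
exists p1.[0], p2.[0], (fun s => p3.[s]); split; first by exists p3.
by move=> s; rewrite !hp h1 h2 h3; ring.
Qed.

(** In characteristic 0 the naturals are infinitely many points, and [p - p.[0]] vanishes at all of
    them. *)
Lemma poly_periodic (C : numFieldType) (p : {poly C}) :
  (forall s, p.[s + 1] = p.[s]) -> forall s, p.[s] = p.[0].
Proof.
move=> H.
have H1 (n : nat) : p.[n%:R] = p.[0].
  by elim: n => [//|n IH]; rewrite -natr1 H IH.
have E : p - p.[0]%:P = 0.
  apply: (@roots_geq_poly_eq0 _ _
    [seq n%:R | n <- iota 0 (size (p - p.[0]%:P))]).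
  - by apply/allP => x /mapP[n _ ->]; rewrite /root !hornerE H1 subrr.
  - rewrite map_inj_uniq ?iota_uniq // => m n /eqP.
    by rewrite eqr_nat => /eqP.
  - by rewrite size_map size_iota.
move=> s; have := congr1 (horner^~ s) E.
by rewrite hornerD hornerN hornerC horner0 => /subr0_eq.
Qed.

(** Product rule for the forward difference [D]: if [p = q * 'X + c], then
    [D p = D q * 'X + q \Po ('X + 1)], and the induction applies to [q]. *)
Lemma size_poly_diff (C : numFieldType) (p : {poly C}) n : (size p <= n.+1)%N ->
  (size (p \Po ('X + 1%:P) - p)%R <= n)%N.
Proof.
elim: n p => [|n IH] p.
  move=> /size1_polyC ->; by rewrite comp_polyC subrr size_poly0.
have [q [c ->]] : exists q c, p = q * 'X + c%:P.
  elim/poly_ind: p => [|p c _]; last by exists p, c.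
  by exists 0, 0; rewrite mul0r add0r.
rewrite -cons_poly_def size_cons_poly => sz.
have {sz} szq : (size q <= n.+1)%N.
  by move: sz; case: ifP => // /andP[/nilP-> _].
rewrite cons_poly_def comp_polyD comp_polyC comp_polyM comp_polyX.
have -> : (q \Po ('X + 1%:P)) * ('X + 1%:P) + c%:P - (q * 'X + c%:P) =
   (q \Po ('X + 1%:P) - q) * 'X + (q \Po ('X + 1%:P)).
  by rewrite mulrDr mulr1; ring.
apply: leq_trans (size_polyD _ _) _; rewrite geq_max; apply/andP; split.
  apply: leq_trans (size_polyMleq _ _) _; rewrite size_polyX addn2 /=.
  by rewrite ltnS; apply: IH.
have -> : q \Po ('X + 1%:P) = (q \Po ('X + 1%:P) - q) + q by rewrite subrK.
apply: leq_trans (size_polyD _ _) _; rewrite geq_max szq andbT.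
exact: leq_trans (IH _ szq) (leqnSn _).
Qed.

(** * The complexified tangency equation *)

Record quad (C : Type) := Quad {
  qf : C -> C -> C -> C -> C;
  qg : C -> C -> C -> C -> C;
  qh : C -> C -> C -> C -> C;
  qe : C -> C -> C -> C -> C }.

(* Tangency to [Q] after polarization: [X] is the field, [Y] its conjugate,
   [(z1, z2, t, w)] the coordinates, and the conjugate coordinates
   [(a1, a2, b, v)] are independent variables subject to the equation of [Q];
   [j] stands for the imaginary unit. *)
Definition polar_tangent (C : numFieldType) (j : C) (X Y : quad C) : Prop :=
  forall z1 z2 t a1 a2 b v : C,
  let w := v + 2 * j * (z1 * b + a1 * t + z2 * b ^+ 2 + a2 * t ^+ 2) in
  qe X z1 z2 t w - qe Y a1 a2 b v =
  2 * j * (qf X z1 z2 t w * b + qf Y a1 a2 b v * t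
           + z1 * qh Y a1 a2 b v + a1 * qh X z1 z2 t w
           + qg X z1 z2 t w * b ^+ 2 + qg Y a1 a2 b v * t ^+ 2
           + 2 * z2 * b * qh Y a1 a2 b v + 2 * a2 * t * qh X z1 z2 t w).

(* The parameters of the families [g_{-3}, ..., g_1]; a prime marks the conjugate
   parameter, which is independent of the unprimed one before reality is imposed. *)
Record param (C : Type) := Param {
  pd : C; pa : C; pa' : C; pb : C; pb' : C; pc : C; pc' : C; pk : C;
  pM : C; pM' : C; pm : C; pm' : C; pl : C; pN : C; pN' : C; pn : C }.

(** The conjugate of a field with parameters [p] has parameters [swap p], with [j] replaced by
    [- j]. *)
Definition swap (C : Type) (p : param C) : param C :=
  Param (pd p) (pa' p) (pa p) (pb' p) (pb p) (pc' p) (pc p) (pk p)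
        (pM' p) (pM p) (pm' p) (pm p) (pl p) (pN' p) (pN p) (pn p).

Definition in_fam (C : numFieldType) (j : C) (p : param C) (X : quad C) : Prop :=
  forall z1 z2 t w : C, [/\
  qf X z1 z2 t w = pa p - 2 * pc' p * z2 + j * pk p * t + pM p * z1
    + pm p * t ^+ 2 + 2 * j * pN' p * z1 * t + pN p * w,
  qg X z1 z2 t w = pb p + (2 * pM p - 3 * pl p) * z2 - pm' p * t
    + 2 * j * pN' p * z2 * t - j * pN p * z1 + j * pn p * t ^+ 2,
  qh X z1 z2 t w = pc p + (3 * pl p - pM' p) * t + j * pN' p * t ^+ 2
  & qe X z1 z2 t w = pd p + 2 * j * pa' p * t + 2 * j * pc' p * z1
    + 2 * j * pb' p * t ^+ 2 + 3 * pl p * w + 2 * j * pN' p * t * w].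

(* [X (w + 1) - X w] lies in the family: [(w ^+ 2 - w) / 2] is the discrete
   primitive of [w]. *)
Definition in_fam_sum (C : numFieldType) (j : C) (p : param C) (X : quad C) : Prop :=
  forall z1 z2 t w : C, [/\
  qf X z1 z2 t w = qf X z1 z2 t 0 + w * (pa p - 2 * pc' p * z2 + j * pk p * t
    + pM p * z1 + pm p * t ^+ 2 + 2 * j * pN' p * z1 * t)
    + pN p * ((w ^+ 2 - w) / 2),
  qg X z1 z2 t w = qg X z1 z2 t 0 + w * (pb p + (2 * pM p - 3 * pl p) * z2
    - pm' p * t + 2 * j * pN' p * z2 * t - j * pN p * z1 + j * pn p * t ^+ 2),
  qh X z1 z2 t w = qh X z1 z2 t 0
    + w * (pc p + (3 * pl p - pM' p) * t + j * pN' p * t ^+ 2)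
  & qe X z1 z2 t w = qe X z1 z2 t 0 + w * (pd p + 2 * j * pa' p * t
    + 2 * j * pc' p * z1 + 2 * j * pb' p * t ^+ 2)
    + (3 * pl p + 2 * j * pN' p * t) * ((w ^+ 2 - w) / 2)].

(** Polynomiality along the axes is enough: the slices of the tangency equation evaluate the
    conjugate field only at points with a single nonzero conjugate variable. *)
Definition axis_poly (C : numFieldType) (F : C -> C -> C -> C -> C) : Prop :=
  forall w, [/\ upoly (fun s => F s 0 0 w), upoly (fun s => F 0 s 0 w)
              & upoly (fun s => F 0 0 s w)].

Definition axis_polyq (C : numFieldType) (X : quad C) : Prop :=
  [/\ axis_poly (qf X), axis_poly (qg X) & axis_poly (qh X)].

(** The polarized equation of [Q] reads [w = v + 2 j P] or [v = w - 2 j P] with a symmetric [P].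
    Every statement about [X] thus transfers to [Y]. *)
Lemma polar_tangent_swap (C : numFieldType) (j : C) (X Y : quad C) :
  polar_tangent j X Y -> polar_tangent (- j) Y X.
Proof.
move=> H a1 a2 b z1 z2 t v /=.
set w := v + _.
have := H z1 z2 t a1 a2 b w.
rewrite /= (_ : w + _ = v); last by rewrite /w; ring.
by move=> E; rewrite -opprB E; ring.
Qed.

(** When all conjugate variables vanish, [w = 0]: this is the Segre variety of the origin, on which
    [qe X] depends only on the values of [Y] at the origin. *)
Lemma e_initial (C : numFieldType) (j : C) (X Y : quad C) (z1 z2 t : C) :
  polar_tangent j X Y ->
  qe X z1 z2 t 0 = qe Y 0 0 0 0 + 2 * j *
    (qf Y 0 0 0 0 * t + qh Y 0 0 0 0 * z1 + qg Y 0 0 0 0 * t ^+ 2).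
Proof.
move=> /(_ z1 z2 t 0 0 0 0) /=.
rewrite (_ : 0 + _ = 0); last by ring.
by move/eqP; rewrite subr_eq => /eqP ->; ring.
Qed.

Ltac solve_upoly := repeat first
  [ assumption | apply: upoly_const | apply: upoly_id
  | apply: upoly_add | apply: upoly_mul | apply: upoly_opp ].

Lemma eq0_scale (C : numFieldType) (x a c : C) : a = 0 -> c = x * a -> c = 0.
Proof. by move=> -> ->; rewrite mulr0. Qed.

Lemma eq0_lincomb (C : numFieldType) (x y a b c : C) :
  a = 0 -> b = 0 -> c = x * a + y * b -> c = 0.
Proof. by move=> -> -> ->; rewrite !mulr0 addr0. Qed.

Lemma factor_eq (C : numFieldType) (c a b : C) :
  c != 0 -> c * (a - b) = 0 -> b = a.
Proof.
by move=> c0 /eqP; rewrite mulf_eq0 (negbTE c0) subr_eq0 => /eqP ->.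
Qed.

(* Compare the coefficients of [a1] and of [a2] in the slice where the other
   conjugate variables and [v] vanish. *)
Lemma h_initial (C : numFieldType) (j : C) (X Y : quad C) (p : param C)
    (x1 x2 : C) (q : C -> C) :
  j != 0 -> polar_tangent j X Y -> axis_polyq Y -> in_fam_sum j p X ->
  upoly q ->
  (forall s, qf Y s 0 0 0 = qf Y 0 0 0 0 + x1 * s + x2 * s ^+ 2 + s ^+ 3 * q s) ->
  [/\ pb' p = 0, pc' p = 0 &
   forall z1 z2 t, qh X z1 z2 t 0 = qh X 0 0 0 0
     + (pd p - 3 * pl p / 2 - x1) * t + j * (pa' p - pN' p / 2) * t ^+ 2].
Proof.
move=> j0 H [Yf Yg Yh] Xw uq hq.
have [/upoly_taylor[g1 [g2 [qg1 [ug hg]]]] /upoly_taylor[g3 [g4 [qg2 [ug' hg']]]] _] := Yg 0.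
have [/upoly_taylor[h1 [h2 [qh1 [uh hh]]]] /upoly_taylor[h3 [h4 [qh2 [uh' hh']]]] _] := Yh 0.
have [_ /upoly_taylor[f3 [f4 [qf2 [uf' hf']]]] _] := Yf 0.
have Hs := polar_tangent_swap H.
have two_j : 2 * j != 0 :> C by rewrite mulf_neq0 // pnatr_eq0.
have E1 z1 z2 t : qh X z1 z2 t 0 = qh X 0 0 0 0 - x1 * t - h1 * z1 - g1 * t ^+ 2
  + t * (pd p + 2 * j * pa' p * t + 2 * j * pc' p * z1 + 2 * j * pb' p * t ^+ 2
         - (3 * pl p + 2 * j * pN' p * t) / 2).
  (* The terms of order at least two in [s]: those from [w ^+ 2], those from [w] times [s], and the
     Taylor tails of [Y]. *)
  pose r s := (3 * pl p + 2 * j * pN' p * t) * (2 * j * t) ^+ 2 / 2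
    - 2 * j * (2 * j * t * (pc p + (3 * pl p - pM' p) * t + j * pN' p * t ^+ 2))
    - 2 * j * (t * (x2 + s * q s) + z1 * (h2 + s * qh1 s) + t ^+ 2 * (g2 + s * qg1 s)).
  have ur : upoly r by rewrite /r; solve_upoly.
  case: (@coef2_eq0 _
    (qe X z1 z2 t 0 - qe Y 0 0 0 0 - 2 * j * (qf Y 0 0 0 0 * t
       + qh Y 0 0 0 0 * z1 + qg Y 0 0 0 0 * t ^+ 2))
    (2 * j * (qh X 0 0 0 0 - x1 * t - h1 * z1 - g1 * t ^+ 2
  + t * (pd p + 2 * j * pa' p * t + 2 * j * pc' p * z1 + 2 * j * pb' p * t ^+ 2
         - (3 * pl p + 2 * j * pN' p * t) / 2) - qh X z1 z2 t 0)) r ur) => [s|_ B0].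
    have /eqP := H z1 z2 t s 0 0 0.
    rewrite -subr_eq0 => /eqP HH; rewrite -[RHS]HH /=.
    have [_ _ -> ->] := Xw z1 z2 t (0 + 2 * j * (z1 * 0 + s * t + z2 * 0 ^+ 2 + 0 * t ^+ 2)).
    rewrite (e_initial s 0 0 Hs) (hq s) (hh s) (hg s) (e_initial 0 0 0 H) /r; field; rewrite ?pnatr_eq0 //.
  exact: factor_eq two_j B0.
have E2 z1 z2 t : f3 * t + h3 * z1 + g3 * t ^+ 2 + 2 * t * qh X z1 z2 t 0
  = t ^+ 2 * (pd p + 2 * j * pa' p * t + 2 * j * pc' p * z1 + 2 * j * pb' p * t ^+ 2
         - (3 * pl p + 2 * j * pN' p * t) / 2).
  pose r s := (3 * pl p + 2 * j * pN' p * t) * (2 * j * t ^+ 2) ^+ 2 / 2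
    - 2 * j * (2 * t * (2 * j * t ^+ 2 * (pc p + (3 * pl p - pM' p) * t + j * pN' p * t ^+ 2)))
    - 2 * j * (t * (f4 + s * qf2 s) + z1 * (h4 + s * qh2 s) + t ^+ 2 * (g4 + s * qg2 s)).
  have ur : upoly r by rewrite /r; solve_upoly.
  case: (@coef2_eq0 _
    (qe X z1 z2 t 0 - qe Y 0 0 0 0 - 2 * j * (qf Y 0 0 0 0 * t
       + qh Y 0 0 0 0 * z1 + qg Y 0 0 0 0 * t ^+ 2))
    (2 * j * (t ^+ 2 * (pd p + 2 * j * pa' p * t + 2 * j * pc' p * z1 + 2 * j * pb' p * t ^+ 2
         - (3 * pl p + 2 * j * pN' p * t) / 2) -
      (f3 * t + h3 * z1 + g3 * t ^+ 2 + 2 * t * qh X z1 z2 t 0))) r ur) => [s|_ B0].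
    have /eqP := H z1 z2 t 0 s 0 0.
    rewrite -subr_eq0 => /eqP HH; rewrite -[RHS]HH /=.
    have [_ _ -> ->] := Xw z1 z2 t (0 + 2 * j * (z1 * 0 + 0 * t + z2 * 0 ^+ 2 + s * t ^+ 2)).
    rewrite (e_initial 0 s 0 Hs) (hf' s) (hh' s) (hg' s) (e_initial 0 0 0 H) /r; field; rewrite ?pnatr_eq0 //.
  exact: factor_eq two_j B0.
(* The slice in [a1] gives [qh X] itself and the slice in [a2] gives [2 t qh X]; [P] is their
   compatibility, a polynomial identity in [z1] and [t]. *)
have P (z1 z2 t : C) : f3 * t + h3 * z1 + g3 * t ^+ 2 + 2 * t * (qh X 0 0 0 0 - x1 * t - h1 * z1 - g1 * t ^+ 2)
   + t ^+ 2 * (pd p + 2 * j * pa' p * t + 2 * j * pc' p * z1 + 2 * j * pb' p * t ^+ 2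
         - (3 * pl p + 2 * j * pN' p * t) / 2) = 0.
  have := E2 z1 z2 t; rewrite E1 => /eqP; rewrite -subr_eq0 => /eqP HH; rewrite -[RHS]HH; ring.
have u0 : upoly (fun s : C => - 2 * g1 + 2 * j * pa' p - j * pN' p + 2 * j * pb' p * s).
  by solve_upoly.
have Q s : 0 + (f3 + 2 * qh X 0 0 0 0) * s + (g3 - 2 * x1 + pd p - 3 * pl p / 2) * s ^+ 2
  + s ^+ 3 * (- 2 * g1 + 2 * j * pa' p - j * pN' p + 2 * j * pb' p * s) = 0.
  by rewrite -[RHS](P 0 0 s); field; rewrite ?pnatr_eq0 //.
have [_ B0 D0] := coef3_eq0 u0 (A := 0) Q.
have [|_ B1 D1] := @coef3_eq0 _ h3 (- 2 * h1) (2 * j * pc' p) _ (upoly_const 0).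
  by move=> s; apply: (eq0_lincomb (x := 1) (y := -1) (P 1 0 s) (P 0 0 s)); field; rewrite ?pnatr_eq0 //.
(* What remains of [Q s] is [s ^+ 3] times an affine function; the values at 1 and -1 separate its
   two coefficients. *)
have r1 : (- 2 * g1 + 2 * j * pa' p - j * pN' p) + 2 * j * pb' p = 0.
  by rewrite -[RHS](Q 1) B0 D0; ring.
have r2 : (- 2 * g1 + 2 * j * pa' p - j * pN' p) - 2 * j * pb' p = 0.
  by apply: (eq0_scale (x := -1) (Q (-1))); rewrite B0 D0; ring.
have b0 : pb' p = 0.
  apply: (@factor_eq _ (4 * j) 0); first by rewrite mulf_neq0 // pnatr_eq0.
  by apply: (eq0_lincomb (x := 1) (y := -1) r2 r1); ring.
have c0 : pc' p = 0.
  by apply: (factor_eq two_j); apply: (eq0_scale (x := -1) D1); ring.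
have h10 : h1 = 0.
  by apply: (@factor_eq _ 2 0); rewrite ?pnatr_eq0 //; apply: (eq0_scale (x := 1) B1); ring.
have g1E : g1 = j * (pa' p - pN' p / 2).
  by apply: (@factor_eq _ 2); rewrite ?pnatr_eq0 // -[RHS]r1 b0; field; rewrite ?pnatr_eq0 //.
split=> // z1 z2 t; rewrite E1 b0 c0 h10 g1E; field; rewrite ?pnatr_eq0 //.
Qed.

(* Coefficients of [b] and [b ^+ 2] in the slice [a1 = a2 = v = 0]. *)
Lemma fg_initial (C : numFieldType) (j : C) (X Y : quad C) (p : param C)
    (x1 f3 f4 g3 g4 : C) (q q' : C -> C) :
  j != 0 -> polar_tangent j X Y -> in_fam_sum j p X ->
  pb' p = 0 -> pc' p = 0 -> upoly q -> upoly q' ->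
  (forall s, qf Y 0 0 s 0 = qf Y 0 0 0 0 + f3 * s + f4 * s ^+ 2 + s ^+ 3 * q s) ->
  (forall s, qg Y 0 0 s 0 = qg Y 0 0 0 0 + g3 * s + g4 * s ^+ 2 + s ^+ 3 * q' s) ->
  (forall a1 a2 b, qh Y a1 a2 b 0 = qh Y 0 0 0 0
     + (pd p - 3 * pl p / 2 - x1) * b + - j * (pa p - pN p / 2) * b ^+ 2) ->
  forall z1 z2 t,
   qf X z1 z2 t 0 = qf X 0 0 0 0 + x1 * z1 + 2 * j * (pa' p - pN' p / 2) * z1 * t
     - f3 * t - g3 * t ^+ 2 - 2 * qh Y 0 0 0 0 * z2 /\
   qg X z1 z2 t 0 = qg X 0 0 0 0
     + z2 * (2 * x1 - (pd p - 3 * pl p / 2) + 2 * j * (pa' p - pN' p / 2) * t)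
     + j * z1 ^+ 2 * (3 * pl p + 2 * j * pN' p * t)
     - 2 * j * z1 * (j * pk p * t + pM p * z1 + pm p * t ^+ 2 + 2 * j * pN' p * z1 * t)
     - f4 * t - j * (pa p - pN p / 2) * z1 - g4 * t ^+ 2.
Proof.
move=> j0 H Xw b'0 c'0 uq uq' hf hg hh z1 z2 t.
have Hs := polar_tangent_swap H.
have two_j : 2 * j != 0 :> C by rewrite mulf_neq0 // pnatr_eq0.
pose D := pd p - 3 * pl p / 2 + 2 * j * (pa' p - pN' p / 2) * t.
pose E2 := (3 * pl p + 2 * j * pN' p * t) / 2.
pose Fw := pa p - pN p / 2 + j * pk p * t + pM p * z1 + pm p * t ^+ 2 + 2 * j * pN' p * z1 * t.
pose Gw := pb p + (2 * pM p - 3 * pl p) * z2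
    - pm' p * t + 2 * j * pN' p * z2 * t - j * pN p * z1 + j * pn p * t ^+ 2.
pose H1 := pd p - 3 * pl p / 2 - x1.
pose H2 := - j * (pa p - pN p / 2).
pose W s := 2 * j * (z1 + z2 * s).
pose r s := E2 * (2 * j) ^+ 2 * (2 * z1 * z2 + z2 ^+ 2 * s)
  - 2 * j * (2 * j * z2 * Fw + pN p / 2 * W s ^+ 2 + t * q s + 2 * z2 * H2 + W s * Gw
             + t ^+ 2 * q' s).
have ur : upoly r by rewrite /r /W; solve_upoly.
case: (@coef3_eq0 _ (qe X z1 z2 t 0 - qe Y 0 0 0 0 - 2 * j * (qf Y 0 0 0 0 * t
       + qh Y 0 0 0 0 * z1 + qg Y 0 0 0 0 * t ^+ 2))
  (2 * j * (z1 * D + qf X 0 0 0 0 - f3 * t - z1 * H1 - g3 * t ^+ 2 - 2 * z2 * qh Y 0 0 0 0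
      - qf X z1 z2 t 0))
  (2 * j * (z2 * D + 2 * j * z1 ^+ 2 * E2 + qg X 0 0 0 0 - 2 * j * z1 * Fw - t * f4 - z1 * H2
      - t ^+ 2 * g4 - 2 * z2 * H1 - qg X z1 z2 t 0)) r ur) => [s|_ B0 D0].
  have /eqP := H z1 z2 t 0 0 s 0.
  rewrite -subr_eq0 => /eqP HH; rewrite -[RHS]HH /=.
  have [-> -> _ ->] := Xw z1 z2 t (0 + 2 * j * (z1 * s + 0 * t + z2 * s ^+ 2 + 0 * t ^+ 2)).
  rewrite (e_initial 0 0 s Hs) (hf s) (hh 0 0 s) (hg s) (e_initial 0 0 0 H) /r b'0 c'0.
  by rewrite /D /E2 /Fw /Gw /H1 /H2 /W; field; rewrite ?pnatr_eq0 //.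
split.
  by rewrite (factor_eq two_j B0) /D /H1; field; rewrite ?pnatr_eq0 //.
rewrite (factor_eq two_j D0) /D /H1 /H2 /Fw /E2; field; rewrite ?pnatr_eq0 //.
Qed.

(* Everything is now explicit; the slice [a1 = a2 = v = 0] kills all parameters of
   the difference except [pd], [pa] and [pa'], first at [z1 = 0], and [pl] from the
   monomial [z1 * z2 * b ^+ 3]. *)
Lemma slice_constraints (C : numFieldType) (j : C) (X Y : quad C) (p : param C)
    (x1 f3 f4 g3 g4 : C) :
  j != 0 -> polar_tangent j X Y -> in_fam_sum j p X ->
  pb p = 0 -> pb' p = 0 -> pc' p = 0 ->
  (forall s, qf Y 0 0 s 0 = qf Y 0 0 0 0 + f3 * s + f4 * s ^+ 2) ->
  (forall s, qg Y 0 0 s 0 = qg Y 0 0 0 0 + g3 * s + g4 * s ^+ 2) ->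
  (forall a1 a2 b, qh Y a1 a2 b 0 = qh Y 0 0 0 0
     + (pd p - 3 * pl p / 2 - x1) * b + - j * (pa p - pN p / 2) * b ^+ 2) ->
  (forall z1 z2 t,
   qf X z1 z2 t 0 = qf X 0 0 0 0 + x1 * z1 + 2 * j * (pa' p - pN' p / 2) * z1 * t
     - f3 * t - g3 * t ^+ 2 - 2 * qh Y 0 0 0 0 * z2 /\
   qg X z1 z2 t 0 = qg X 0 0 0 0
     + z2 * (2 * x1 - (pd p - 3 * pl p / 2) + 2 * j * (pa' p - pN' p / 2) * t)
     + j * z1 ^+ 2 * (3 * pl p + 2 * j * pN' p * t)
     - 2 * j * z1 * (j * pk p * t + pM p * z1 + pm p * t ^+ 2 + 2 * j * pN' p * z1 * t)
     - f4 * t - j * (pa p - pN p / 2) * z1 - g4 * t ^+ 2) ->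
  [/\ pN p = 0, pN' p = 0, pk p = 0 & pm p = 0] /\
  [/\ pm' p = 0, pn p = 0, pM p = 0 & pl p = 0].
Proof.
move=> j0 H Xw b0 b'0 c'0 hf hg hh Xfg.
have Hs := polar_tangent_swap H.
have e0 : qe X 0 0 0 0 = qe Y 0 0 0 0 by rewrite (e_initial 0 0 0 H); ring.
have two0 : 2 != 0 :> C by rewrite pnatr_eq0.
have S z2 t b :
  (9 / 2 * pl p - 2 * pM p - j * pN' p * t - j * b * pN p) * (2 * j * z2 * b ^+ 2) ^+ 2
  - 2 * j * (2 * j * z2 * b ^+ 2) * (b * (j * pk p * t + pm p * t ^+ 2)
     + b ^+ 2 * (- pm' p * t + j * pn p * t ^+ 2)) = 0.
  have /eqP := H 0 z2 t 0 0 b 0; rewrite -subr_eq0 /= => /eqP HH.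
  apply: (eq0_scale (x := 1) HH) => {HH}.
  have [-> -> _ ->] := Xw 0 z2 t (0 + 2 * j * (0 * b + 0 * t + z2 * b ^+ 2 + 0 * t ^+ 2)).
  have [-> ->] := Xfg 0 z2 t.
  rewrite (e_initial 0 z2 t H) (e_initial 0 0 b Hs) (hf b) (hg b) (hh 0 0 b) e0 b0 b'0 c'0.
  by field.
(* Even and odd parts of [S] in [z2]. The values 0, 1, -1 of [t] and [b] then isolate the individual
   parameters. *)
have S1 t b : 8 * j ^+ 2 * b ^+ 4 *
   (9 / 2 * pl p - 2 * pM p - j * pN' p * t - j * b * pN p) = 0.
  by apply: (eq0_lincomb (x := 1) (y := 1) (S 1 t b) (S (- 1) t b)); ring.
have S2 t b : 8 * j ^+ 2 * b ^+ 2 * (b * (j * pk p * t + pm p * t ^+ 2)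
     + b ^+ 2 * (- pm' p * t + j * pn p * t ^+ 2)) = 0.
  by apply: (eq0_lincomb (x := - 1) (y := 1) (S 1 t b) (S (- 1) t b)); ring.
have j3 : 16 * j ^+ 3 != 0 by rewrite mulf_neq0 ?expf_neq0 // pnatr_eq0.
have j2 : 16 * j ^+ 2 != 0 by rewrite mulf_neq0 ?expf_neq0 // pnatr_eq0.
have N0 : pN p = 0.
  apply: (factor_eq j3).
  by apply: (eq0_lincomb (x := 1) (y := -1) (S1 0 1) (S1 0 (-1))); ring.
have N'0 : pN' p = 0.
  apply: (factor_eq j3).
  by apply: (eq0_lincomb (x := 2) (y := -2) (S1 1 1) (S1 0 1)); ring.
have ME : pM p = 9 / 4 * pl p.
  apply: (factor_eq j2).
  by apply: (eq0_scale (x := 1) (S1 0 1)); rewrite N0; field.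
have S3 b : 16 * j ^+ 2 * b ^+ 2 * (b * pm p + b ^+ 2 * j * pn p) = 0.
  by apply: (eq0_lincomb (x := 1) (y := 1) (S2 1 b) (S2 (-1) b)); ring.
have S4 b : 16 * j ^+ 2 * b ^+ 2 * (b * j * pk p - b ^+ 2 * pm' p) = 0.
  by apply: (eq0_lincomb (x := 1) (y := -1) (S2 1 b) (S2 (-1) b)); ring.
have m0 : pm p = 0.
  apply: (factor_eq j2).
  by apply: (eq0_lincomb (x := - 1 / 2) (y := 1 / 2) (S3 1) (S3 (-1))); field.
have n0 : pn p = 0.
  apply: (factor_eq j3).
  by apply: (eq0_lincomb (x := - 1 / 2) (y := - 1 / 2) (S3 1) (S3 (-1))); field.
have k0 : pk p = 0.
  apply: (factor_eq j3).
  by apply: (eq0_lincomb (x := - 1 / 2) (y := 1 / 2) (S4 1) (S4 (-1))); field.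
have m'0 : pm' p = 0.
  apply: (factor_eq j2).
  by apply: (eq0_lincomb (x := 1 / 2) (y := 1 / 2) (S4 1) (S4 (-1))); field.
have l0 : pl p = 0.
  have /eqP := H 1 1 0 0 0 1 0; rewrite -subr_eq0 /= => /eqP HH.
  have j2' : 3 * j ^+ 2 != 0 by rewrite mulf_neq0 ?expf_neq0 // pnatr_eq0.
  apply: (factor_eq j2'); apply: (eq0_scale (x := 1) HH) => {HH}.
  have [-> -> _ ->] := Xw 1 1 0 (0 + 2 * j * (1 * 1 + 0 * 0 + 1 * 1 ^+ 2 + 0 * 0 ^+ 2)).
  have [-> ->] := Xfg 1 1 0.
  rewrite (e_initial 1 1 0 H) (e_initial 0 0 1 Hs) (hf 1) (hg 1) (hh 0 0 1) e0.
  by rewrite b0 b'0 c'0 ME N0 N'0 m0 n0 k0 m'0; field.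
by rewrite ME l0 mulr0; do !split.
Qed.

(** Each formula for [X] on [w = 0] involves Taylor coefficients of [Y], and conversely. Comparing
    these formulas with the Taylor expansions along the third axis removes the tails, so both fields
    become explicit and [slice_constraints] applies to each. The second application, to the swapped
    pair, is what kills [pM']. *)
Lemma fam_step (C : numFieldType) (j : C) (X Y : quad C) (p : param C) :
  j != 0 -> polar_tangent j X Y -> axis_polyq X -> axis_polyq Y ->
  in_fam_sum j p X -> in_fam_sum (- j) (swap p) Y ->
  exists p', in_fam j p' X /\ in_fam (- j) (swap p') Y.
Proof.
move=> j0 H Xp Yp Xw Yw.
have Hs := polar_tangent_swap H.
have nj0 : - j != 0 by rewrite oppr_eq0.
have [Xf Xg _] := Xp; have [Yf Yg _] := Yp.
have [/upoly_taylor[x1 [x2 [xq [xu xh]]]] _ /upoly_taylor[f3 [f4 [fq [fu fh]]]]] := Xf 0.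
have [/upoly_taylor[y1 [y2 [yq [yu yh]]]] _ /upoly_taylor[f3' [f4' [fq' [fu' fh']]]]] := Yf 0.
have [_ _ /upoly_taylor[g3 [g4 [gq [gu gh]]]]] := Xg 0.
have [_ _ /upoly_taylor[g3' [g4' [gq' [gu' gh']]]]] := Yg 0.
have [b'0 c'0 hX] := h_initial j0 H Yp Xw yu yh.
have [/= b0 c0 hY] := h_initial nj0 Hs Xp Yw xu xh.
have Xfg := fg_initial j0 H Xw b'0 c'0 fu' gu' fh' gh' hY.
have hX' a1 a2 b : qh X a1 a2 b 0 = qh X 0 0 0 0
     + (pd (swap p) - 3 * pl (swap p) / 2 - y1) * b
     + - - j * (pa (swap p) - pN (swap p) / 2) * b ^+ 2 by rewrite hX opprK.
have Yfg := fg_initial nj0 Hs Yw b0 c0 fu gu fh gh hX'.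
have eX z1 z2 t := e_initial z1 z2 t H.
have eY z1 z2 t := e_initial z1 z2 t Hs.
have e0 : qe X 0 0 0 0 = qe Y 0 0 0 0 by rewrite eX; ring.
have [f3E f4E] : f3 = - f3' /\ f4 = - g3'.
  have u : upoly (fun s => - fq s) by solve_upoly.
  case: (@coef3_eq0 _ 0 (- f3' - f3) (- g3' - f4) _ u) => [s|_].
    have := fh s; have [-> _] := Xfg 0 0 s => /eqP; rewrite -subr_eq0 => /eqP HH.
    by rewrite -[RHS]HH; ring.
  by move=> /subr0_eq-> /subr0_eq->.
have [g3E g4E] : g3 = - f4' /\ g4 = - g4'.
  have u : upoly (fun s => - gq s) by solve_upoly.
  case: (@coef3_eq0 _ 0 (- f4' - g3) (- g4' - g4) _ u) => [s|_].
    have := gh s; have [_ ->] := Xfg 0 0 s => /eqP; rewrite -subr_eq0 => /eqP HH.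
    by rewrite -[RHS]HH; ring.
  by move=> /subr0_eq-> /subr0_eq->.
have hf s : qf X 0 0 s 0 = qf X 0 0 0 0 + f3 * s + f4 * s ^+ 2.
  by have [-> _] := Xfg 0 0 s; rewrite f3E f4E; ring.
have hg s : qg X 0 0 s 0 = qg X 0 0 0 0 + g3 * s + g4 * s ^+ 2.
  by have [_ ->] := Xfg 0 0 s; rewrite g3E g4E; ring.
have hf' s : qf Y 0 0 s 0 = qf Y 0 0 0 0 + f3' * s + f4' * s ^+ 2.
  by have [-> _] := Yfg 0 0 s; rewrite f3E g3E; ring.
have hg' s : qg Y 0 0 s 0 = qg Y 0 0 0 0 + g3' * s + g4' * s ^+ 2.
  by have [_ ->] := Yfg 0 0 s; rewrite f4E g4E; ring.
have [[N0 N'0 k0 m0] [m'0 n0 M0 l0]] :=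
  slice_constraints j0 H Xw b0 b'0 c'0 hf' hg' hY Xfg.
have [_ [_ _ /= M'0 _]] :=
  slice_constraints nj0 Hs Yw b'0 b0 c0 hf hg hX' Yfg.
(* Constant parameters are values at the origin. The surviving parameters of the difference are
   coefficients of [w]: [pd] becomes [3 pl], while [pa] and [pa'] become [pN] and [pN']. *)
exists (Param (qe X 0 0 0 0) (qf X 0 0 0 0) (qf Y 0 0 0 0) (qg X 0 0 0 0) (qg Y 0 0 0 0)
  (qh X 0 0 0 0) (qh Y 0 0 0 0) (- f3' / j) x1 y1 (- g3') (- g3) (pd p / 3) (pa p) (pa' p)
  (- g4' / j)).
have three0 : 3 != 0 :> C by rewrite pnatr_eq0.
have two0 : 2 != 0 :> C by rewrite pnatr_eq0.
split=> z1 z2 t w.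
  have [-> -> -> ->] := Xw z1 z2 t w; have [-> ->] := Xfg z1 z2 t.
  rewrite /= (eX z1 z2 t) (hX z1 z2 t) e0 N0 N'0 k0 m0 m'0 n0 M0 M'0 l0 b0 b'0 c'0 c0 g3E /=; split; field; rewrite ?j0 ?three0 ?two0 //.
have [/= -> -> -> ->] := Yw z1 z2 t w; have [-> ->] := Yfg z1 z2 t.
rewrite /= (eY z1 z2 t) (hY z1 z2 t) N0 N'0 k0 m0 m'0 n0 M0 M'0 l0 b0 b'0 c'0 c0 f3E f4E g4E /=; split; field; rewrite ?j0 ?three0 ?two0 //.
Qed.

(** * Degree in w and the classification by finite differences *)

Definition wsize (C : numFieldType) (n : nat) (F : C -> C -> C -> C -> C) : Prop :=
  forall z1 z2 t, exists p : {poly C},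
    (size p <= n)%N /\ forall w, F z1 z2 t w = p.[w].

Definition wsizeq (C : numFieldType) (n : nat) (X : quad C) : Prop :=
  [/\ wsize n (qf X), wsize n (qg X), wsize n (qh X) & wsize n (qe X)].

Definition dw (C : numFieldType) (F : C -> C -> C -> C -> C) :=
  fun z1 z2 t w => F z1 z2 t (w + 1) - F z1 z2 t w.

Definition dwq (C : numFieldType) (X : quad C) : quad C :=
  Quad (dw (qf X)) (dw (qg X)) (dw (qh X)) (dw (qe X)).

Lemma wsize_dw (C : numFieldType) n (F : C -> C -> C -> C -> C) :
  wsize n.+1 F -> wsize n (dw F).
Proof.
move=> H z1 z2 t; have [p [sp hp]] := H z1 z2 t.
exists (p \Po ('X + 1%:P) - p); split; first exact: size_poly_diff.
by move=> w; rewrite /dw !hp hornerD hornerN horner_comp hornerD hornerX hornerC.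
Qed.

Lemma axis_poly_dw (C : numFieldType) (F : C -> C -> C -> C -> C) :
  axis_poly F -> axis_poly (dw F).
Proof.
move=> H w; have [a b c] := H w; have [a' b' c'] := H (w + 1).
by split; rewrite /dw; solve_upoly.
Qed.

Lemma upoly_dw_eq (C : numFieldType) (F E : C -> C) :
  upoly F -> upoly E -> E 0 = 0 ->
  (forall w, F (w + 1) - F w = E (w + 1) - E w) -> forall w, F w = F 0 + E w.
Proof.
move=> uF uE E0 H w.
have [p hp] : upoly (fun s => F s - E s) by solve_upoly.
have := @poly_periodic _ p _ w.
rewrite -!hp E0 subr0 => <-; first by rewrite subrK.
move=> s; rewrite -!hp; apply/eqP; rewrite -subr_eq0; apply/eqP.
by have /eqP := H s; rewrite -subr_eq0 => /eqP HH; rewrite -[RHS]HH; ring.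
Qed.

(* Induction on the degree in [w]: real translations in [w] preserve tangency, so
   the difference [X (w + 1) - X w] is tangent and of smaller degree. *)
Lemma fam_classify (C : numFieldType) (j : C) n (X Y : quad C) :
  j != 0 -> polar_tangent j X Y -> axis_polyq X -> axis_polyq Y ->
  wsizeq n X -> wsizeq n Y ->
  exists p, in_fam j p X /\ in_fam (- j) (swap p) Y.
Proof.
move=> j0; elim: n X Y => [|n IH] X Y H Xa Ya [Xf Xg Xh Xe] [Yf Yg Yh Ye].
  have Z F : wsize 0 F -> forall z1 z2 t w : C, F z1 z2 t w = 0.
    move=> HF z1 z2 t w; have [p [sp ->]] := HF z1 z2 t.
    by move: sp; rewrite leqn0 size_poly_eq0 => /eqP ->; rewrite horner0.
  exists (Param 0 0 0 0 0 0 0 0 0 0 0 0 0 0 0 0).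
  by split=> z1 z2 t w; rewrite /= !Z //; split; ring.
have [p [Xp Yp]] : exists p, in_fam j p (dwq X) /\ in_fam (- j) (swap p) (dwq Y).
  apply: IH.
  - move=> z1 z2 t a1 a2 b v w; have := H z1 z2 t a1 a2 b v.
    have := H z1 z2 t a1 a2 b (v + 1); rewrite /= (_ : v + 1 + _ = w + 1); last by rewrite /w; ring.
    rewrite /= -/w /dw => /eqP; rewrite -subr_eq0 => /eqP E2.
    move=> /eqP; rewrite -subr_eq0 => /eqP E1.
    by apply/eqP; rewrite -subr_eq0; apply/eqP; apply: (eq0_lincomb (x := -1) (y := 1) E1 E2); ring.
  - by case: Xa => a b c; split; apply: axis_poly_dw.
  - by case: Ya => a b c; split; apply: axis_poly_dw.
  - by split; apply: wsize_dw.
  - by split; apply: wsize_dw.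
have two0 : 2 != 0 :> C by rewrite pnatr_eq0.
have U F z1 z2 t : wsize n.+1 F -> upoly (fun w : C => F z1 z2 t w).
  by move=> HF; have [q [_ hq]] := HF z1 z2 t; exists q.
have W (k : C) q Z : in_fam k q (dwq Z) -> wsizeq n.+1 Z -> in_fam_sum k q Z.
  move=> Zp [Zf Zg Zh Ze] z1 z2 t w; split.
  - rewrite -addrA; move: w; apply: upoly_dw_eq.
    + by apply: (U (qf Z)).
    + by solve_upoly.
    + by field.
    + by move=> s; have [/= + + + +] := Zp z1 z2 t s; rewrite /dw => Q1 Q2 Q3 Q4; rewrite ?Q1 ?Q2 ?Q3 ?Q4; field.
  - move: w; apply: upoly_dw_eq.
    + by apply: (U (qg Z)).
    + by solve_upoly.
    + by field.
    + by move=> s; have [/= + + + +] := Zp z1 z2 t s; rewrite /dw => Q1 Q2 Q3 Q4; rewrite ?Q1 ?Q2 ?Q3 ?Q4; field.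
  - move: w; apply: upoly_dw_eq.
    + by apply: (U (qh Z)).
    + by solve_upoly.
    + by field.
    + by move=> s; have [/= + + + +] := Zp z1 z2 t s; rewrite /dw => Q1 Q2 Q3 Q4; rewrite ?Q1 ?Q2 ?Q3 ?Q4; field.
  - rewrite -addrA; move: w; apply: upoly_dw_eq.
    + by apply: (U (qe Z)).
    + by solve_upoly.
    + by field.
    + by move=> s; have [/= + + + +] := Zp z1 z2 t s; rewrite /dw => Q1 Q2 Q3 Q4; rewrite ?Q1 ?Q2 ?Q3 ?Q4; field.
by apply: (fam_step j0 H Xa Ya (p := p)); apply: W.
Qed.

(** * The norm on R[i] and polynomial functions of several variables *)

Lemma cnormE (R : realType) (x : R[i]) : (cnorm x)%:C = `|x|.
Proof. by rewrite normc_def. Qed.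

Lemma cnorm_ge0 (R : realType) (x : R[i]) : 0 <= cnorm x.
Proof. exact: sqrtr_ge0. Qed.

Lemma cnormM (R : realType) (x y : R[i]) : cnorm (x * y) = cnorm x * cnorm y.
Proof. by apply: complexI; rewrite rmorphM /= !cnormE normrM. Qed.

Lemma cnormD (R : realType) (x y : R[i]) : cnorm (x + y) <= cnorm x + cnorm y.
Proof. by rewrite -lecR rmorphD /= !cnormE ler_normD. Qed.

Lemma cnormN (R : realType) (x : R[i]) : cnorm (- x) = cnorm x.
Proof. by apply: complexI; rewrite !cnormE normrN. Qed.

Lemma cnormB (R : realType) (x y : R[i]) : cnorm (x - y) <= cnorm x + cnorm y.
Proof. by apply: le_trans (cnormD _ _) _; rewrite cnormN. Qed.

Lemma cnorm_real (R : realType) (x : R) : cnorm x%:C = `|x|.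
Proof. by rewrite /cnorm /= expr0n addr0 sqrtr_sqr. Qed.

Lemma cnorm0 (R : realType) : cnorm (0 : R[i]) = 0.
Proof. by rewrite (cnorm_real 0) normr0. Qed.

Lemma cnorm1 (R : realType) : cnorm (1 : R[i]) = 1.
Proof. by rewrite (cnorm_real 1) normr1. Qed.

Lemma cnorm_le0 (R : realType) (x : R[i]) : cnorm x <= 0 -> x = 0.
Proof.
by rewrite -lecR cnormE normr_le0 => /eqP.
Qed.

Lemma cnorm_cj (R : realType) (x : R[i]) : cnorm (cj x) = cnorm x.
Proof. by case: x => a b; rewrite /cnorm /= sqrrN. Qed.

Lemma cnorm_ci (R : realType) : cnorm (ci R) = 1.
Proof. by rewrite /cnorm /= expr0n add0r expr1n sqrtr1. Qed.

Lemma cnormX (R : realType) (x : R[i]) n : cnorm (x ^+ n) = cnorm x ^+ n.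
Proof. by elim: n => [|n IH]; rewrite ?expr0 ?cnorm1 // !exprS cnormM IH. Qed.

Lemma Re_le_cnorm (R : realType) (x : R[i]) : `|complex.Re x| <= cnorm x.
Proof.
case: x => a b; rewrite /cnorm /= -sqrtr_sqr ler_sqrt ?addr_ge0 ?sqr_ge0 //.
by rewrite lerDl sqr_ge0.
Qed.

Lemma Im_le_cnorm (R : realType) (x : R[i]) : `|complex.Im x| <= cnorm x.
Proof.
case: x => a b; rewrite /cnorm /= -sqrtr_sqr ler_sqrt ?addr_ge0 ?sqr_ge0 //.
by rewrite lerDr sqr_ge0.
Qed.

Lemma cnorm_le_ReIm (R : realType) (x : R[i]) :
  cnorm x <= `|complex.Re x| + `|complex.Im x|.
Proof.
have -> : x = (complex.Re x)%:C + ci R * (complex.Im x)%:C.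
  by rewrite {1}(complexE x).
apply: le_trans (cnormD _ _) _; rewrite cnormM cnorm_ci mul1r !cnorm_real.
by case: x => a b /=; rewrite !mul0r !mul1r !(subr0, addr0, add0r, mulr0).
Qed.

Lemma cnorm_sum (R : realType) (I : Type) (s : seq I) (F : I -> R[i]) :
  cnorm (\sum_(i <- s) F i) <= \sum_(i <- s) cnorm (F i).
Proof.
elim: s => [|a s IH]; first by rewrite !big_nil cnorm0.
by rewrite !big_cons (le_trans (cnormD _ _)) // lerD2l.
Qed.

Lemma cnorm_prod (R : realType) (I : Type) (s : seq I) (F : I -> R[i]) :
  cnorm (\prod_(i <- s) F i) = \prod_(i <- s) cnorm (F i).
Proof.
elim: s => [|a s IH]; first by rewrite !big_nil cnorm1.
by rewrite !big_cons cnormM IH.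
Qed.

(** Polynomial functions as the closure of constants and variables under sum and product:
    substitution, conjugation, restriction to lines and Lipschitz bounds are then structural
    inductions. *)
Inductive polyfun (C : numFieldType) (I : Type) : ((I -> C) -> C) -> Prop :=
| polyfun_const c : polyfun (fun=> c)
| polyfun_var i : polyfun (fun x => x i)
| polyfun_add F G : polyfun F -> polyfun G -> polyfun (fun x => F x + G x)
| polyfun_mul F G : polyfun F -> polyfun G -> polyfun (fun x => F x * G x).

Lemma polyfun_opp (C : numFieldType) (I : Type) (F : (I -> C) -> C) :
  polyfun F -> polyfun (fun x => - F x).
Proof.
move=> pF; rewrite (_ : (fun x => - F x) = fun x => (-1) * F x).
  by apply: polyfun_mul => //; apply: polyfun_const.
by apply: funext => x; rewrite mulN1r.
Qed.

Lemma polyfun_exp (C : numFieldType) (I : Type) (F : (I -> C) -> C) n :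
  polyfun F -> polyfun (fun x => F x ^+ n).
Proof.
move=> pF; elim: n => [|n IH]; first exact: polyfun_const.
rewrite (_ : (fun x => _) = fun x => F x * F x ^+ n).
  exact: polyfun_mul.
by apply: funext => x; rewrite exprS.
Qed.

Lemma polyfun_sum (C : numFieldType) (I J : Type) (s : seq J)
    (F : J -> (I -> C) -> C) :
  (forall i, polyfun (F i)) -> polyfun (fun x => \sum_(i <- s) F i x).
Proof.
move=> pF; elim: s => [|a s IH].
  rewrite (_ : (fun x => _) = fun=> 0); first exact: polyfun_const.
  by apply: funext => x; rewrite big_nil.
rewrite (_ : (fun x => _) = fun x => F a x + \sum_(i <- s) F i x).
  exact: polyfun_add.
by apply: funext => x; rewrite big_cons.
Qed.

Lemma polyfun_prod (C : numFieldType) (I J : Type) (s : seq J)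
    (F : J -> (I -> C) -> C) :
  (forall i, polyfun (F i)) -> polyfun (fun x => \prod_(i <- s) F i x).
Proof.
move=> pF; elim: s => [|a s IH].
  rewrite (_ : (fun x => _) = fun=> 1); first exact: polyfun_const.
  by apply: funext => x; rewrite big_nil.
rewrite (_ : (fun x => _) = fun x => F a x * \prod_(i <- s) F i x).
  exact: polyfun_mul.
by apply: funext => x; rewrite big_cons.
Qed.

Lemma polyfun_comp (C : numFieldType) (I J : Type) (F : (I -> C) -> C)
    (G : I -> (J -> C) -> C) :
  polyfun F -> (forall i, polyfun (G i)) -> polyfun (fun x => F (fun i => G i x)).
Proof.
move=> pF pG; elim: pF => [c|i|F1 F2 _ I1 _ I2|F1 F2 _ I1 _ I2].
- exact: polyfun_const.
- exact: pG.
- exact: polyfun_add.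
- exact: polyfun_mul.
Qed.

(** The degree bound [n] is uniform over all lines; this supplies the degree in [w] on which the
    classification inducts. *)
Lemma polyfun_line (C : numFieldType) (I : Type) (F : (I -> C) -> C) :
  polyfun F -> exists n, forall x v : I -> C, exists p : {poly C},
    (size p <= n)%N /\ forall s, F (fun i => x i + s * v i) = p.[s].
Proof.
elim=> [c|i|F1 F2 _ [n1 H1] _ [n2 H2]|F1 F2 _ [n1 H1] _ [n2 H2]].
- exists 1%N => x v; exists c%:P; rewrite size_polyC leq_b1; split=> // s.
  by rewrite hornerC.
- exists 2%N => x v; exists ((x i)%:P + v i *: 'X); split.
    rewrite addrC -mul_polyC -cons_poly_def size_cons_poly.
    by case: ifP => // _; rewrite ltnS size_polyC leq_b1.
  by move=> s; rewrite hornerD hornerC hornerZ hornerX mulrC.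
- exists (maxn n1 n2) => x v.
  have [p [sp hp]] := H1 x v; have [q [sq hq]] := H2 x v.
  exists (p + q); split; last by move=> s; rewrite hornerD hp hq.
  apply: leq_trans (size_polyD _ _) _.
  by rewrite geq_max !leq_max sp sq orbT.
- exists (n1 + n2)%N => x v.
  have [p [sp hp]] := H1 x v; have [q [sq hq]] := H2 x v.
  exists (p * q); split; last by move=> s; rewrite hornerM hp hq.
  apply: leq_trans (size_polyMleq _ _) _.
  by apply: leq_trans (leq_pred _) _; apply: leq_add.
Qed.

Lemma polyfun_cj (R : realType) (I : Type) (F : (I -> R[i]) -> R[i]) :
  polyfun F -> polyfun (fun x => cj (F (fun i => cj (x i)))).
Proof.
elim=> [c|i|F1 F2 _ I1 _ I2|F1 F2 _ I1 _ I2].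
- exact: polyfun_const.
- rewrite (_ : (fun x => _) = fun x => x i); first exact: polyfun_var.
  by apply: funext => x; rewrite /cj conjcK.
- rewrite (_ : (fun x => _) = fun x => cj (F1 (fun i => cj (x i))) + cj (F2 (fun i => cj (x i)))).
    exact: polyfun_add.
  by apply: funext => x; rewrite /cj rmorphD.
- rewrite (_ : (fun x => _) = fun x => cj (F1 (fun i => cj (x i))) * cj (F2 (fun i => cj (x i)))).
    exact: polyfun_mul.
  by apply: funext => x; rewrite /cj rmorphM.
Qed.

(** The sup bound and the Lipschitz bound are proved together, with one constant, because the
    Lipschitz estimate of a product needs the sup bounds of its factors. *)
Lemma polyfun_lip (R : realType) (I : Type) (F : (I -> R[i]) -> R[i]) (M : R) :
  0 <= M -> polyfun F ->
  exists2 L : R, 0 <= L & forall (x y : I -> R[i]) (d : R),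
    (forall i, cnorm (x i) <= M) -> (forall i, cnorm (y i) <= M) ->
    (forall i, cnorm (x i - y i) <= d) -> 0 <= d ->
    cnorm (F x) <= L /\ cnorm (F x - F y) <= L * d.
Proof.
move=> M0; elim=> [c|i|F1 F2 _ [L1 p1 H1] _ [L2 p2 H2]|F1 F2 _ [L1 p1 H1] _ [L2 p2 H2]].
- exists (cnorm c); first exact: cnorm_ge0.
  by move=> x y d _ _ _ d0; rewrite subrr cnorm0 mulr_ge0 ?cnorm_ge0.
- exists (M + 1); first by rewrite addr_ge0.
  move=> x y d hx hy hd d0; split; first by rewrite (le_trans (hx i)) // lerDl.
  by rewrite (le_trans (hd i)) // ler_peMl // lerDr.
- exists (L1 + L2); first exact: addr_ge0.
  move=> x y d hx hy hd d0.
  have [a1 b1] := H1 x y d hx hy hd d0; have [a2 b2] := H2 x y d hx hy hd d0.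
  split; first by rewrite (le_trans (cnormD _ _)) // lerD.
  rewrite opprD addrACA (le_trans (cnormD _ _)) // mulrDl lerD //.
- exists (L1 * L2 + L1 * L2); first by rewrite addr_ge0 ?mulr_ge0.
  move=> x y d hx hy hd d0.
  have [a1 b1] := H1 x y d hx hy hd d0; have [a2 b2] := H2 x y d hx hy hd d0.
  have [a3 _] := H2 y y 0 hy hy (fun i => ltac:(by rewrite subrr cnorm0)) (lexx _).
  split; first by rewrite cnormM (le_trans (ler_pM _ _ a1 a2)) ?cnorm_ge0 // lerDl mulr_ge0.
  have -> : F1 x * F2 x - F1 y * F2 y = F1 x * (F2 x - F2 y) + (F1 x - F1 y) * F2 y by ring.
  rewrite (le_trans (cnormD _ _)) // [(_ + _) * d]mulrDl lerD // cnormM.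
    by rewrite -mulrA ler_pM ?cnorm_ge0.
  by rewrite mulrAC ler_pM ?cnorm_ge0.
Qed.

(** A small real box is a uniqueness set. The first [k] coordinates are already allowed to be
    complex; the next one is freed because the restriction to its line is a polynomial in one
    variable with the infinitely many real zeros [eps / 2 / m.+1]. *)
Lemma polyfun_real_zero (R : realType) n (F : ('I_n -> R[i]) -> R[i]) (eps : R) :
  0 < eps -> polyfun F ->
  (forall x : 'I_n -> R, (forall i, `|x i| < eps) -> F (fun i => (x i)%:C) = 0) ->
  forall x, F x = 0.
Proof.
move=> e0 pF H; have [N line] := polyfun_line pF.
suff G k : (k <= n)%N -> forall x : 'I_n -> R[i],
    (forall i : 'I_n, (k <= i)%N -> exists2 r : R, `|r| < eps & x i = r%:C) -> F x = 0.
  by move=> x; apply: (G n) => // i; rewrite leqNgt ltn_ord.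
elim: k => [_ x hx|k IH kn x hx].
  have {hx} hx i : {r : R | `|r| < eps /\ x i = r%:C}.
    by apply: cid; have [r] := hx i isT; exists r.
  rewrite (_ : x = fun i => (sval (hx i))%:C).
    by apply: H => i; case: (hx i) => r [].
  by apply: funext => i; case: (hx i) => r [].
pose i0 := Ordinal kn.
pose x0 i := if i == i0 then 0 else x i.
pose v (i : 'I_n) : R[i] := if i == i0 then 1 else 0.
have [p [_ hp]] := line x0 v.
have xE : x = fun i => x0 i + x i0 * v i.
  apply: funext => i; rewrite /x0 /v; case: eqVneq => [->|_].
    by rewrite add0r mulr1.
  by rewrite mulr0 addr0.
rewrite xE hp (_ : p = 0) ?horner0 //.
apply: (@poly_eq0_nat _ _ (eps / 2)%:C) => [|m].
  by rewrite fmorph_eq0 gt_eqF // divr_gt0.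
rewrite -hp; apply: IH => [|i ki]; first exact: ltnW.
rewrite /x0 /v; case: eqVneq => [_|ni].
  exists (eps / 2 / m.+1%:R); last first.
    by rewrite add0r mulr1 [RHS]rmorphM [in RHS]fmorphV [in RHS]rmorph_nat.
  rewrite ger0_norm ?divr_ge0 ?ltW //.
  rewrite ltr_pdivrMr ?ltr0Sn // ltr_pdivrMr //.
  rewrite -[X in X < _]mulr1 -mulrA ltr_pM2l // -natrM ltr1n; lia.
have : (k < i)%N.
  by rewrite ltn_neqAle ki andbT; apply: contraNneq ni => e; apply/eqP/val_inj.
by move/hx => [r r1 r2]; exists r => //; rewrite mulr0 addr0.
Qed.

(** * Power series and weighted dilations *)

Lemma box_sum_stable (T : zmodType) (k N0 N : nat) (G : {ffun 'I_k -> nat} -> T) :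
  (N0 <= N)%N -> (forall (a : {ffun 'I_k -> nat}) j, (N0 <= a j)%N -> G a = 0) ->
  \sum_(a : {ffun 'I_k -> 'I_N}) G (mexp a) =
  \sum_(a : {ffun 'I_k -> 'I_N0}) G (mexp a).
Proof.
move=> le H.
pose h (b : {ffun 'I_k -> 'I_N0}) : {ffun 'I_k -> 'I_N} :=
  [ffun j => widen_ord le (b j)].
have hE b : mexp (h b) = mexp b by apply/ffunP => j; rewrite !ffunE.
have hI : injective h.
  move=> b b' /ffunP e; apply/ffunP => j; apply/val_inj.
  by have := e j; rewrite !ffunE => /(congr1 val).
rewrite (bigID (mem (h @: [set: {ffun 'I_k -> 'I_N0}]))) /=.
rewrite [X in _ + X]big1 ?addr0.
  rewrite big_imset /=; last by move=> b b' _ _; apply: hI.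
  by apply: eq_big => [b|b _]; rewrite ?inE ?hE.
move=> a /negP na; apply: contra_notP na => nz.
have lt j : (a j < N0)%N.
  rewrite ltnNge; apply/negP => aj; apply: nz; apply: (H _ j).
  by rewrite ffunE.
apply/imsetP; exists [ffun j => Ordinal (lt j)]; first by rewrite inE.
by apply/ffunP => j; apply/val_inj; rewrite !ffunE.
Qed.

Definition weight (k : nat) (wt : 'I_k -> nat) (a : {ffun 'I_k -> nat}) : nat :=
  \sum_(j < k) wt j * a j.

Definition trunc (C : nmodType) (k : nat) (wt : 'I_k -> nat) (m : nat)
    (c : {ffun 'I_k -> nat} -> C) (a : {ffun 'I_k -> nat}) : C :=
  if weight wt a == m then c a else 0.

Definition scale (C : pzRingType) (k : nat) (wt : 'I_k -> nat) (t : C)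
  (x : 'I_k -> C) : 'I_k -> C := fun j => t ^+ wt j * x j.

Lemma weight_ge (k : nat) (wt : 'I_k -> nat) (a : {ffun 'I_k -> nat}) j :
  (0 < wt j)%N -> (a j <= weight wt a)%N.
Proof.
by move=> w0; rewrite /weight (bigD1 j) //=; apply: leq_trans (leq_addr _ _); rewrite leq_pmull.
Qed.

Lemma prod_scale (C : comPzRingType) (k : nat) (wt : 'I_k -> nat) (t : C)
    (x : 'I_k -> C) (a : {ffun 'I_k -> nat}) :
  \prod_(j < k) scale wt t x j ^+ a j = t ^+ weight wt a * \prod_(j < k) x j ^+ a j.
Proof.
rewrite /weight /scale -prodrXr -big_split /=; apply: eq_bigr => j _.
by rewrite exprMn exprM.
Qed.

Lemma psum_trunc_stable (R : realType) k (wt : 'I_k -> nat) m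
    (c : {ffun 'I_k -> nat} -> R[i]) x N0 N :
  (forall j, (0 < wt j)%N) -> (m < N0)%N -> (N0 <= N)%N ->
  psum (trunc wt m c) x N = psum (trunc wt m c) x N0.
Proof.
move=> w0 mN le; rewrite /psum.
apply: (box_sum_stable (G := fun a => trunc wt m c a * \prod_(j < k) x j ^+ a j)) => //.
move=> a j aj; rewrite /trunc; case: eqP => [wa|]; last by rewrite mul0r.
have := weight_ge a (w0 j); rewrite wa => /(leq_trans aj) /(leq_trans mN).
by rewrite ltnn.
Qed.

Lemma pabs_le (R : realType) k (c : {ffun 'I_k -> nat} -> R[i]) x y N :
  (forall j, cnorm (x j) <= cnorm (y j)) -> pabs c x N <= pabs c y N.
Proof.
move=> le; apply: ler_sum => a _; apply: ler_wpM2l; first exact: cnorm_ge0.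
by apply: ler_prod => j _; rewrite exprn_ge0 ?cnorm_ge0 // lerXn2r ?nnegrE ?cnorm_ge0.
Qed.

Lemma series_at_eps (R : realType) k (c : {ffun 'I_k -> nat} -> R[i]) x v (e : R) :
  series_at c x v -> 0 < e ->
  exists N0, forall N, (N0 <= N)%N -> cnorm (psum c x N - v) <= e.
Proof.
move=> [_ [hr hi]] e0.
have e2 : 0 < e / 2 by rewrite divr_gt0.
move/cvgrPdist_lt: hr => /(_ _ e2) [N1 _ H1].
move/cvgrPdist_lt: hi => /(_ _ e2) [N2 _ H2].
exists (maxn N1 N2) => N; rewrite geq_max => /andP[h1 h2].
apply: le_trans (cnorm_le_ReIm _) _.
rewrite (splitr e) !raddfB /=; apply: lerD.
  by rewrite distrC ltW // H1.
by rewrite distrC ltW // H2.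
Qed.

Lemma series_at_bound (R : realType) k (c : {ffun 'I_k -> nat} -> R[i]) x v T (B : R) N0 :
  series_at c x v -> (forall N, (N0 <= N)%N -> cnorm (psum c x N - T) <= B) ->
  cnorm (v - T) <= B.
Proof.
move=> s H; apply/ler_addgt0Pr => e e0.
have [N1 H1] := series_at_eps s e0.
have -> : v - T = (psum c x (maxn N0 N1) - T) - (psum c x (maxn N0 N1) - v) by ring.
apply: le_trans (cnormB _ _) _; apply: lerD; first by apply: H; rewrite leq_maxl.
by apply: H1; rewrite leq_maxr.
Qed.

(** Weights below [m] are absent, weight [m] cancels exactly, and every higher weight has a factor
    [t ^+ m.+1], the rest being dominated by the absolute series at radius [rho]. *)
Lemma series_leading (R : realType) k (wt : 'I_k -> nat) m
    (c : {ffun 'I_k -> nat} -> R[i]) (rho B : R) (t : R) (y : 'I_k -> R[i]) v :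
  (forall j, (0 < wt j)%N) ->
  (forall a, (weight wt a < m)%N -> c a = 0) ->
  0 <= rho -> (forall N, pabs c (fun=> rho%:C) N <= B) ->
  0 <= t <= 1 -> (forall j, cnorm (y j) <= rho) ->
  series_at c (scale wt t%:C y) v ->
  cnorm (v - t%:C ^+ m * psum (trunc wt m c) y m.+1) <= t ^+ m.+1 * B.
Proof.
move=> w0 cm r0 HB /andP[t0 t1] hy s.
apply: (series_at_bound (N0 := m.+1) s) => N mN.
rewrite -(psum_trunc_stable c y w0 (ltnSn m) mN) /psum mulr_sumr -sumrB.
apply: le_trans (cnorm_sum _ _) _.
apply: le_trans (_ : t ^+ m.+1 * pabs c (fun=> rho%:C) N <= _); last first.
  by rewrite ler_wpM2l ?exprn_ge0.
rewrite /pabs mulr_sumr; apply: ler_sum => a _.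
rewrite prod_scale /trunc; set b := mexp a.
have Hmon : cnorm (\prod_(j < k) y j ^+ b j) <= \prod_(j < k) cnorm rho%:C ^+ b j.
  rewrite cnorm_prod; apply: ler_prod => j _; rewrite cnormX.
  rewrite exprn_ge0 ?cnorm_ge0 //= lerXn2r ?nnegrE ?cnorm_ge0 //.
  by rewrite cnorm_real ger0_norm.
case: (ltngtP (weight wt b) m) => [/cm ->|lt|->].
- by rewrite !mul0r mulr0 subrr cnorm0 mul0r mulr0.
- rewrite mul0r mulr0 subr0 mulrCA !cnormM.
  apply: ler_pM; rewrite ?cnorm_ge0 ?mulr_ge0 ?cnorm_ge0 //.
    by rewrite cnormX cnorm_real ger0_norm // ler_wiXn2l.
  by apply: ler_wpM2l => //; apply: cnorm_ge0.
- rewrite mulrCA subrr cnorm0 !mulr_ge0 ?exprn_ge0 ?cnorm_ge0 ?prodr_ge0 //.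
  by move=> j _; rewrite exprn_ge0 ?cnorm_ge0.
Qed.

(** * Formal derivatives of power series *)

(** The product rule for a monomial, unfolded along the same list as the big product. For [a j = 0]
    the truncated exponent is harmless, the factor [(a j)%:R] being 0. *)
Fixpoint dmon_seq (C : comPzRingType) (k : nat) (x v : 'I_k -> C)
    (a : {ffun 'I_k -> nat}) (s : seq 'I_k) : C :=
  if s is j :: s' then
    (a j)%:R * (v j * x j ^+ (a j).-1) * \prod_(i <- s') x i ^+ a i
    + x j ^+ a j * dmon_seq x v a s'
  else 0.

Definition dmon (C : comPzRingType) (k : nat) (x v : 'I_k -> C)
  (a : {ffun 'I_k -> nat}) : C := dmon_seq x v a (index_enum 'I_k).

Definition dpsum (R : realType) (k : nat) (c : {ffun 'I_k -> nat} -> R[i])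
  (x v : 'I_k -> R[i]) (N : nat) : R[i] :=
  \sum_(a : {ffun 'I_k -> 'I_N}) c (mexp a) * dmon x v (mexp a).

Lemma dmon_lincomb (C : comPzRingType) k n (x : 'I_k -> C) (lam : 'I_n -> C)
    (v : 'I_n -> 'I_k -> C) a :
  dmon x (fun j => \sum_(i < n) lam i * v i j) a = \sum_(i < n) lam i * dmon x (v i) a.
Proof.
rewrite /dmon; elim: (index_enum 'I_k) => [|j s IH] /=.
  by rewrite big1 // => i _; rewrite mulr0.
rewrite IH mulr_suml mulr_sumr mulr_suml mulr_sumr -big_split /=.
by apply: eq_bigr => i _; ring.
Qed.

Lemma dmonZ (C : comPzRingType) k (x : 'I_k -> C) (lam : C) (v : 'I_k -> C) a :
  dmon x (fun j => lam * v j) a = lam * dmon x v a.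
Proof.
have := dmon_lincomb x (fun=> lam) (fun _ : 'I_1 => v) a.
rewrite big_ord1 => <-; congr dmon.
by apply: funext => j; rewrite big_ord1.
Qed.

(* A first-order expansion with quadratic remainder, in a form closed under
   products because [M] dominates the sum of the norms of all coefficients. *)
Definition expands (R : realType) (A : R -> R[i]) (A0 A1 : R[i]) (M : R) : Prop :=
  forall t : R, `|t| <= 1 -> exists2 al : R[i],
    A t = A0 + t%:C * A1 + t%:C ^+ 2 * al & cnorm A0 + cnorm A1 + cnorm al <= M.

(** Each of the nine products of coefficient norms occurs exactly once in the new expansion, up to
    powers of [t] of norm at most 1; hence the bounds simply multiply. *)
Lemma expands_mul (R : realType) (A B : R -> R[i]) (A0 A1 B0 B1 : R[i]) (M N : R) :
  expands A A0 A1 M -> expands B B0 B1 N ->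
  expands (fun t => A t * B t) (A0 * B0) (A1 * B0 + A0 * B1) (M * N).
Proof.
move=> HA HB t t1; have [al -> hal] := HA t t1; have [be -> hbe] := HB t t1.
exists (A0 * be + al * B0 + A1 * B1 + t%:C * (A1 * be + al * B1)
        + t%:C ^+ 2 * (al * be)); first by ring.
have T x : cnorm (t%:C * x) <= cnorm x.
  by rewrite cnormM cnorm_real ler_piMl ?cnorm_ge0.
have T2 x : cnorm (t%:C ^+ 2 * x) <= cnorm x.
  by rewrite expr2 -mulrA (le_trans (T _)) ?T.
apply: (@le_trans _ _ ((cnorm A0 + cnorm A1 + cnorm al) * (cnorm B0 + cnorm B1 + cnorm be))).
  have K1 := cnormD (A1 * B0) (A0 * B1).
  have K2 := cnormD (A0 * be + al * B0 + A1 * B1 + t%:C * (A1 * be + al * B1))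
    (t%:C ^+ 2 * (al * be)).
  have K3 := cnormD (A0 * be + al * B0 + A1 * B1) (t%:C * (A1 * be + al * B1)).
  have K4 := cnormD (A0 * be + al * B0) (A1 * B1).
  have K5 := cnormD (A0 * be) (al * B0).
  have K6 := T (A1 * be + al * B1).
  have K7 := cnormD (A1 * be) (al * B1).
  have K8 := T2 (al * be).
  rewrite !cnormM in K1 K4 K5 K7 *.
  rewrite (cnormM al be) in K8.
  lra.
by apply: ler_pM => //; rewrite !addr_ge0 ?cnorm_ge0.
Qed.

Lemma expands_pow (R : realType) (x v : R[i]) n :
  expands (fun t => (x + t%:C * v) ^+ n) (x ^+ n) (n%:R * (v * x ^+ n.-1))
    ((cnorm x + cnorm v) ^+ n).
Proof.
elim: n => [|n IH].
  by move=> t _; exists 0; rewrite ?mul0r ?mulr0 ?addr0 ?cnorm0 ?cnorm1 ?addr0.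
have base : expands (fun t => x + t%:C * v) x v (cnorm x + cnorm v).
  by move=> t _; exists 0; rewrite ?mulr0 ?addr0 ?cnorm0 ?addr0.
have := expands_mul base IH; rewrite -!exprS.
rewrite (_ : v * x ^+ n + x * (n%:R * (v * x ^+ n.-1)) = n.+1%:R * (v * x ^+ n.+1.-1)).
  move=> H t t1; have [al e l] := H t t1; exists al => //.
  by rewrite exprS e.
case: n {IH} => [|n]; first by rewrite mul0r mulr0 addr0 mul1r.
by rewrite /= -(natr1 n.+1) exprS; ring.
Qed.

Lemma expands_mon (R : realType) k (x v : 'I_k -> R[i]) (a : {ffun 'I_k -> nat}) :
  expands (fun t => \prod_(j < k) (x j + t%:C * v j) ^+ a j)
    (\prod_(j < k) x j ^+ a j) (dmon x v a)
    (\prod_(j < k) (cnorm (x j) + cnorm (v j)) ^+ a j).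
Proof.
rewrite /dmon; elim: (index_enum _) => [|j s IH].
  by move=> t _; exists 0; rewrite !big_nil /= ?mulr0 ?addr0 ?cnorm0 ?cnorm1 ?addr0.
rewrite !big_cons /=; have H := expands_mul (expands_pow (x j) (v j) (a j)) IH.
by move=> t t1; have [al e l] := H t t1; exists al => //; rewrite big_cons e.
Qed.

Lemma dmon_le (R : realType) k (x v : 'I_k -> R[i]) (a : {ffun 'I_k -> nat}) :
  cnorm (dmon x v a) <= \prod_(j < k) (cnorm (x j) + cnorm (v j)) ^+ a j.
Proof.
have [|al _] := expands_mon x v a (t := 0); first by rewrite normr0.
by apply: le_trans; rewrite -addrA addrCA lerDl addr_ge0 ?cnorm_ge0.
Qed.

(** Summing the monomial expansions: the remainder is controlled uniformly in [N] as soon as the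
    absolute sums at the majorizing point [y] are bounded. *)
Lemma psum_taylor (R : realType) k (c : {ffun 'I_k -> nat} -> R[i])
    (x v y : 'I_k -> R[i]) N (t : R) :
  `|t| <= 1 -> (forall j, cnorm (x j) + cnorm (v j) <= cnorm (y j)) ->
  cnorm (psum c (fun j => x j + t%:C * v j) N - psum c x N - t%:C * dpsum c x v N)
    <= t ^+ 2 * pabs c y N.
Proof.
move=> t1 le; rewrite /psum /dpsum mulr_sumr -!sumrB.
apply: le_trans (cnorm_sum _ _) _; rewrite /pabs mulr_sumr; apply: ler_sum => a _.
have [al -> hal] := expands_mon x v (mexp a) t1.
rewrite (_ : _ - _ - _ = t%:C ^+ 2 * (c (mexp a) * al)); last by ring.
rewrite [cnorm _]cnormM cnormX [cnorm (c _ * _)]cnormM cnorm_real real_normK ?num_real // ler_wpM2l ?sqr_ge0 //.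
rewrite ler_wpM2l ?cnorm_ge0 //.
apply: le_trans (_ : _ <= \prod_(j < k) (cnorm (x j) + cnorm (v j)) ^+ mexp a j) _.
  by apply: le_trans hal; rewrite lerDr addr_ge0 ?cnorm_ge0.
apply: ler_prod => j _; rewrite exprn_ge0 ?addr_ge0 ?cnorm_ge0 //=.
by rewrite lerXn2r ?nnegrE ?addr_ge0 ?cnorm_ge0.
Qed.

Lemma dpsum_scale_le (R : realType) k (wt : 'I_k -> nat) m
    (c : {ffun 'I_k -> nat} -> R[i]) (t : R) (x v y : 'I_k -> R[i]) N :
  (forall a, c a != 0 -> (m <= weight wt a)%N) -> 0 <= t <= 1 ->
  (forall j, cnorm (x j) + cnorm (v j) <= cnorm (y j)) ->
  cnorm (dpsum c (scale wt t%:C x) (scale wt t%:C v) N) <= t ^+ m * pabs c y N.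
Proof.
move=> cm /andP[t0 t1] le; apply: le_trans (cnorm_sum _ _) _.
rewrite /pabs mulr_sumr; apply: ler_sum => a _; rewrite cnormM.
have [->|/cm wa] := eqVneq (c (mexp a)) 0; first by rewrite cnorm0 !mul0r mulr0.
rewrite mulrCA ler_wpM2l ?cnorm_ge0 //.
apply: le_trans (dmon_le _ _ _) _.
rewrite (eq_bigr (fun j => scale wt t (fun j => cnorm (x j) + cnorm (v j)) j ^+ mexp a j)).
  rewrite prod_scale; apply: ler_pM.
  - exact: exprn_ge0.
  - by apply: prodr_ge0 => j _; rewrite exprn_ge0 ?addr_ge0 ?cnorm_ge0.
  - by rewrite ler_wiXn2l.
  - apply: ler_prod => j _; rewrite exprn_ge0 ?addr_ge0 ?cnorm_ge0 //=.
    by rewrite lerXn2r ?nnegrE ?addr_ge0 ?cnorm_ge0.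
move=> j _; rewrite /scale !cnormM !cnormX cnorm_real ger0_norm // -mulrDr //.
Qed.

Lemma ReB (R : realType) (x y : R[i]) :
  complex.Re (x - y) = complex.Re x - complex.Re y.
Proof. by case: x; case: y. Qed.

(** * Tangency along a hypersurface v = 2Re(...) + phi *)

Definition q7 (R : realType) (p : pt R) : 'I_7 -> R[i] :=
  vars7 (p iz1) (p iz2) (p izeta) (complex.Re (p iw)).

(** The differential of [rhoQ] at [p], applied to [V]. *)
Definition dQ (R : realType) (p V : pt R) : R :=
  complex.Im (V iw) - 2 * complex.Re (V iz1 * cj (p izeta) + p iz1 * cj (V izeta)
    + V iz2 * cj (p izeta) ^+ 2 + 2 * p iz2 * cj (p izeta) * cj (V izeta)).

Lemma rhoQ_line (R : realType) (p V : pt R) : exists K2 K3 : R, forall t : R,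
  rhoQ (fun j => p j + t%:C * V j) = rhoQ p + t * dQ p V + t ^+ 2 * K2 + t ^+ 3 * K3.
Proof.
exists (- 2 * complex.Re (V iz1 * cj (V izeta) + p iz2 * cj (V izeta) ^+ 2
   + 2 * V iz2 * cj (p izeta) * cj (V izeta))).
exists (- 2 * complex.Re (V iz2 * cj (V izeta) ^+ 2)).
move=> t; rewrite /rhoQ /dQ /cj.
case: (p iz1) => a1 b1; case: (p iz2) => a2 b2; case: (p izeta) => a3 b3.
case: (p iw) => a4 b4; case: (V iz1) => c1 d1; case: (V iz2) => c2 d2.
case: (V izeta) => c3 d3; case: (V iw) => c4 d4 /=; ring.
Qed.

Lemma is_derive_eps (R : realType) (f : R -> R) (l e : R) :
  is_derive (0 : R) (1 : R) f l -> 0 < e ->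
  exists2 d : R, 0 < d & forall h, 0 < h < d -> `|(f h - f 0) - h * l| <= h * e.
Proof.
move=> [df fl] e0.
have : ((fun h => h^-1 *: (f (h *: 1 + 0) - f 0)) @ 0^' --> l)%classic by rewrite -fl; exact: df.
move/cvgrPdist_lt => /(_ _ e0) /nbhs_ballP[d /= d0 H].
exists d => // h /andP[h0 hd].
have := H h; rewrite /ball /= sub0r normrN gtr0_norm // => /(_ hd).
rewrite gt_eqF // => /(_ isT).
rewrite /GRing.scale /= mulr1 addr0 => /ltW K.
have -> : f h - f 0 - h * l = - (h * (l - h^-1 * (f h - f 0))).
  by field; rewrite gt_eqF.
by rewrite normrN normrM gtr0_norm // ler_pM2l.
Qed.

Lemma q7_line (R : realType) (p V : pt R) (t : R) :
  q7 (fun j => p j + t%:C * V j) = fun j => q7 p j + t%:C * q7 V j.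
Proof.
apply: funext => j; rewrite /q7 /vars7.
have C (z w : R[i]) : cj (z + t%:C * w) = cj z + t%:C * cj w.
  by rewrite /cj rmorphD rmorphM /= oppr0.
case: (nat_of_ord j) => [|[|[|[|[|[|n]]]]]] //.
case: (p iw) => a b; case: (V iw) => a' b' /=.
by apply/eqP; rewrite eq_complex /= !mul0r !mulr0 !subr0 !addr0 !eqxx.
Qed.

Lemma q7_norm (R : realType) (p : pt R) (rho : R) :
  (forall j, cnorm (p j) <= rho) -> forall j, cnorm (q7 p j) <= rho.
Proof.
move=> H j; rewrite /q7 /vars7.
case: (nat_of_ord j) => [|[|[|[|[|[|n]]]]]]; rewrite ?cnorm_cj //.
by rewrite cnorm_real (le_trans (Re_le_cnorm _)).
Qed.

Definition series_on7 (R : realType) (phi : R[i] -> R[i] -> R[i] -> R -> R)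
    (r : R) (c : {ffun 'I_7 -> nat} -> R[i]) : Prop :=
  forall z1 z2 zeta u, cnorm z1 < r -> cnorm z2 < r -> cnorm zeta < r ->
      `|u| < r -> series_at c (vars7 z1 z2 zeta u) (phi z1 z2 zeta u)%:C.

Definition phip (R : realType) (phi : R[i] -> R[i] -> R[i] -> R -> R) (p : pt R) :=
  phi (p iz1) (p iz2) (p izeta) (complex.Re (p iw)).

Lemma series_on7P (R : realType) phi (r : R) c (p : pt R) :
  series_on7 phi r c -> near0 r p -> series_at c (q7 p) (phip phi p)%:C.
Proof.
by move=> H np; apply: H; rewrite ?np // (le_lt_trans (Re_le_cnorm _)).
Qed.

Lemma series_on7_bound (R : realType) phi (r rho : R) c :
  series_on7 phi r c -> 0 <= rho < r ->
  exists2 B : R, 0 <= B & forall N, pabs c (fun=> rho%:C) N <= B.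
Proof.
move=> H /andP[r0 rr].
have n : cnorm rho%:C < r by rewrite cnorm_real ger0_norm.
have [] := H rho%:C rho%:C rho%:C rho n n n; first by rewrite ger0_norm.
move=> [B HB] _; exists B.
  apply: le_trans (HB 0%N); apply: sumr_ge0 => a _.
  by rewrite mulr_ge0 ?cnorm_ge0 // prodr_ge0 // => j _; rewrite exprn_ge0 ?cnorm_ge0.
move=> N; apply: le_trans (HB N); apply: pabs_le => j; rewrite /vars7.
by case: (nat_of_ord j) => [|[|[|[|[|[|m]]]]]]; rewrite ?cnorm_cj.
Qed.

Lemma dpsumZ (R : realType) k (c : {ffun 'I_k -> nat} -> R[i]) x (lam : R[i]) v N :
  dpsum c x (fun j => lam * v j) N = lam * dpsum c x v N.
Proof.
rewrite /dpsum mulr_sumr; apply: eq_bigr => a _; rewrite dmonZ; ring.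
Qed.

Lemma small_step (R : realType) (d tau K e : R) :
  0 < d -> 0 < tau -> 0 <= K -> 0 < e ->
  exists t, [/\ 0 < t, t < d, t <= tau & t * K <= e].
Proof.
move=> d0 tau0 K0 e0; exists (Num.min (Num.min (d / 2) tau) (e / (K + 1))).
have K1 : 0 < K + 1 by rewrite ltr_wpDl.
split.
- by rewrite !lt_min !divr_gt0 // tau0.
- by rewrite !gt_min ltr_pdivrMr // ltr_pMr // ltr1n.
- by rewrite !ge_min lexx orbT.
- apply: le_trans (_ : e / (K + 1) * K <= _).
    by rewrite ler_wpM2r // ge_min lexx orbT.
  by rewrite mulrAC ler_pdivrMr // ler_pM2l // lerDl.
Qed.

(* The derivative of [phi] along [V], as the limit of the termwise derivatives of
   its series, equals [dQ p V]: tangency to [rhoG phi] in a form linear in [V]. *)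
Definition dphi_limit (R : realType) (c : {ffun 'I_7 -> nat} -> R[i]) (p V : pt R) :=
  forall e : R, 0 < e -> exists N0, forall N, (N0 <= N)%N ->
    `|complex.Re (dpsum c (q7 p) (q7 V) N) - dQ p V| <= e.

(** [rhoQ] is an exact cubic along a line, so the hypothesis controls the difference quotient of
    [phi] along [V]. The partial sums of the series have nearly the same quotient, which a Taylor
    estimate uniform in [N] compares with their termwise derivative. *)
Lemma tangent_dphi_limit (R : realType) phi (r : R) c (p V : pt R) :
  0 < r -> series_on7 phi r c -> near0 (r / 2) p ->
  is_derive (0 : R) (1 : R) (fun t : R => rhoG phi (fun j => p j + t%:C * V j)) 0 ->
  dphi_limit c p V.
Proof.
move=> r0 Hc np Hd e e0.
have [K2 [K3 HK]] := rhoQ_line p V.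
have e8 : 0 < e / 8 by rewrite divr_gt0.
have [d d0 Hdd] := is_derive_eps Hd e8.
pose Vs := \sum_(j < 4) cnorm (V j).
have Vs0 : 0 <= Vs by apply: sumr_ge0 => j _; apply: cnorm_ge0.
have Vle j : cnorm (V j) <= Vs.
  by rewrite /Vs (bigD1 j) //= lerDl sumr_ge0 // => i _; apply: cnorm_ge0.
(* Scaling the direction by [tau] keeps the norms of [p] and [tau V] together below
   [r / 2 + r / 4 = 3 / 4 * r], inside the domain of convergence; Taylor is then used with direction
   [tau V] and step [t / tau]. *)
pose tau := Num.min 1 (r / 4 / (Vs + 1)).
have Vs1 : 0 < Vs + 1 by rewrite ltr_wpDl.
have tau0 : 0 < tau by rewrite /tau lt_min ltr01 !divr_gt0.
have tauV j : tau * cnorm (V j) <= r / 4.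
  apply: le_trans (_ : r / 4 / (Vs + 1) * (Vs + 1) <= _); last by rewrite divfK ?gt_eqF.
  apply: ler_pM; rewrite ?cnorm_ge0 ?(ltW tau0) //; first by rewrite /tau ge_min lexx orbT.
  by rewrite (le_trans (Vle j)) // lerDl.
have r34 : 0 <= 3 / 4 * r < r by apply/andP; split; lra.
have [B B0 HB] := series_on7_bound Hc r34.
(* The step [t] is fixed before [N]: the quadratic error is uniform in [N], whereas the convergence
   of the partial sums is needed only at the two points [p] and [p + t V]. *)
have [t [t0 td ttau tK]] := small_step d0 tau0
  (ltac:(by rewrite !addr_ge0 ?divr_ge0 ?sqr_ge0 // normr_ge0) :
     0 <= `|K2| + `|K3| + B / tau ^+ 2) e8.
have t1 : t <= 1 by apply: le_trans ttau _; rewrite /tau ge_min lexx.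
pose pt' j := p j + t%:C * V j.
have np' : near0 r pt'.
  move=> j; apply: le_lt_trans (cnormD _ _) _; rewrite cnormM cnorm_real gtr0_norm //.
  have h1 := np j; have h2 := tauV j.
  have h3 : t * cnorm (V j) <= tau * cnorm (V j) by rewrite ler_wpM2r ?cnorm_ge0.
  lra.
have np0 : near0 r p by move=> j; apply: lt_trans (np j) _; lra.
have te : 0 < t * (e / 8) by rewrite mulr_gt0.
have [N1 H1] := series_at_eps (series_on7P Hc np') te.
have [N2 H2] := series_at_eps (series_on7P Hc np0) te.
exists (maxn N1 N2) => N; rewrite geq_max => /andP[/H1 {}H1 /H2 {}H2].
have HT : cnorm (psum c (q7 pt') N - psum c (q7 p) N - t%:C * dpsum c (q7 p) (q7 V) N)
    <= t ^+ 2 * (B / tau ^+ 2).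
  have tt1 : `|t / tau| <= 1.
    rewrite ger0_norm; last by rewrite divr_ge0 // ltW.
    by rewrite ler_pdivrMr // mul1r.
  have := @psum_taylor _ _ c (q7 p) (fun j => tau%:C * q7 V j)
    (fun=> (3 / 4 * r)%:C) N (t / tau) tt1 _.
  rewrite dpsumZ (_ : (fun j => _) = q7 pt'); last first.
    rewrite /pt' q7_line; apply: funext => j; rewrite mulrA -rmorphM /= divfK ?gt_eqF //.
  rewrite mulrA -rmorphM /= divfK ?gt_eqF // => H.
  apply: le_trans (H _) _; last first.
    rewrite exprMn exprVn mulrAC -mulrA ler_wpM2l ?sqr_ge0 //.
    by rewrite ler_wpM2r ?HB // invr_ge0 sqr_ge0.
  move=> j; rewrite cnorm_real ger0_norm; last by case/andP: r34.
  rewrite cnormM cnorm_real gtr0_norm //.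
  have h1 : cnorm (q7 p j) <= r / 2 by apply: q7_norm => i; apply: ltW.
  have h2 : cnorm (q7 V j) <= r / 4 / tau.
    by apply: q7_norm => i; rewrite ler_pdivlMr // mulrC.
  have h3 : tau * cnorm (q7 V j) <= r / 4 by rewrite mulrC -ler_pdivlMr.
  lra.
have HD : `|phip phi pt' - phip phi p - t * dQ p V| <= t * (e / 8) + t ^+ 2 * (`|K2| + `|K3|).
  have := Hdd t; rewrite t0 td => /(_ isT).
  rewrite (_ : (fun j => p j + 0%:C * V j) = p); last first.
    by apply: funext => j; rewrite mul0r addr0.
  rewrite /rhoG HK mulr0 subr0.
  rewrite -/(phip phi pt') -/(phip phi p) => H.
  have -> : phip phi pt' - phip phi p - t * dQ p V =
    t ^+ 2 * K2 + t ^+ 3 * K3 - (rhoQ p + t * dQ p V + t ^+ 2 * K2 + t ^+ 3 * K3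
      - phip phi pt' - (rhoQ p - phip phi p)) by ring.
  apply: le_trans (ler_normB _ _) _; rewrite [leLHS]addrC; apply: lerD => //.
  apply: le_trans (ler_normD _ _) _; rewrite [`|t ^+ 2 * K2|]normrM [`|t ^+ 3 * K3|]normrM !normrX gtr0_norm // mulrDr lerD2l.
  by rewrite ler_wpM2r // (exprS t 2) ler_piMl // exprn_ge0 // ltW.
have -> : complex.Re (dpsum c (q7 p) (q7 V) N) - dQ p V =
  complex.Re (dpsum c (q7 p) (q7 V) N - (dQ p V)%:C) by rewrite ReB.
apply: le_trans (Re_le_cnorm _) _; rewrite -(ler_pM2l t0) -{1}(gtr0_norm t0).
rewrite -cnorm_real -cnormM.
have -> : t%:C * (dpsum c (q7 p) (q7 V) N - (dQ p V)%:C) =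
  - (psum c (q7 pt') N - psum c (q7 p) N - t%:C * dpsum c (q7 p) (q7 V) N)
  + (psum c (q7 pt') N - (phip phi pt')%:C) - (psum c (q7 p) N - (phip phi p)%:C)
  + (phip phi pt' - phip phi p - t * dQ p V)%:C by rewrite (rmorphB _ (_ - _)) (rmorphB _ (phip _ _)) rmorphM; ring.
apply: le_trans (cnormD _ _) _; rewrite cnorm_real.
have K1 := cnormB (- (psum c (q7 pt') N - psum c (q7 p) N - t%:C * dpsum c (q7 p) (q7 V) N)
  + (psum c (q7 pt') N - (phip phi pt')%:C)) (psum c (q7 p) N - (phip phi p)%:C).
have K4 := cnormD (- (psum c (q7 pt') N - psum c (q7 p) N - t%:C * dpsum c (q7 p) (q7 V) N))
  (psum c (q7 pt') N - (phip phi pt')%:C).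
rewrite cnormN in K4.
have K5 : t * (t * (`|K2| + `|K3| + B / tau ^+ 2)) <= t * (e / 8) by rewrite ler_pM2l.
have te0 : 0 < t * e by rewrite mulr_gt0.
lra.
Qed.

(** * Weighted homogeneity of Q and the leading component of a field *)

Definition mk4 (C : Type) (z1 z2 t w : C) : 'I_4 -> C :=
  fun j => match nat_of_ord j with 0 => z1 | 1 => z2 | 2 => t | _ => w end.

Definition wt4 (j : 'I_4) : nat :=
  match nat_of_ord j with 0 => 2 | 3 => 3 | _ => 1 end.

Lemma ord4P (P : 'I_4 -> Prop) : P iz1 -> P iz2 -> P izeta -> P iw -> forall j, P j.
Proof.
move=> h0 h1 h2 h3 [[|[|[|[|n]]]] hn] //.
- by rewrite (_ : Ordinal hn = iz1) //; apply/val_inj.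
- by rewrite (_ : Ordinal hn = iz2) //; apply/val_inj.
- by rewrite (_ : Ordinal hn = izeta) //; apply/val_inj.
- by rewrite (_ : Ordinal hn = iw) //; apply/val_inj.
Qed.

Lemma wt4_gt0 j : (0 < wt4 j)%N.
Proof. by elim/ord4P: j. Qed.

Lemma q7_scale (R : realType) (t : R) (p : pt R) :
  q7 (scale wt4 t%:C p) = scale wt7 t%:C (q7 p).
Proof.
apply: funext => j; rewrite /q7 /vars7 /scale /wt7 /wt4 /=.
have C n (w : R[i]) : cj (t%:C ^+ n * w) = t%:C ^+ n * cj w.
  by rewrite /cj rmorphM rmorphXn /= oppr0.
case: j => [[|[|[|[|[|[|[|n]]]]]]] hn] //=.
rewrite -rmorphXn; case: (p iw) => a b /=; rewrite mul0r subr0.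
by apply/eqP; rewrite eq_complex /= !(mul0r, mulr0, subr0, addr0) !eqxx.
Qed.

Lemma dQ_scale (R : realType) (t : R) (p V : pt R) :
  dQ (scale wt4 t%:C p) (scale wt4 t%:C V) = t ^+ 3 * dQ p V.
Proof.
rewrite /dQ /cj /scale /wt4 /= -!rmorphXn.
case: (p iz1) => a1 b1; case: (p iz2) => a2 b2; case: (p izeta) => a3 b3.
case: (V iz1) => c1 d1; case: (V iz2) => c2 d2.
case: (V izeta) => c3 d3; case: (V iw) => c4 d4 /=; ring.
Qed.

Lemma dQ_lincomb (R : realType) n (lam : 'I_n -> R) (p : pt R) (V : 'I_n -> pt R) :
  dQ p (fun j => \sum_(i < n) (lam i)%:C * V i j) = \sum_(i < n) lam i * dQ p (V i).
Proof.
elim: n lam V => [|n IH] lam V.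
  rewrite !big_ord0 /dQ !big_ord0 /cj conjc0 !mul0r !mulr0 !addr0.
  by rewrite /= !(mulr0, subr0).
rewrite big_ord_recl -IH /dQ !big_ord_recl.
set S1 := \sum_(i < n) _; set S2 := \sum_(i < n) _; set S3 := \sum_(i < n) _.
set S4 := \sum_(i < n) _; rewrite /cj.
case: S1 => c1' d1'; case: S2 => c2' d2'; case: S3 => c3' d3'; case: S4 => c4' d4'.
case: (p iz1) => a1 b1; case: (p iz2) => a2 b2; case: (p izeta) => a3 b3.
case: (V ord0 iz1) => c1 d1; case: (V ord0 iz2) => c2 d2.
case: (V ord0 izeta) => c3 d3; case: (V ord0 iw) => c4 d4 /=; ring.
Qed.

Lemma dQB (R : realType) (p V W : pt R) :
  dQ p (fun j => V j - W j) = dQ p V - dQ p W.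
Proof.
rewrite /dQ /cj.
case: (p iz1) => a1 b1; case: (p iz2) => a2 b2; case: (p izeta) => a3 b3.
case: (V iz1) => c1 d1; case: (V iz2) => c2 d2.
case: (V izeta) => c3 d3; case: (V iw) => c4 d4 /=.
case: (W iz1) => c1' d1'; case: (W iz2) => c2' d2'.
case: (W izeta) => c3' d3'; case: (W iw) => c4' d4' /=; ring.
Qed.

Lemma dQZ (R : realType) (p V : pt R) (s : R) :
  dQ p (fun j => s%:C * V j) = s * dQ p V.
Proof.
rewrite /dQ /cj.
case: (p iz1) => a1 b1; case: (p iz2) => a2 b2; case: (p izeta) => a3 b3.
case: (V iz1) => c1 d1; case: (V iz2) => c2 d2.
case: (V izeta) => c3 d3; case: (V iw) => c4 d4 /=; ring.
Qed.

(** The constant is 11 = 1 + 2 (1 + 1 + 1 + 2), one summand per term of [dQ]. The coordinate [w] of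
    the base point is unrestricted because [dQ] does not depend on it. *)
Lemma dQ_le (R : realType) (p V : pt R) (d : R) :
  (forall j, j != iw -> cnorm (p j) <= 1) -> (forall j, cnorm (V j) <= d) ->
  `|dQ p V| <= 11 * d.
Proof.
move=> hp hV; have d0 : 0 <= d by apply: le_trans (hV iw); apply: cnorm_ge0.
apply: le_trans (ler_normB _ _) _.
have -> : 11 * d = d + 10 * d by ring.
apply: lerD; first exact: le_trans (Im_le_cnorm _) (hV _).
have M1 x y : cnorm x <= 1 -> cnorm y <= d -> cnorm (x * y) <= d.
  by move=> hx hy; rewrite cnormM -[d]mul1r ler_pM ?cnorm_ge0.
have P1 := hp iz1 isT; have P2 := hp iz2 isT; have P3 := hp izeta isT.
have P33 : cnorm (cj (p izeta) ^+ 2) <= 1.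
  by rewrite cnormX cnorm_cj exprn_ile1 ?cnorm_ge0.
have P23 : cnorm (p iz2 * cj (p izeta)) <= 1.
  by rewrite cnormM cnorm_cj mulr_ile1 ?cnorm_ge0.
have two : cnorm (2 : R[i]) = 2.
  by have := @cnorm_real R 2; rewrite rmorph_nat => ->; rewrite ger0_norm.
have Q1 : cnorm (V iz1 * cj (p izeta)) <= d by rewrite mulrC M1 ?cnorm_cj.
have Q2 : cnorm (p iz1 * cj (V izeta)) <= d by rewrite M1 ?cnorm_cj.
have Q3 : cnorm (V iz2 * cj (p izeta) ^+ 2) <= d by rewrite mulrC M1.
have Q4 : cnorm (2 * p iz2 * cj (p izeta) * cj (V izeta)) <= 2 * d.
  by rewrite -!mulrA (cnormM 2) two ler_pM2l // mulrA M1 ?cnorm_cj.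
rewrite normrM ger0_norm //.
have -> : 10 * d = 2 * (5 * d) by ring.
rewrite ler_pM2l //; apply: le_trans (Re_le_cnorm _) _.
have K1 := cnormD (V iz1 * cj (p izeta) + p iz1 * cj (V izeta) + V iz2 * cj (p izeta) ^+ 2)
  (2 * p iz2 * cj (p izeta) * cj (V izeta)).
have K2 := cnormD (V iz1 * cj (p izeta) + p iz1 * cj (V izeta)) (V iz2 * cj (p izeta) ^+ 2).
have K3 := cnormD (V iz1 * cj (p izeta)) (p iz1 * cj (V izeta)).
lra.
Qed.

Lemma series_weight_le (R : realType) k (wt : 'I_k -> nat) m
    (c : {ffun 'I_k -> nat} -> R[i]) (rho B t : R) (y : 'I_k -> R[i]) v :
  (forall a, c a != 0 -> (m <= weight wt a)%N) ->
  0 <= rho -> (forall N, pabs c (fun=> rho%:C) N <= B) ->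
  0 <= t <= 1 -> (forall j, cnorm (y j) <= rho) ->
  series_at c (scale wt t%:C y) v -> cnorm v <= t ^+ m * B.
Proof.
move=> cm r0 HB /andP[t0 t1] hy s; rewrite -[v]subr0.
apply: (series_at_bound (N0 := 0) s) => N _; rewrite subr0.
apply: le_trans (cnorm_sum _ _) _.
apply: le_trans (_ : t ^+ m * pabs c (fun=> rho%:C) N <= _); last first.
  by rewrite ler_wpM2l ?exprn_ge0.
rewrite /pabs mulr_sumr; apply: ler_sum => a _; rewrite cnormM.
have [->|/cm wa] := eqVneq (c (mexp a)) 0; first by rewrite cnorm0 !mul0r mulr0.
rewrite mulrCA ler_wpM2l ?cnorm_ge0 // prod_scale cnormM cnormX cnorm_real ger0_norm //.
apply: ler_pM; rewrite ?exprn_ge0 ?cnorm_ge0 ?ler_wiXn2l //.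
rewrite cnorm_prod; apply: ler_prod => j _; rewrite cnormX.
rewrite exprn_ge0 ?cnorm_ge0 //= lerXn2r ?nnegrE ?cnorm_ge0 //.
by rewrite cnorm_real ger0_norm.
Qed.

(* The component of weighted degree [K - 3] of a vector field: coefficients of
   [d/dx_j] of weight [K - 3 + wt4 j], written without subtraction. *)
Definition lead_coef4 (R : realType) (K : nat) (j : 'I_4)
    (c : {ffun 'I_4 -> nat} -> R[i]) (a : {ffun 'I_4 -> nat}) : R[i] :=
  if (weight wt4 a + 3 == K + wt4 j)%N then c a else 0.

(** As [wt4 j <= 3], the selected monomials have weight, hence exponents, at most [K]. The box of
    size [K + 4] contains them all, and also the exponents up to 2 of the explicit family when [K]
    is small. *)
Definition lead4 (R : realType) (K : nat) (c : 'I_4 -> {ffun 'I_4 -> nat} -> R[i])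
    (j : 'I_4) (y : pt R) : R[i] := psum (lead_coef4 K j (c j)) y (K + 4).

Lemma psum_polyfun (R : realType) k (c : {ffun 'I_k -> nat} -> R[i]) N :
  polyfun (fun y => psum c y N).
Proof.
apply: polyfun_sum => a; apply: polyfun_mul; first exact: polyfun_const.
by apply: polyfun_prod => j; apply: polyfun_exp; apply: polyfun_var.
Qed.

(** The factor [t ^+ 3] on the left replaces a division, so that components of negative weighted
    degree need no separate treatment. *)
Lemma lead4_approx (R : realType) K (c : 'I_4 -> {ffun 'I_4 -> nat} -> R[i]) j
    (rho B t : R) (y : pt R) v :
  (forall a, (weight wt4 a + 3 < K + wt4 j)%N -> c j a = 0) ->
  0 <= rho -> 0 <= B -> (forall N, pabs (c j) (fun=> rho%:C) N <= B) ->
  0 <= t <= 1 -> (forall i, cnorm (y i) <= rho) ->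
  series_at (c j) (scale wt4 t%:C y) v ->
  cnorm (t%:C ^+ 3 * v - t%:C ^+ (K + wt4 j) * lead4 K c j y) <= t ^+ (K + wt4 j).+1 * B.
Proof.
move=> cK r0 B0 HB t01 hy s; have /andP[t0 t1] := t01.
have w3 : (wt4 j <= 3)%N by elim/ord4P: (j).
have [le|lt] := leqP 3 (K + wt4 j).
  pose m := (K + wt4 j - 3)%N.
  have mE : (K + wt4 j = 3 + m)%N by rewrite subnKC.
  have -> : lead4 K c j y = psum (trunc wt4 m (c j)) y m.+1.
    rewrite -(psum_trunc_stable (c j) y wt4_gt0 (ltnSn m) (N := K + 4)); last by lia.
    apply: eq_bigr => a _; congr (_ * _); rewrite /lead_coef4 /trunc mE.
    by rewrite addnC eqn_add2l.
  rewrite mE exprD -mulrA -mulrBr cnormM cnormX cnorm_real ger0_norm // -addnS exprD.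
  rewrite -mulrA ler_wpM2l ?exprn_ge0 //.
  apply: (series_leading wt4_gt0 _ r0 HB t01 hy s) => a wa; apply: cK.
  by rewrite mE addnC ltn_add2l.
(* Here [K + wt4 j < 3], so no monomial is selected, and [t ^+ 3] alone is at most
   [t ^+ (K + wt4 j).+1]. *)
have -> : lead4 K c j y = 0.
  rewrite /lead4 /psum big1 // => a _; rewrite /lead_coef4.
  case: eqP => [e|]; last by rewrite mul0r.
  by move: lt; rewrite -e ltnNge leq_addl.
rewrite mulr0 subr0 cnormM cnormX cnorm_real ger0_norm //.
apply: ler_pM; rewrite ?exprn_ge0 ?cnorm_ge0 ?ler_wiXn2l //.
have := @series_weight_le _ _ wt4 0 (c j) rho B t y v (fun _ _ => leq0n _) r0 HB t01 hy s.
by rewrite expr0 mul1r.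
Qed.

Lemma ord4_bound (R : realType) (P : 'I_4 -> R -> Prop) :
  (forall j, exists2 B, 0 <= B & P j B) ->
  (forall j B B', P j B -> B <= B' -> P j B') ->
  exists2 B, 0 <= B & forall j, P j B.
Proof.
move=> H mono.
have [b0 p0 h0] := H iz1; have [b1 p1 h1] := H iz2.
have [b2 p2 h2] := H izeta; have [b3 p3 h3] := H iw.
exists (b0 + b1 + b2 + b3); first by rewrite !addr_ge0.
elim/ord4P; [apply: mono h0 _|apply: mono h1 _|apply: mono h2 _|apply: mono h3 _]; lra.
Qed.

Lemma le_eps_mul0 (R : realType) (x C t0 : R) : 0 < t0 -> 0 <= C ->
  (forall t, 0 < t -> t <= t0 -> x <= t * C) -> x <= 0.
Proof.
move=> t00 C0 H; apply/ler_addgt0Pr => e e0; rewrite add0r.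
have [t [t0' _ tt tC]] := small_step ltr01 t00 C0 e0.
exact: le_trans (H t t0' tt) tC.
Qed.

(** Along dilated vectors [dQ] scales with [t ^+ 3], but the derivative of a series of weight at
    least 4 is of size [t ^+ 4]. After division by the common power one factor [t] remains. *)
Lemma dphi_limit_le (R : realType) (c : {ffun 'I_7 -> nat} -> R[i])
    (K : nat) (t r B M1 : R) (y V V' : pt R) :
  (forall a, c a != 0 -> (4 <= weight7 a)%N) ->
  0 < r -> 0 < t <= 1 -> 0 <= B -> 0 <= M1 ->
  (forall N, pabs c (fun=> (3 / 4 * r)%:C) N <= B) ->
  (forall j, cnorm (y j) <= r / 2) -> (forall j, cnorm (V' j) <= M1) ->
  (forall j, t%:C ^+ 3 * V j = t%:C ^+ K * scale wt4 t%:C V' j) ->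
  dphi_limit c (scale wt4 t%:C y) V ->
  `|dQ y V'| <= t * ((4 * M1 / r + 1) * B).
Proof.
move=> c4 r0 /andP[t0 t1] B0 M0 HB hy hV VE lim.
(* Dividing [V'] by [M2] brings its norm below [r / 4], so that it fits with [y] into radius
   [3 / 4 * r]; linearity in the direction restores the factor. *)
pose M2 := 4 * M1 / r + 1.
have M20 : 0 < M2 by rewrite /M2 ltr_wpDl // divr_ge0 ?mulr_ge0 // ltW.
have tc : t%:C != 0 :> R[i] by rewrite fmorph_eq0 gt_eqF.
pose V3 j := t%:C ^+ 3 * V j.
have Ec j : V3 j = (t ^+ K)%:C * scale wt4 t%:C V' j by rewrite /V3 VE rmorphXn.
have E1 : t ^+ 3 * dQ (scale wt4 t%:C y) V = t ^+ K * (t ^+ 3 * dQ y V').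
  rewrite -(dQ_scale t y V') -!dQZ; congr dQ; apply: funext => j.
  by rewrite -Ec /V3 rmorphXn.
have E2 N : cnorm ((t ^+ 3)%:C * dpsum c (q7 (scale wt4 t%:C y)) (q7 V) N)
    <= t ^+ K * (M2 * (t ^+ 4 * B)).
  have L (s : R) (W : pt R) : (fun j => s%:C * q7 W j) = q7 (fun j => s%:C * W j).
    have := q7_line (fun=> 0) W s.
    rewrite (_ : (fun j => 0 + s%:C * W j) = fun j => s%:C * W j); last first.
      by apply: funext => j; rewrite add0r.
    move=> ->; apply: funext => j; rewrite (_ : q7 (fun=> 0) j = 0) ?add0r //.
    by rewrite /q7 /vars7 /cj conjc0; case: (nat_of_ord j) => [|[|[|[|[|[|n]]]]]].
  rewrite -dpsumZ L.
  have -> : (fun j => (t ^+ 3)%:C * V j) =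
      fun j => (t ^+ K * M2)%:C * scale wt4 t%:C (fun j => (M2^-1)%:C * V' j) j.
    apply: funext => j; rewrite rmorphXn VE rmorphM /scale fmorphV.
    by rewrite rmorphXn; field; rewrite fmorph_eq0 gt_eqF.
  rewrite -L dpsumZ cnormM cnorm_real ger0_norm; last first.
    by rewrite mulr_ge0 ?exprn_ge0 // ltW.
  rewrite -mulrA ler_wpM2l ?exprn_ge0 ?(ltW t0) // ler_wpM2l ?(ltW M20) //.
  rewrite !q7_scale -L.
  apply: le_trans (_ : t ^+ 4 * pabs c (fun=> (3 / 4 * r)%:C) N <= _); last first.
    by rewrite ler_wpM2l ?exprn_ge0 // ltW.
  apply: dpsum_scale_le => //; first by rewrite (ltW t0).
  move=> j; rewrite cnormM !cnorm_real !ger0_norm ?invr_ge0 ?(ltW M20) //; last first.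
    by rewrite mulr_ge0 // ltW.
  have h1 := q7_norm hy j; have h2 := q7_norm hV j.
  have h3 : M2^-1 * cnorm (q7 V' j) <= r / 4.
    rewrite mulrC ler_pdivrMr // (le_trans h2) // /M2.
    have -> : r / 4 * (4 * M1 / r + 1) = M1 + r / 4 by field; rewrite gt_eqF.
    by rewrite lerDl divr_ge0 // ltW.
  lra.
have tK0 : 0 < t ^+ K * t ^+ 3 by rewrite mulr_gt0 ?exprn_gt0.
rewrite -(ler_pM2l tK0) -[X in X * `|_|](gtr0_norm tK0) -normrM -(mulrA _ _ (dQ y V')) -E1.
have -> : t ^+ K * t ^+ 3 * (t * (M2 * B)) = t ^+ K * (M2 * (t ^+ 4 * B)) by ring.
apply/ler_addgt0Pr => e e0.
have [N0 HN] := lim (e / t ^+ 3) (divr_gt0 e0 (exprn_gt0 _ t0)).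
have {HN} := HN N0 (leqnn _); rewrite ler_pdivlMr ?exprn_gt0 // => HN.
have := E2 N0 => {}E2.
set D := dpsum _ _ _ _ in HN E2.
have RD : complex.Re ((t ^+ 3)%:C * D) = t ^+ 3 * complex.Re D.
  by case: (D) => a b /=; rewrite mul0r subr0.
have -> : t ^+ 3 * dQ (scale wt4 t%:C y) V = complex.Re ((t ^+ 3)%:C * D)
   - (complex.Re D - dQ (scale wt4 t%:C y) V) * t ^+ 3 by rewrite RD; ring.
apply: le_trans (ler_normB _ _) _; apply: lerD.
  exact: le_trans (Re_le_cnorm _) E2.
by rewrite normrM [X in _ * X]ger0_norm // exprn_ge0 // ltW.
Qed.

(* Evaluate the tangency condition at the dilated point of the hypersurface and let
   [t] tend to 0: [phi] contributes one more factor [t] than the leading terms. *)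
Lemma leading_tangent (R : realType) phi (r : R) c7 (X : vf R)
    (c4 : 'I_4 -> {ffun 'I_4 -> nat} -> R[i]) (K : nat) :
  0 < r <= 1 -> (forall a, c7 a != 0 -> (4 <= weight7 a)%N) ->
  series_on7 phi r c7 ->
  (forall j p, near0 r p -> series_at (c4 j) p (X j p)) ->
  (forall p, near0 r p -> rhoG phi p = 0 -> dphi_limit c7 p (fun j => X j p)) ->
  (forall j a, (weight wt4 a + 3 < K + wt4 j)%N -> c4 j a = 0) ->
  forall z1 z2 zeta u, cnorm z1 <= r / 12 -> cnorm z2 <= r / 12 ->
    cnorm zeta <= r / 12 -> `|u| <= r / 12 ->
  let y := mk4 z1 z2 zeta
    (Complex u (2 * complex.Re (z1 * cj zeta + z2 * cj zeta ^+ 2))) in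
  dQ y (fun j => lead4 K c4 j y) = 0.
Proof.
move=> /andP[r0 r1] w7 Hc HX Hlim c4K z1 z2 zeta u h1 h2 h3 hu y0.
pose P := 2 * complex.Re (z1 * cj zeta + z2 * cj zeta ^+ 2).
have r34 : 0 <= 3 / 4 * r < r by apply/andP; split; lra.
have [B7 B70 HB7] := series_on7_bound Hc r34.
have [B4 B40 HB4] : exists2 B, 0 <= B & forall j N, pabs (c4 j) (fun=> (r / 2)%:C) N <= B.
  apply: (@ord4_bound _ (fun j B => forall N, pabs (c4 j) (fun=> (r / 2)%:C) N <= B)).
    move=> j; have [|[B HB] _] := HX j (fun=> (r / 2)%:C).
      by move=> i; rewrite cnorm_real ger0_norm; lra.
    exists `|B| => // N; exact: le_trans (HB N) (ler_norm _).
  by move=> j B B' H le N; apply: le_trans (H N) le.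
have [Lp Lp0 HL] : exists2 B, 0 <= B & forall j, forall (x y : pt R) (d : R),
    (forall i, cnorm (x i) <= 1) -> (forall i, cnorm (y i) <= 1) ->
    (forall i, cnorm (x i - y i) <= d) -> 0 <= d ->
    cnorm (lead4 K c4 j x) <= B /\ cnorm (lead4 K c4 j x - lead4 K c4 j y) <= B * d.
  apply: ord4_bound => [j|j B B' H le x y d hx hy hd d0].
    exact: (polyfun_lip ler01 (psum_polyfun (lead_coef4 K j (c4 j)) _)).
  have [a b] := H x y d hx hy hd d0; split; first exact: le_trans le.
  by apply: le_trans b _; rewrite ler_wpM2r.
have hP : `|P| <= 4 * (r / 12).
  rewrite /P normrM ger0_norm // (_ : 4 * (r / 12) = 2 * (2 * (r / 12))); last by ring.
  rewrite ler_pM2l //; apply: le_trans (Re_le_cnorm _) _; apply: le_trans (cnormD _ _) _.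
  rewrite mulr_natl mulr2n !cnormM !cnorm_cj.
  have z1' : cnorm zeta <= 1 by lra.
  have := cnorm_ge0 z1; have := cnorm_ge0 z2; have := cnorm_ge0 zeta; nra.
(* The bound for [w] is [r / 12] from [u] plus [4 * (r / 12)] from [P]; another [r / 12] is left for
   the correction of [w] below, up to the total [r / 2]. *)
have y0n j : cnorm (y0 j) <= 5 / 12 * r.
  elim/ord4P: j; rewrite /y0 /mk4 /=; [lra|lra|lra|].
  apply: le_trans (cnorm_le_ReIm _) _ => /=; rewrite -/P; lra.
pose M1 := Lp + B4.
have M10 : 0 <= M1 by rewrite addr_ge0.
pose CC := (4 * M1 / r + 1) * B7 + 11 * (B4 + Lp * B7).
have CC0 : 0 <= CC.
  rewrite addr_ge0 // mulr_ge0 // ?addr_ge0 ?mulr_ge0 //.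
  by rewrite invr_ge0 ltW.
apply/eqP; rewrite -normr_le0; apply/eqP/eqP.
have [t0 [t00 _ t01 t0B]] := small_step ltr01 ltr01 B70 (ltac:(lra) : 0 < r / 12).
apply: (le_eps_mul0 t00 CC0) => t tp tt.
have t1 : t <= 1 by apply: le_trans tt t01.
have tB : t * B7 <= r / 12 by apply: le_trans t0B; rewrite ler_wpM2r.
have t01' : 0 <= t <= 1 by rewrite ltW.
have t01'' : 0 < t <= 1 by rewrite tp.
have scn (y : pt R) (d : R) : (forall j, cnorm (y j) <= d) ->
    forall j, cnorm (scale wt4 t%:C y j) <= d.
  move=> H j; rewrite /scale cnormM cnormX cnorm_real gtr0_norm //.
  by apply: le_trans (H j); rewrite ler_piMl ?cnorm_ge0 // exprn_ile1 // ltW.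
pose ph := phip phi (scale wt4 t%:C y0).
have hph : `|ph| <= t ^+ 4 * B7.
  rewrite -cnorm_real; apply: (series_weight_le (wt := wt7) (rho := 3 / 4 * r)
    (y := q7 y0) w7 _ HB7 t01'); first by case/andP: r34.
    by apply: q7_norm => j; apply: le_trans (y0n j) _; lra.
  rewrite -q7_scale; apply: (series_on7P Hc) => j.
  by apply: le_lt_trans (scn _ _ y0n j) _; lra.
(* The correction of Im [w] puts the dilated point [p] on the perturbed hypersurface. As [phi]
   depends only on Re [w], its value is still [ph], and the correction is of size [t]. *)
pose y := mk4 z1 z2 zeta (Complex u (P + ph / t ^+ 3)).
have dy j : cnorm (y j - y0 j) <= t * B7.
  elim/ord4P: j; rewrite /y /y0 /mk4 /= ?subrr ?cnorm0 ?mulr_ge0 // ?(ltW tp) //.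
  apply: le_trans (cnorm_le_ReIm _) _ => /=; rewrite -/P subrr normr0 add0r.
  rewrite addrC addKr normrM normfV [X in _ / X]ger0_norm ?exprn_ge0 ?(ltW tp) //.
  rewrite ler_pdivrMr ?exprn_gt0 // (le_trans hph) //.
  by rewrite (_ : t ^+ 4 * B7 = t * B7 * t ^+ 3) //; ring.
have yn j : cnorm (y j) <= r / 2.
  have -> : y j = y0 j + (y j - y0 j) by ring.
  apply: le_trans (cnormD _ _) _; have := y0n j; have := dy j; lra.
pose p := scale wt4 t%:C y.
have pn : near0 r p by move=> j; apply: le_lt_trans (scn _ _ yn j) _; lra.
have php : phip phi p = ph.
  rewrite /ph /phip /p /scale /= -!rmorphXn; congr (phi _ _ _ _).
  by ring.
have rp : rhoG phi p = 0.
  rewrite /rhoG -/(phip phi p) php /rhoQ /p /scale /wt4 /= -!rmorphXn /y /mk4 /= /cj.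
  rewrite /P /cj; case: (z1) => a1 b1; case: (z2) => a2 b2; case: (zeta) => a3 b3 /=.
  by field; rewrite gt_eqF.
have lim := Hlim p pn rp.
have tc : t%:C != 0 :> R[i] by rewrite fmorph_eq0 gt_eqF.
(* The field renormalized so that [t ^+ 3 X(p)] is [t ^+ K] times the dilation of [V']; it differs
   from the leading component at [y] by [t * B4]. *)
pose V' j := t%:C ^+ 3 * X j p / t%:C ^+ (K + wt4 j).
have V'L j : cnorm (V' j - lead4 K c4 j y) <= t * B4.
  have tk : 0 < t ^+ (K + wt4 j) by rewrite exprn_gt0.
  rewrite -(ler_pM2l tk) mulrA -exprSr.
  rewrite -[X in X * cnorm _](gtr0_norm tk) -cnorm_real -cnormM.
  rewrite (_ : _ * _ = t%:C ^+ 3 * X j p - t%:C ^+ (K + wt4 j) * lead4 K c4 j y); last first.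
    by rewrite rmorphXn /V'; field; rewrite expf_neq0.
  apply: (lead4_approx (rho := r / 2)) => //; [exact: c4K|lra|].
  exact: HX.
have one x : x <= r / 2 -> x <= 1 by lra.
have y1 i : cnorm (y i) <= 1 by apply: one.
have y01 i : cnorm (y0 i) <= 1 by apply: le_trans (y0n i) _; lra.
have tB70 : 0 <= t * B7 by rewrite mulr_ge0 // ltW.
have V'n j : cnorm (V' j) <= M1.
  have -> : V' j = lead4 K c4 j y + (V' j - lead4 K c4 j y) by ring.
  apply: le_trans (cnormD _ _) _; rewrite /M1; apply: lerD.
    by have [] := HL j y y0 (t * B7) y1 y01 dy tB70.
  by apply: le_trans (V'L j) _; rewrite ler_piMl.
have est := dphi_limit_le (K := K) (V' := V') w7 r0 t01'' B70 M10 HB7 yn V'n _ lim.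
have {}est : `|dQ y V'| <= t * ((4 * M1 / r + 1) * B7).
  by apply: est => j; rewrite /V' /scale exprD; field; rewrite ?andbT ?mulf_neq0 ?expf_neq0.
have dyy W : dQ y0 W = dQ y W by [].
have -> : dQ y0 (fun j => lead4 K c4 j y0) = dQ y V'
   - dQ y0 (fun j => V' j - lead4 K c4 j y0) by rewrite dQB dyy; ring.
apply: le_trans (ler_normB _ _) _; rewrite /CC mulrDr; apply: lerD => //.
rewrite mulrCA; apply: dQ_le => [j _|j]; first exact: y01.
have -> : V' j - lead4 K c4 j y0 = (V' j - lead4 K c4 j y) + (lead4 K c4 j y - lead4 K c4 j y0).
  by ring.
apply: le_trans (cnormD _ _) _; rewrite mulrDr; apply: lerD => //.
have [_ H] := HL j y y0 (t * B7) y1 y01 dy tB70.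
by apply: le_trans H _; rewrite mulrCA.
Qed.

(** * Reality and reconstruction of the coefficients *)

Definition quad_of (C : Type) (X : 'I_4 -> ('I_4 -> C) -> C) : quad C :=
  Quad (fun z1 z2 t w => X iz1 (mk4 z1 z2 t w)) (fun z1 z2 t w => X iz2 (mk4 z1 z2 t w))
       (fun z1 z2 t w => X izeta (mk4 z1 z2 t w)) (fun z1 z2 t w => X iw (mk4 z1 z2 t w)).

(** For a polynomial field this conjugates the coefficients; it is the partner [Y] in
    [polar_tangent]. *)
Definition cjX (R : realType) (X : vf R) : vf R :=
  fun j x => cj (X j (fun i => cj (x i))).

Lemma cj_mk4 (R : realType) (z1 z2 t w : R[i]) :
  (fun i => cj (mk4 z1 z2 t w i)) = mk4 (cj z1) (cj z2) (cj t) (cj w).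
Proof. by apply: funext; elim/ord4P. Qed.

Lemma polyfun_mk4 (C : numFieldType) (I : Type) (F : ('I_4 -> C) -> C)
    (a b c d : (I -> C) -> C) :
  polyfun F -> polyfun a -> polyfun b -> polyfun c -> polyfun d ->
  polyfun (fun y => F (mk4 (a y) (b y) (c y) (d y))).
Proof.
move=> pF pa pb pc pd.
apply: (polyfun_comp (G := fun i y => mk4 (a y) (b y) (c y) (d y) i)) => //.
by elim/ord4P.
Qed.

(** [dQ] written without real and imaginary parts, with each quantity next to its conjugate, the
    form in which conjugates can be made independent. *)
Lemma dQ_complex (R : realType) (p V : pt R) :
  2 * ci R * (dQ p V)%:C = V iw - cj (V iw) - 2 * ci R *
   (V iz1 * cj (p izeta) + cj (V iz1) * p izeta + p iz1 * cj (V izeta)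
    + cj (p iz1) * V izeta + V iz2 * cj (p izeta) ^+ 2 + cj (V iz2) * p izeta ^+ 2
    + 2 * p iz2 * cj (p izeta) * cj (V izeta) + 2 * cj (p iz2) * p izeta * V izeta).
Proof.
rewrite /dQ /cj.
case: (p iz1) => a1 b1; case: (p iz2) => a2 b2; case: (p izeta) => a3 b3.
case: (V iz1) => c1 d1; case: (V iz2) => c2 d2.
case: (V izeta) => c3 d3; case: (V iw) => c4 d4.
by apply/eqP; rewrite eq_complex /=; apply/andP; split; apply/eqP; ring.
Qed.

Lemma ci_neq0 (R : realType) : ci R != 0.
Proof. by rewrite eq_complex /= oner_eq0 andbF. Qed.

Lemma cj_ci (R : realType) : cj (ci R) = - ci R.
Proof. by apply/eqP; rewrite eq_complex /= oppr0 !eqxx. Qed.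

Lemma cjK (R : realType) : involutive (@cj R).
Proof. exact: conjcK. Qed.

Ltac solve_polyfun := repeat first
  [ assumption | apply: polyfun_const | apply: polyfun_var
  | apply: polyfun_mk4 | apply: polyfun_exp | apply: polyfun_opp
  | apply: polyfun_add | apply: polyfun_mul ].

(** In the real coordinates of [Q] (real and imaginary parts of [z1], [z2], [zeta], and [u]) the
    tangency equation is a polynomial [F] vanishing on a small real box, hence for all complex
    values. At complex values [x + i y] and [x - i y] are unrelated, which is the polarization. *)
Lemma polar_of_real (R : realType) (X : vf R) (eps : R) : 0 < eps ->
  (forall j, polyfun (X j)) ->
  (forall z1 z2 zeta u, cnorm z1 <= eps -> cnorm z2 <= eps -> cnorm zeta <= eps ->
    `|u| <= eps ->
    let y := mk4 z1 z2 zeta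
      (Complex u (2 * complex.Re (z1 * cj zeta + z2 * cj zeta ^+ 2))) in
    dQ y (fun j => X j y) = 0) ->
  polar_tangent (ci R) (quad_of X) (quad_of (cjX X)).
Proof.
move=> e0 pX H.
have pX' j : polyfun (cjX X j) by apply: polyfun_cj.
pose y0 : 'I_7 := @Ordinal 7 0 isT. pose y1 : 'I_7 := @Ordinal 7 1 isT.
pose y2 : 'I_7 := @Ordinal 7 2 isT. pose y3 : 'I_7 := @Ordinal 7 3 isT.
pose y4 : 'I_7 := @Ordinal 7 4 isT. pose y5 : 'I_7 := @Ordinal 7 5 isT.
pose y6 : 'I_7 := @Ordinal 7 6 isT.
pose T7 := 'I_7 -> R[i].
pose Z1 (y : T7) := y y0 + ci R * y y1. pose A1 (y : T7) := y y0 + - (ci R * y y1).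
pose Z2 (y : T7) := y y2 + ci R * y y3. pose A2 (y : T7) := y y2 + - (ci R * y y3).
pose T (y : T7) := y y4 + ci R * y y5. pose B (y : T7) := y y4 + - (ci R * y y5).
pose PP (y : T7) := Z1 y * B y + A1 y * T y + Z2 y * B y ^+ 2 + A2 y * T y ^+ 2.
pose W (y : T7) := y y6 + ci R * PP y. pose V (y : T7) := y y6 + - (ci R * PP y).
pose Xc j (y : T7) := X j (mk4 (Z1 y) (Z2 y) (T y) (W y)).
pose Yc j (y : T7) := cjX X j (mk4 (A1 y) (A2 y) (B y) (V y)).
pose F (y : T7) := Xc iw y + - Yc iw y + - (2 * ci R * (Xc iz1 y * B y + Yc iz1 y * T y
   + Z1 y * Yc izeta y + A1 y * Xc izeta y + Xc iz2 y * B y ^+ 2 + Yc iz2 y * T y ^+ 2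
   + 2 * Z2 y * B y * Yc izeta y + 2 * A2 y * T y * Xc izeta y)).
have pZ1 : polyfun Z1 by rewrite /Z1; solve_polyfun.
have pA1 : polyfun A1 by rewrite /A1; solve_polyfun.
have pZ2 : polyfun Z2 by rewrite /Z2; solve_polyfun.
have pA2 : polyfun A2 by rewrite /A2; solve_polyfun.
have pT : polyfun T by rewrite /T; solve_polyfun.
have pB : polyfun B by rewrite /B; solve_polyfun.
have pPP : polyfun PP by rewrite /PP; solve_polyfun.
have pW : polyfun W by rewrite /W; solve_polyfun.
have pV : polyfun V by rewrite /V; solve_polyfun.
have pXc j : polyfun (Xc j) by apply: polyfun_mk4.
have pYc j : polyfun (Yc j) by apply: polyfun_mk4.
have pF : polyfun F by rewrite /F; solve_polyfun.
have F0 : forall y, F y = 0.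
  apply: (polyfun_real_zero (eps := eps / 2)) pF _ => [|x hx]; first by rewrite divr_gt0.
  set y : T7 := fun i => (x i)%:C.
  have AZ1 : A1 y = cj (Z1 y).
    by apply/eqP; rewrite eq_complex /=; apply/andP; split; apply/eqP; ring.
  have AZ2 : A2 y = cj (Z2 y).
    by apply/eqP; rewrite eq_complex /=; apply/andP; split; apply/eqP; ring.
  have AT : B y = cj (T y).
    by apply/eqP; rewrite eq_complex /=; apply/andP; split; apply/eqP; ring.
  have PE : PP y = (2 * complex.Re (Z1 y * cj (T y) + Z2 y * cj (T y) ^+ 2))%:C.
    rewrite /PP AZ1 AZ2 AT; case: (Z1 y) => a1 b1; case: (Z2 y) => a2 b2.
    case: (T y) => a3 b3.
    by apply/eqP; rewrite eq_complex /=; apply/andP; split; apply/eqP; ring.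
  have WE : W y = Complex (x y6) (2 * complex.Re (Z1 y * cj (T y) + Z2 y * cj (T y) ^+ 2)).
    rewrite /W PE; set P := 2 * _.
    by apply/eqP; rewrite eq_complex /=; apply/andP; split; apply/eqP; ring.
  have VE : V y = cj (W y).
    rewrite WE /V PE; set P := 2 * _.
    by apply/eqP; rewrite eq_complex /=; apply/andP; split; apply/eqP; ring.
  have nrm (a b : 'I_7) : cnorm (y a + ci R * y b) <= eps.
    apply: le_trans (cnormD _ _) _; rewrite cnormM cnorm_ci mul1r !cnorm_real.
    have := hx a; have := hx b; lra.
  have hu : `|x y6| <= eps by have := hx y6; lra.
  have /= := H (Z1 y) (Z2 y) (T y) (x y6) (nrm _ _) (nrm _ _) (nrm _ _) hu.
  rewrite -WE => D0.
  have := dQ_complex (mk4 (Z1 y) (Z2 y) (T y) (W y))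
    (fun j => X j (mk4 (Z1 y) (Z2 y) (T y) (W y))).
  rewrite D0 mulr0 /= => E.
  rewrite /F /Yc /cjX cj_mk4 AZ1 AZ2 AT VE !cjK -/(Xc iz1 y) -/(Xc iz2 y) -/(Xc izeta y) -/(Xc iw y).
  by rewrite [RHS]E /Xc /mk4 /=; ring.
have two0 : 2 != 0 :> R[i] by rewrite pnatr_eq0.
have i0 := ci_neq0 R.
move=> z1 z2 t a1 a2 b v w.
pose P := z1 * b + a1 * t + z2 * b ^+ 2 + a2 * t ^+ 2.
(* Inverse of the change of variables; the last entry is [v + i P] because [V y] must equal [v]. *)
pose y : T7 := fun i => match nat_of_ord i with
  | 0 => (z1 + a1) / 2 | 1 => (z1 - a1) / (2 * ci R)
  | 2 => (z2 + a2) / 2 | 3 => (z2 - a2) / (2 * ci R)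
  | 4 => (t + b) / 2 | 5 => (t - b) / (2 * ci R) | _ => v + ci R * P end.
have e1 : Z1 y = z1 by rewrite /Z1 /y /=; field; rewrite ?i0 ?two0.
have e2 : A1 y = a1 by rewrite /A1 /y /=; field; rewrite ?i0 ?two0.
have e3 : Z2 y = z2 by rewrite /Z2 /y /=; field; rewrite ?i0 ?two0.
have e4 : A2 y = a2 by rewrite /A2 /y /=; field; rewrite ?i0 ?two0.
have e5 : T y = t by rewrite /T /y /=; field; rewrite ?i0 ?two0.
have e6 : B y = b by rewrite /B /y /=; field; rewrite ?i0 ?two0.
have e7 : PP y = P by rewrite /PP e1 e2 e3 e4 e5 e6.
have e8 : V y = v by rewrite /V e7 /y /=; ring.
have e9 : W y = w by rewrite /W e7 /y /= /w -/P; ring.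
have := F0 y; rewrite /F /Xc /Yc e1 e2 e3 e4 e5 e6 e8 e9 => /eqP.
by rewrite subr_eq0 => /eqP.
Qed.

Lemma mk4_line (C : numFieldType) (x1 x2 x3 x4 v1 v2 v3 v4 s : C) :
  (fun i => mk4 x1 x2 x3 x4 i + s * mk4 v1 v2 v3 v4 i) =
  mk4 (x1 + s * v1) (x2 + s * v2) (x3 + s * v3) (x4 + s * v4).
Proof. by apply: funext; elim/ord4P. Qed.

Lemma polyfun_axis (C : numFieldType) (F : ('I_4 -> C) -> C) : polyfun F ->
  axis_poly (fun z1 z2 t w => F (mk4 z1 z2 t w)).
Proof.
move=> /polyfun_line[n H] w; split.
- have [p [_ hp]] := H (mk4 0 0 0 w) (mk4 1 0 0 0); exists p => s.
  by rewrite -hp mk4_line !(mulr0, mulr1, add0r, addr0).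
- have [p [_ hp]] := H (mk4 0 0 0 w) (mk4 0 1 0 0); exists p => s.
  by rewrite -hp mk4_line !(mulr0, mulr1, add0r, addr0).
- have [p [_ hp]] := H (mk4 0 0 0 w) (mk4 0 0 1 0); exists p => s.
  by rewrite -hp mk4_line !(mulr0, mulr1, add0r, addr0).
Qed.

Lemma polyfun_wsize (C : numFieldType) (F : ('I_4 -> C) -> C) : polyfun F ->
  exists n, wsize n (fun z1 z2 t w => F (mk4 z1 z2 t w)).
Proof.
move=> /polyfun_line[n H]; exists n => z1 z2 t.
have [p [sp hp]] := H (mk4 z1 z2 t 0) (mk4 0 0 0 1); exists p; split=> // w.
by rewrite -hp mk4_line !(mulr0, mulr1, add0r, addr0).
Qed.

Lemma polyfun_wsizeq (C : numFieldType) (X : 'I_4 -> ('I_4 -> C) -> C) :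
  (forall j, polyfun (X j)) ->
  exists n, forall m, (n <= m)%N -> wsizeq m (quad_of X).
Proof.
move=> pX.
have mono k l F : (k <= l)%N -> @wsize C k F -> wsize l F.
  move=> kl H z1 z2 t; have [p [sp hp]] := H z1 z2 t.
  by exists p; split=> //; apply: leq_trans kl.
have [n1 h1] := polyfun_wsize (pX iz1); have [n2 h2] := polyfun_wsize (pX iz2).
have [n3 h3] := polyfun_wsize (pX izeta); have [n4 h4] := polyfun_wsize (pX iw).
exists (n1 + n2 + n3 + n4)%N => m le.
by split; [apply: mono h1|apply: mono h2|apply: mono h3|apply: mono h4]; lia.
Qed.

Lemma cjD (R : realType) (x y : R[i]) : cj (x + y) = cj x + cj y.
Proof. exact: rmorphD. Qed.

Lemma cjM (R : realType) (x y : R[i]) : cj (x * y) = cj x * cj y.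
Proof. exact: rmorphM. Qed.

Lemma cjN (R : realType) (x : R[i]) : cj (- x) = - cj x.
Proof. exact: rmorphN. Qed.

(** At points with real coordinates [cjX X] takes the conjugate of the value of [X]. Comparing the
    two families at points with coordinates 0, 1, -1 shows that primed parameters are conjugates and
    that the unpaired ones are real. *)
Lemma real_fam (R : realType) (X : vf R) (eps : R) : 0 < eps ->
  (forall j, polyfun (X j)) ->
  (forall z1 z2 zeta u, cnorm z1 <= eps -> cnorm z2 <= eps -> cnorm zeta <= eps ->
    `|u| <= eps ->
    let y := mk4 z1 z2 zeta
      (Complex u (2 * complex.Re (z1 * cj zeta + z2 * cj zeta ^+ 2))) in
    dQ y (fun j => X j y) = 0) ->
  exists p, in_fam (ci R) p (quad_of X) /\
  [/\ pa' p = cj (pa p), pb' p = cj (pb p), pc' p = cj (pc p), pM' p = cj (pM p)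
    & pm' p = cj (pm p)] /\
  [/\ pN' p = cj (pN p), cj (pd p) = pd p, cj (pk p) = pk p, cj (pl p) = pl p
    & cj (pn p) = pn p].
Proof.
move=> e0 pX H.
have pX' j : polyfun (cjX X j) by apply: polyfun_cj.
have PT := polar_of_real e0 pX H.
have [n1 h1] := polyfun_wsizeq pX; have [n2 h2] := polyfun_wsizeq pX'.
have aX : axis_polyq (quad_of X) by split; apply: polyfun_axis.
have aX' : axis_polyq (quad_of (cjX X)) by split; apply: polyfun_axis.
have [p [fX fY]] := fam_classify (ci_neq0 R) PT aX aX'
  (h1 _ (leq_addr n2 n1)) (h2 _ (leq_addl n1 n2)).
exists p; split=> //.
have rel z1 z2 t w j : cj z1 = z1 -> cj z2 = z2 -> cj t = t -> cj w = w ->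
    cjX X j (mk4 z1 z2 t w) = cj (X j (mk4 z1 z2 t w)).
  by move=> h1' h2' h3' h4'; rewrite /cjX cj_mk4 h1' h2' h3' h4'.
have c0 : cj (0 : R[i]) = 0 by rewrite /cj conjc0.
have c1 : cj (1 : R[i]) = 1 by rewrite /cj conjc1.
have cN1 : cj (-1 : R[i]) = -1 by rewrite cjN c1.
have i0 := ci_neq0 R.
have two0 : 2 != 0 :> R[i] by rewrite pnatr_eq0.
have three0 : 3 != 0 :> R[i] by rewrite pnatr_eq0.
have Ea : pa' p = cj (pa p).
  have [fx _ _ _] := fX 0 0 0 0; have [fy _ _ _] := fY 0 0 0 0.
  rewrite /= in fx fy; rewrite rel // fx in fy.
  rewrite (_ : pa p = pa p - 2 * pc' p * 0 + ci R * pk p * 0 + pM p * 0 + pm p * 0 ^+ 2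
     + 2 * ci R * pN' p * 0 * 0 + pN p * 0); last by ring.
  by rewrite fy; ring.
have Eb : pb' p = cj (pb p).
  have [_ gx _ _] := fX 0 0 0 0; have [_ gy _ _] := fY 0 0 0 0.
  rewrite /= in gx gy; rewrite rel // gx in gy.
  rewrite (_ : pb p = pb p + (2 * pM p - 3 * pl p) * 0 - pm' p * 0 + 2 * ci R * pN' p * 0 * 0
     - ci R * pN p * 0 + ci R * pn p * 0 ^+ 2); last by ring.
  by rewrite gy; ring.
have Ec : pc' p = cj (pc p).
  have [_ _ hx _] := fX 0 0 0 0; have [_ _ hy _] := fY 0 0 0 0.
  rewrite /= in hx hy; rewrite rel // hx in hy.
  rewrite (_ : pc p = pc p + (3 * pl p - pM' p) * 0 + ci R * pN' p * 0 ^+ 2); last by ring.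
  by rewrite hy; ring.
have Ed : cj (pd p) = pd p.
  have [_ _ _ ex] := fX 0 0 0 0; have [_ _ _ ey] := fY 0 0 0 0.
  rewrite /= in ex ey; rewrite rel // ex in ey.
  rewrite {1}(_ : pd p = pd p + 2 * ci R * pa' p * 0 + 2 * ci R * pc' p * 0 +
     2 * ci R * pb' p * 0 ^+ 2 + 3 * pl p * 0 + 2 * ci R * pN' p * 0 * 0); last by ring.
  by rewrite ey; ring.
have EM : pM' p = cj (pM p).
  have [fx _ _ _] := fX 1 0 0 0; have [fy _ _ _] := fY 1 0 0 0.
  rewrite /= in fx fy; rewrite rel // fx in fy.
  apply: (addrI (cj (pa p))); rewrite -cjD -{1}Ea.
  rewrite (_ : pa p + pM p = pa p - 2 * pc' p * 0 + ci R * pk p * 0 + pM p * 1 + pm p * 0 ^+ 2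
     + 2 * ci R * pN' p * 1 * 0 + pN p * 0); last by ring.
  by rewrite fy; ring.
have EN : pN' p = cj (pN p).
  have [fx _ _ _] := fX 0 0 0 1; have [fy _ _ _] := fY 0 0 0 1.
  rewrite /= in fx fy; rewrite rel // fx in fy.
  apply: (addrI (cj (pa p))); rewrite -cjD -{1}Ea.
  rewrite (_ : pa p + pN p = pa p - 2 * pc' p * 0 + ci R * pk p * 0 + pM p * 0 + pm p * 0 ^+ 2
     + 2 * ci R * pN' p * 0 * 0 + pN p * 1); last by ring.
  by rewrite fy; ring.
have El : cj (pl p) = pl p.
  have [_ _ _ ex] := fX 0 0 0 1; have [_ _ _ ey] := fY 0 0 0 1.
  rewrite /= in ex ey; rewrite rel // ex in ey.
  apply: (mulfI three0); apply: (addrI (pd p)).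
  have c3 : cj (3 : R[i]) = 3 by rewrite /cj conjc_nat.
  rewrite -{1}Ed -{1}c3 -cjM -cjD.
  rewrite (_ : pd p + 3 * pl p = pd p + 2 * ci R * pa' p * 0 + 2 * ci R * pc' p * 0 +
     2 * ci R * pb' p * 0 ^+ 2 + 3 * pl p * 1 + 2 * ci R * pN' p * 0 * 1); last by ring.
  by rewrite ey; ring.
(* The points [t = 1] and [t = -1] separate the linear parameter [pk] from the quadratic one
   [pm]. *)
have [Ek Em] : cj (pk p) = pk p /\ pm' p = cj (pm p).
  have [fx _ _ _] := fX 0 0 1 0; have [fy _ _ _] := fY 0 0 1 0.
  have [fx' _ _ _] := fX 0 0 (-1) 0; have [fy' _ _ _] := fY 0 0 (-1) 0.
  rewrite /= in fx fy fx' fy'; rewrite rel // fx in fy; rewrite rel // fx' in fy'.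
  have E1 : cj (pa p) - ci R * cj (pk p) + cj (pm p) = cj (pa p) - ci R * pk p + pm' p.
    rewrite -mulNr -cj_ci -cjM -!cjD.
    rewrite (_ : pa p + ci R * pk p + pm p = pa p - 2 * pc' p * 0 + ci R * pk p * 1 + pM p * 0
      + pm p * 1 ^+ 2 + 2 * ci R * pN' p * 0 * 1 + pN p * 0); last by ring.
    by rewrite fy -Ea; ring.
  have E2 : cj (pa p) + ci R * cj (pk p) + cj (pm p) = cj (pa p) + ci R * pk p + pm' p.
    rewrite -[ci R * cj _]opprK -mulNr -cj_ci -cjM -cjN -!cjD.
    rewrite (_ : pa p - ci R * pk p + pm p = pa p - 2 * pc' p * 0 + ci R * pk p * -1 + pM p * 0
      + pm p * (-1) ^+ 2 + 2 * ci R * pN' p * 0 * -1 + pN p * 0); last by ring.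
    by rewrite fy' -Ea; ring.
  have E3 : 2 * ci R * cj (pk p) = 2 * ci R * pk p.
    have -> : 2 * ci R * cj (pk p) = (cj (pa p) + ci R * cj (pk p) + cj (pm p))
       - (cj (pa p) - ci R * cj (pk p) + cj (pm p)) by ring.
    by rewrite E1 E2; ring.
  have Ek : cj (pk p) = pk p by apply: mulfI E3; rewrite mulf_neq0.
  by split=> //; move: E1; rewrite Ek => /addrI ->.
have En : cj (pn p) = pn p.
  have [_ gx _ _] := fX 0 0 1 0; have [_ gy _ _] := fY 0 0 1 0.
  rewrite /= in gx gy; rewrite rel // gx in gy.
  have E1 : cj (pb p) - cj (pm' p) - ci R * cj (pn p) = pb' p - pm p - ci R * pn p.
    rewrite -[- (_ * _)]mulNr -{1}cj_ci -cjM -cjN -!cjD.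
    rewrite (_ : pb p - pm' p + ci R * pn p = pb p + (2 * pM p - 3 * pl p) * 0 - pm' p * 1
      + 2 * ci R * pN' p * 0 * 1 - ci R * pN p * 0 + ci R * pn p * 1 ^+ 2); last by ring.
    by rewrite gy; ring.
  by move: E1; rewrite Em cjK Eb => /addrI /oppr_inj; apply: mulfI.
by [].
Qed.

(** * Monomials in four variables and recovery of coefficients *)

Definition mexp4 (i j k l : nat) : {ffun 'I_4 -> nat} :=
  [ffun x => mk4 i j k l x].

Lemma mexp4_eq i j k l i' j' k' l' : (mexp4 i j k l == mexp4 i' j' k' l') =
  [&& i == i', j == j', k == k' & l == l'].
Proof.
apply/eqP/idP => [/ffunP e|/and4P[/eqP-> /eqP-> /eqP-> /eqP->] //].
have := e iz1; have := e iz2; have := e izeta; have := e iw.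
by rewrite !ffunE /mk4 /= => -> -> -> ->; rewrite !eqxx.
Qed.

Lemma ffun4E (a : {ffun 'I_4 -> nat}) : a = mexp4 (a iz1) (a iz2) (a izeta) (a iw).
Proof. by apply/ffunP; elim/ord4P; rewrite ffunE. Qed.

Lemma prod_ord4 (C : comPzRingType) (F : 'I_4 -> C) :
  \prod_(j < 4) F j = F iz1 * F iz2 * F izeta * F iw.
Proof.
rewrite !big_ord_recl big_ord0 mulr1 !mulrA.
by congr (_ * _ * _ * _); congr F; apply/val_inj.
Qed.

Definition mcoef (C : pzRingType) (s : seq (C * {ffun 'I_4 -> nat}))
  (a : {ffun 'I_4 -> nat}) : C := \sum_(m <- s) m.1 * (a == m.2)%:R.

Definition mpol (C : comPzRingType) (s : seq (C * {ffun 'I_4 -> nat}))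
  (x : 'I_4 -> C) : C := \sum_(m <- s) m.1 * \prod_(j < 4) x j ^+ m.2 j.

Lemma box_sum_delta (T : zmodType) k N (a0 : {ffun 'I_k -> nat}) (G : {ffun 'I_k -> nat} -> T) :
  (forall j, (a0 j < N)%N) -> (forall a, a != a0 -> G a = 0) ->
  \sum_(a : {ffun 'I_k -> 'I_N}) G (mexp a) = G a0.
Proof.
move=> lt H; pose b : {ffun 'I_k -> 'I_N} := [ffun j => Ordinal (lt j)].
have be : mexp b = a0 by apply/ffunP => j; rewrite !ffunE.
rewrite (bigD1 b) //= be big1 ?addr0 // => a ab; apply: H.
apply: contraNneq ab => e; apply/eqP/ffunP => j; apply/val_inj.
by move/ffunP: e => /(_ j); rewrite !ffunE.
Qed.

Lemma psum_mcoef (R : realType) (s : seq (R[i] * {ffun 'I_4 -> nat})) x N :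
  (forall m, m \in s -> forall j, (m.2 j < N)%N) -> psum (mcoef s) x N = mpol s x.
Proof.
move=> H; rewrite /psum /mcoef /mpol.
under eq_bigr do rewrite mulr_suml.
rewrite exchange_big /= big_seq [RHS]big_seq; apply: eq_bigr => m ms.
rewrite (box_sum_delta (a0 := m.2) (G := fun a => m.1 * (a == m.2)%:R * \prod_(j < 4) x j ^+ a j)).
- by rewrite eqxx mulr1.
- exact: H.
- by move=> a /negPf ->; rewrite mulr0 mul0r.
Qed.

Lemma digits (N a b x y : nat) : (a < N)%N -> (b < N)%N ->
  (a + N * x = b + N * y)%N -> a = b /\ x = y.
Proof.
move=> aN bN e.
have ab : a = b.
  have := congr1 (fun z => z %% N)%N e.
  by rewrite ![(N * _)%N]mulnC ![(_ + _ * N)%N]addnC !modnMDl !modn_small.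
split=> //; move: e; rewrite ab => /addnI/eqP; rewrite eqn_pmul2l ?(leq_trans _ aN) //.
by move/eqP.
Qed.

(* Kronecker substitution [x_j = s ^ (N ^ j)] makes all monomials of the box
   distinct powers of [s]. *)
Lemma psum_inj (R : realType) N (c d : {ffun 'I_4 -> nat} -> R[i]) :
  (forall x, psum c x N = psum d x N) ->
  forall a : {ffun 'I_4 -> nat}, (forall j, (a j < N)%N) -> c a = d a.
Proof.
move=> H a0 lt.
pose code (a : {ffun 'I_4 -> nat}) :=
  (a iz1 + N * (a iz2 + N * (a izeta + N * a iw)))%N.
pose Q := \sum_(a : {ffun 'I_4 -> 'I_N}) (c (mexp a) - d (mexp a)) *: 'X^(code (mexp a)).
have Q0 : Q = 0.
  apply: poly_eq0_horner => s; rewrite /Q horner_sum.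
  have /eqP := H (mk4 s (s ^+ N) (s ^+ (N * N)) (s ^+ (N * (N * N)))).
  rewrite -subr_eq0 /psum -sumrB => /eqP E; rewrite -[RHS]E; apply: eq_bigr => a _.
  rewrite hornerZ hornerXn -mulrBl prod_ord4 /mk4 /= -!exprM -!exprD.
  by congr (_ * _ ^+ _); rewrite /code; ring.
have := congr1 (fun q : {poly R[i]} => q`_(code a0)) Q0.
rewrite coef0 /Q coef_sum; under eq_bigr do rewrite coefZ coefXn.
pose b : {ffun 'I_4 -> 'I_N} := [ffun j => Ordinal (lt j)].
have be : mexp b = a0 by apply/ffunP => j; rewrite !ffunE.
rewrite (bigD1 b) //= be eqxx mulr1 big1 ?addr0 => [|a ab]; first by move/subr0_eq.
case: eqP => [e|]; last by rewrite mulr0.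
have lta j : (mexp a j < N)%N by rewrite ffunE.
have [e0 {}e] := digits (lt _) (lta _) e.
have [e1 {}e] := digits (lt _) (lta _) e.
have [e2 e3] := digits (lt _) (lta _) e.
case/eqP: ab; apply/ffunP => j; apply/val_inj.
have -> : val (a j) = mexp a j by rewrite ffunE.
have -> : val (b j) = a0 j by rewrite ffunE.
by elim/ord4P: j.
Qed.

(** The family of [in_fam] as lists of monomials, so that one datum gives both its values ([mpol])
    and its coefficients ([mcoef]). *)
Definition famlist (C : comPzRingType) (j : C) (p : param C) (i : 'I_4) :
    seq (C * {ffun 'I_4 -> nat}) :=
  match nat_of_ord i with
  | 0 => [:: (pa p, mexp4 0 0 0 0); (- 2 * pc' p, mexp4 0 1 0 0);
             (j * pk p, mexp4 0 0 1 0); (pM p, mexp4 1 0 0 0);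
             (pm p, mexp4 0 0 2 0); (2 * j * pN' p, mexp4 1 0 1 0);
             (pN p, mexp4 0 0 0 1)]
  | 1 => [:: (pb p, mexp4 0 0 0 0); (2 * pM p - 3 * pl p, mexp4 0 1 0 0);
             (- pm' p, mexp4 0 0 1 0); (2 * j * pN' p, mexp4 0 1 1 0);
             (- j * pN p, mexp4 1 0 0 0); (j * pn p, mexp4 0 0 2 0)]
  | 2 => [:: (pc p, mexp4 0 0 0 0); (3 * pl p - pM' p, mexp4 0 0 1 0);
             (j * pN' p, mexp4 0 0 2 0)]
  | _ => [:: (pd p, mexp4 0 0 0 0); (2 * j * pa' p, mexp4 0 0 1 0);
             (2 * j * pc' p, mexp4 1 0 0 0); (2 * j * pb' p, mexp4 0 0 2 0);
             (3 * pl p, mexp4 0 0 0 1); (2 * j * pN' p, mexp4 0 0 1 1)]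
  end.

Lemma famlist_lt (C : comPzRingType) (j : C) (p : param C) i m :
  m \in famlist j p i -> forall k, (m.2 k < 3)%N.
Proof.
have S (s : seq (C * {ffun 'I_4 -> nat})) :
    all (fun e : {ffun 'I_4 -> nat} => [forall k, (e k < 3)%N]) (map snd s) ->
    m \in s -> forall k, (m.2 k < 3)%N.
  by move=> /allP H ms; apply/forallP/H/map_f.
apply: S; elim/ord4P: i; apply/allP => e /=; rewrite !inE;
  move=> H; repeat (case/orP: H => [/eqP->|H]); try move/eqP: H => ->;
  by apply/forallP; elim/ord4P; rewrite ffunE.
Qed.

Lemma mpol_famlist (R : realType) (j : R[i]) (p : param R[i]) (X : vf R) :
  in_fam j p (quad_of X) -> forall i x, X i x = mpol (famlist j p i) x.
Proof.
move=> H i x; have xE : x = mk4 (x iz1) (x iz2) (x izeta) (x iw).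
  by apply: funext; elim/ord4P.
have [/= f g h e] := H (x iz1) (x iz2) (x izeta) (x iw); rewrite -xE in f g h e.
rewrite /mpol; elim/ord4P: i; rewrite ?f ?g ?h ?e /famlist /= !big_cons big_nil /=;
  rewrite !prod_ord4 !ffunE /mk4 /=; ring.
Qed.

(** * Sixteen linear coordinates on tangent fields *)

(* Coordinates [0..6] are the values at the origin that are not forced by
   tangency; the last nine determine the fields vanishing at the origin. *)
Definition coords (R : realType) (c : 'I_4 -> {ffun 'I_4 -> nat} -> R[i])
    (n : nat) : R :=
  match n with
  | 0 => complex.Re (c iw (mexp4 0 0 0 0))
  | 1 => complex.Re (c iz1 (mexp4 0 0 0 0))
  | 2 => complex.Im (c iz1 (mexp4 0 0 0 0))
  | 3 => complex.Re (c iz2 (mexp4 0 0 0 0))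
  | 4 => complex.Im (c iz2 (mexp4 0 0 0 0))
  | 5 => complex.Re (c izeta (mexp4 0 0 0 0))
  | 6 => complex.Im (c izeta (mexp4 0 0 0 0))
  | 7 => complex.Im (c iz1 (mexp4 0 0 1 0))
  | 8 => complex.Re (c iz1 (mexp4 1 0 0 0))
  | 9 => complex.Im (c iz1 (mexp4 1 0 0 0))
  | 10 => complex.Re (c iz1 (mexp4 0 0 2 0))
  | 11 => complex.Im (c iz1 (mexp4 0 0 2 0))
  | 12 => complex.Re (c iw (mexp4 0 0 0 1))
  | 13 => complex.Re (c iz1 (mexp4 0 0 0 1))
  | 14 => complex.Im (c iz1 (mexp4 0 0 0 1))
  | _ => complex.Im (c iz2 (mexp4 0 0 2 0))
  end.

Lemma Re_lincomb (R : realType) n (lam : 'I_n -> R) (x : 'I_n -> R[i]) :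
  complex.Re (\sum_(i < n) (lam i)%:C * x i) = \sum_(i < n) lam i * complex.Re (x i).
Proof.
elim: n lam x => [|n IH] lam x; first by rewrite !big_ord0.
rewrite !big_ord_recl -IH; set S := \sum_(i < n) _.
by case: (x ord0) => a b; case: S => a' b' /=; rewrite mul0r subr0.
Qed.

Lemma Im_lincomb (R : realType) n (lam : 'I_n -> R) (x : 'I_n -> R[i]) :
  complex.Im (\sum_(i < n) (lam i)%:C * x i) = \sum_(i < n) lam i * complex.Im (x i).
Proof.
elim: n lam x => [|n IH] lam x; first by rewrite !big_ord0.
rewrite !big_ord_recl -IH; set S := \sum_(i < n) _.
by case: (x ord0) => a b; case: S => a' b' /=; rewrite mul0r addr0.
Qed.

Lemma coords_lincomb (R : realType) n (lam : 'I_n -> R)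
    (c : 'I_n -> 'I_4 -> {ffun 'I_4 -> nat} -> R[i]) k :
  coords (fun j a => \sum_(i < n) (lam i)%:C * c i j a) k =
  \sum_(i < n) lam i * coords (c i) k.
Proof.
by do 16 (case: k => [|k]; first by rewrite /coords ?Re_lincomb ?Im_lincomb);
   rewrite /coords Im_lincomb.
Qed.

(** The leading component lies in the real family, and each of its coefficients is either the one of
    [c4] or 0. So the vanishing coordinates of [c4] annihilate its parameters one after the
    other. *)
Lemma lead_zero (R : realType) phi (r : R) c7 (X : vf R)
    (c4 : 'I_4 -> {ffun 'I_4 -> nat} -> R[i]) (K : nat) :
  0 < r <= 1 -> (forall a, c7 a != 0 -> (4 <= weight7 a)%N) ->
  series_on7 phi r c7 ->
  (forall j p, near0 r p -> series_at (c4 j) p (X j p)) ->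
  (forall p, near0 r p -> rhoG phi p = 0 -> dphi_limit c7 p (fun j => X j p)) ->
  (forall k, (k < 16)%N -> coords c4 k = 0) ->
  (forall j a, (weight wt4 a + 3 < K + wt4 j)%N -> c4 j a = 0) ->
  forall j a, (weight wt4 a + 3 = K + wt4 j)%N -> c4 j a = 0.
Proof.
move=> r01 w7 Hc HX Hlim jet cK; have /andP[r0 r1] := r01.
have r12 : 0 < r / 12 by rewrite divr_gt0.
have pl4 j : polyfun (lead4 K c4 j) by apply: psum_polyfun.
have [p [fam [[Ea Eb Ec EM Em] [EN Ed Ek El En]]]] :=
  real_fam r12 pl4 (leading_tangent r01 w7 Hc HX Hlim cK).
have lcE j (a : {ffun 'I_4 -> nat}) : (forall i, (a i < K + 4)%N) ->
    lead_coef4 K j (c4 j) a = mcoef (famlist (ci R) p j) a.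
  move=> lt; apply: (psum_inj (N := (K + 4)%N)) => // x.
  rewrite psum_mcoef; first exact: (mpol_famlist fam).
  by move=> m ms k; apply: leq_trans (famlist_lt ms k) _; lia.
have small i j k l : (i < 3)%N -> (j < 3)%N -> (k < 3)%N -> (l < 3)%N ->
    forall n, (mexp4 i j k l n < K + 4)%N.
  by move=> h1 h2 h3 h4; elim/ord4P; rewrite ffunE /mk4 /=; lia.
have lc0 j a : (c4 j a = 0) -> lead_coef4 K j (c4 j) a = 0.
  by move=> h; rewrite /lead_coef4; case: ifP.
have lcRe j a : (complex.Re (c4 j a) = 0) -> complex.Re (lead_coef4 K j (c4 j) a) = 0.
  by move=> h; rewrite /lead_coef4; case: ifP.
have lcIm j a : (complex.Im (c4 j a) = 0) -> complex.Im (lead_coef4 K j (c4 j) a) = 0.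
  by move=> h; rewrite /lead_coef4; case: ifP.
have C0 (x : R[i]) : complex.Re x = 0 -> complex.Im x = 0 -> x = 0.
  by case: x => a b /= -> ->.
have R0 (x : R[i]) : cj x = x -> complex.Re x = 0 -> x = 0.
  case: x => a b /= [] /eqP; rewrite eq_sym -addr_eq0 => /eqP b0 ->.
  by rewrite (_ : b = 0) //; lra.
have I0 (x : R[i]) : cj x = x -> complex.Im (ci R * x) = 0 -> x = 0.
  by move=> /R0 H; case: x H => a b H /=; rewrite mul0r add0r mul1r => h; apply: H.
have ev j i k l n : (i < 3)%N -> (k < 3)%N -> (l < 3)%N -> (n < 3)%N ->
   lead_coef4 K j (c4 j) (mexp4 i k l n) = mcoef (famlist (ci R) p j) (mexp4 i k l n).
  by move=> h1 h2 h3 h4; apply/lcE/small.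
(* The parameters [pd], [pk], [pl], [pn] are real, so a single real coordinate is enough for each;
   the others use two. *)
have pd0 : pd p = 0.
  apply: R0 => //; have := lcRe _ _ (jet 0%N isT); rewrite ev //.
  by rewrite /mcoef /famlist /= !big_cons big_nil /= !mexp4_eq /= !(mulr1, mulr0, addr0, add0r).
have pa0 : pa p = 0.
  have := lc0 _ _ (C0 _ (jet 1%N isT) (jet 2%N isT)); rewrite ev //.
  by rewrite /mcoef /famlist /= !big_cons big_nil /= !mexp4_eq /= !(mulr1, mulr0, addr0, add0r).
have pb0 : pb p = 0.
  have := lc0 _ _ (C0 _ (jet 3%N isT) (jet 4%N isT)); rewrite ev //.
  by rewrite /mcoef /famlist /= !big_cons big_nil /= !mexp4_eq /= !(mulr1, mulr0, addr0, add0r).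
have pc0 : pc p = 0.
  have := lc0 _ _ (C0 _ (jet 5%N isT) (jet 6%N isT)); rewrite ev //.
  by rewrite /mcoef /famlist /= !big_cons big_nil /= !mexp4_eq /= !(mulr1, mulr0, addr0, add0r).
have pk0 : pk p = 0.
  apply: I0 => //; have := lcIm _ _ (jet 7%N isT); rewrite ev //.
  by rewrite /mcoef /famlist /= !big_cons big_nil /= !mexp4_eq /= !(mulr1, mulr0, addr0, add0r).
have pM0 : pM p = 0.
  have := lc0 _ _ (C0 _ (jet 8%N isT) (jet 9%N isT)); rewrite ev //.
  by rewrite /mcoef /famlist /= !big_cons big_nil /= !mexp4_eq /= !(mulr1, mulr0, addr0, add0r).
have pm0 : pm p = 0.
  have := lc0 _ _ (C0 _ (jet 10%N isT) (jet 11%N isT)); rewrite ev //.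
  by rewrite /mcoef /famlist /= !big_cons big_nil /= !mexp4_eq /= !(mulr1, mulr0, addr0, add0r).
have three0 : 3 != 0 :> R[i] by rewrite pnatr_eq0.
have pl0 : pl p = 0.
  apply/eqP; rewrite -(mulrI_eq0 _ (mulfI three0)); apply/eqP.
  apply: R0; first by rewrite cjM El; congr (_ * _); rewrite /cj conjc_nat.
  have := lcRe _ _ (jet 12%N isT); rewrite ev //.
  by rewrite /mcoef /famlist /= !big_cons big_nil /= !mexp4_eq /= !(mulr1, mulr0, addr0, add0r).
have pN0 : pN p = 0.
  have := lc0 _ _ (C0 _ (jet 13%N isT) (jet 14%N isT)); rewrite ev //.
  by rewrite /mcoef /famlist /= !big_cons big_nil /= !mexp4_eq /= !(mulr1, mulr0, addr0, add0r).
have pn0 : pn p = 0.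
  apply: I0 => //; have := lcIm _ _ (jet 15%N isT); rewrite ev //.
  by rewrite /mcoef /famlist /= !big_cons big_nil /= !mexp4_eq /= !(mulr1, mulr0, addr0, add0r).
have c00 : cj (0 : R[i]) = 0 by rewrite /cj conjc0.
have F0 j a : mcoef (famlist (ci R) p j) a = 0.
  rewrite /mcoef; elim/ord4P: j; rewrite /famlist /= !big_cons big_nil /=;
  by rewrite ?Ea ?Eb ?Ec ?EM ?Em ?EN ?pd0 ?pa0 ?pb0 ?pc0 ?pk0 ?pM0 ?pm0 ?pl0 ?pN0 ?pn0 ?c00
    !(mulr0, subr0, oppr0, mul0r, addr0).
move=> j a wa.
have lt i : (a i < K + 4)%N.
  have w3 : (wt4 j <= 3)%N by elim/ord4P: (j).
  have := weight_ge a (wt4_gt0 i); lia.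
by have := lcE j a lt; rewrite F0 /lead_coef4 wa eqxx.
Qed.

Lemma jet_determines (R : realType) phi (r : R) c7 (X : vf R)
    (c4 : 'I_4 -> {ffun 'I_4 -> nat} -> R[i]) :
  0 < r <= 1 -> (forall a, c7 a != 0 -> (4 <= weight7 a)%N) ->
  series_on7 phi r c7 ->
  (forall j p, near0 r p -> series_at (c4 j) p (X j p)) ->
  (forall p, near0 r p -> rhoG phi p = 0 -> dphi_limit c7 p (fun j => X j p)) ->
  (forall k, (k < 16)%N -> coords c4 k = 0) -> forall j a, c4 j a = 0.
Proof.
move=> r01 w7 Hc HX Hlim jet.
have G K : forall j a, (weight wt4 a + 3 < K + wt4 j)%N -> c4 j a = 0.
  (* The base case is empty because [wt4 j] is at most 3. *)
  elim: K => [|K IH] j a.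
    have w3 : (wt4 j <= 3)%N by elim/ord4P: (j).
    by rewrite add0n => h; lia.
  rewrite addSn ltnS leq_eqVlt => /orP[/eqP|]; last exact: IH.
  exact: (lead_zero r01 w7 Hc HX Hlim jet IH).
by move=> j a; apply: (G (weight wt4 a + 4)%N); lia.
Qed.

(** * Linear combinations of tangent fields and the dimension bounds *)

Lemma series_at_zero (R : realType) k (c : {ffun 'I_k -> nat} -> R[i]) x v :
  (forall a, c a = 0) -> series_at c x v -> v = 0.
Proof.
move=> c0 s; apply: cnorm_le0; rewrite -[v]subr0.
apply: (series_at_bound (N0 := 0) s) => N _.
by rewrite /psum big1 ?subr0 ?cnorm0 // => a _; rewrite c0 mul0r.
Qed.

Lemma series_at_origin (R : realType) (c : {ffun 'I_4 -> nat} -> R[i]) v :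
  series_at c (fun=> 0) v -> c (mexp4 0 0 0 0) = v.
Proof.
move=> s; apply/eqP; rewrite eq_sym -subr_eq0; apply/eqP/cnorm_le0.
apply: (series_at_bound (N0 := 1) s) => N N0; rewrite /psum.
rewrite (box_sum_delta (a0 := mexp4 0 0 0 0)
  (G := fun a => c a * \prod_(j < 4) (0 : R[i]) ^+ a j)).
- by rewrite prod_ord4 !ffunE /= !expr0 !mulr1 subrr cnorm0.
- by elim/ord4P; rewrite ffunE.
- move=> a; rewrite {1}(ffun4E a) mexp4_eq prod_ord4 => H.
  apply/eqP; rewrite !mulf_eq0 !expf_eq0 !eqxx !andbT.
  by move: H; rewrite !negb_and -!lt0n => /or4P[]->; rewrite ?orbT.
Qed.

Lemma lincomb_kernel (R : fieldType) (m n : nat) (A : 'I_m -> 'I_n -> R) :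
  (n < m)%N -> exists2 lam : 'I_m -> R, (exists i, lam i != 0) &
    forall k, \sum_(i < m) lam i * A i k = 0.
Proof.
move=> nm; pose M := \matrix_(i < m, k < n) A i k.
have : kermx M != 0.
  rewrite kermx_eq0 /row_free neq_ltn; apply/orP; left.
  by apply: leq_ltn_trans (rank_leq_col M) nm.
move=> /matrix0Pn[i0 [i1 nz]]; exists (fun i => kermx M i0 i); first by exists i1.
move=> k; have := congr1 (fun Z : matrix R m n => Z i0 k) (mulmx_ker M).
by rewrite !mxE => E; rewrite -[RHS]E; apply: eq_bigr => i _; rewrite !mxE.
Qed.

Lemma psum_lincomb (R : realType) k n (lam : 'I_n -> R[i])
    (c : 'I_n -> {ffun 'I_k -> nat} -> R[i]) x N :
  psum (fun a => \sum_(i < n) lam i * c i a) x N = \sum_(i < n) lam i * psum (c i) x N.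
Proof.
rewrite /psum; under eq_bigr do rewrite mulr_suml.
rewrite exchange_big /=; apply: eq_bigr => i _; rewrite mulr_sumr.
by apply: eq_bigr => a _; rewrite mulrA.
Qed.

Definition tends (R : realType) (u : nat -> R) (l : R) : Prop :=
  forall e : R, 0 < e -> exists N0, forall N, (N0 <= N)%N -> `|u N - l| <= e.

Lemma tendsP (R : realType) (u : nat -> R) (l : R) : (u @ \oo --> l)%classic <-> tends u l.
Proof.
split=> [/cvgrPdist_le H e /H[N0 _ HN]|H].
  by exists N0 => N /HN; rewrite distrC.
apply/cvgrPdist_le => e /H[N0 HN]; exists N0 => // N /= /HN.
by rewrite distrC.
Qed.

Lemma tends_lincomb (R : realType) n (lam : 'I_n -> R) (u : 'I_n -> nat -> R)
    (l : 'I_n -> R) : (forall i, tends (u i) (l i)) ->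
  tends (fun N => \sum_(i < n) lam i * u i N) (\sum_(i < n) lam i * l i).
Proof.
move=> H e e0; pose S := \sum_(i < n) `|lam i|.
have S0 : 0 <= S by apply: sumr_ge0.
have S1 : 0 < S + 1 by rewrite ltr_wpDl.
have /choice[N0 HN] : forall i, exists N0, forall N, (N0 <= N)%N -> `|u i N - l i| <= e / (S + 1).
  by move=> i; apply: H; rewrite divr_gt0.
exists (\max_(i < n) N0 i)%N => N le.
rewrite -sumrB; apply: le_trans (ler_norm_sum _ _ _) _.
apply: le_trans (_ : \sum_(i < n) `|lam i| * (e / (S + 1)) <= _).
  apply: ler_sum => i _; rewrite -mulrBr normrM ler_wpM2l // HN //.
  exact: leq_trans (leq_bigmax i) le.
rewrite -mulr_suml -/S mulrCA -[leRHS]mulr1 ler_pM2l // ler_pdivrMr // mul1r.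
by rewrite lerDl.
Qed.

Lemma q7_lincomb (R : realType) n (lam : 'I_n -> R) (V : 'I_n -> pt R) :
  q7 (fun j => \sum_(i < n) (lam i)%:C * V i j) =
  fun k => \sum_(i < n) (lam i)%:C * q7 (V i) k.
Proof.
apply: funext => k; rewrite /q7 /vars7.
have C j : cj (\sum_(i < n) (lam i)%:C * V i j) = \sum_(i < n) (lam i)%:C * cj (V i j).
  rewrite /cj rmorph_sum; apply: eq_bigr => i _.
  by rewrite rmorphM /= oppr0.
case: (nat_of_ord k) => [|[|[|[|[|[|m]]]]]] //.
by rewrite Re_lincomb rmorph_sum; apply: eq_bigr => i _; rewrite rmorphM.
Qed.

Lemma dphi_limit_lincomb (R : realType) n (lam : 'I_n -> R) c (p : pt R)
    (V : 'I_n -> pt R) : (forall i, dphi_limit c p (V i)) ->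
  dphi_limit c p (fun j => \sum_(i < n) (lam i)%:C * V i j).
Proof.
move=> H; have := @tends_lincomb _ _ lam _ _ H.
rewrite -dQ_lincomb => G e /G[N0 HN]; exists N0 => N /HN /=.
rewrite -Re_lincomb q7_lincomb.
rewrite (_ : dpsum _ _ _ _ = \sum_(i < n) (lam i)%:C * dpsum c (q7 p) (q7 (V i)) N) //.
rewrite /dpsum; under eq_bigr do rewrite dmon_lincomb mulr_sumr.
rewrite exchange_big /=; apply: eq_bigr => i _; rewrite mulr_sumr.
by apply: eq_bigr => a _; rewrite mulrCA.
Qed.

Lemma series_at_lincomb (R : realType) k n (lam : 'I_n -> R)
    (c : 'I_n -> {ffun 'I_k -> nat} -> R[i]) x v :
  (forall i, series_at (c i) x (v i)) ->
  series_at (fun a => \sum_(i < n) (lam i)%:C * c i a) x (\sum_(i < n) (lam i)%:C * v i).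
Proof.
move=> H; split; [|split].
- have /choice[B HB] : forall i, exists B : R, forall N, pabs (c i) x N <= B.
    by move=> i; case: (H i).
  exists (\sum_(i < n) `|lam i| * B i) => N.
  apply: le_trans (_ : \sum_(i < n) `|lam i| * pabs (c i) x N <= _); last first.
    by apply: ler_sum => i _; rewrite ler_wpM2l.
  rewrite /pabs; under [leRHS]eq_bigr do rewrite mulr_sumr.
  rewrite exchange_big /=; apply: ler_sum => a _.
  under [leRHS]eq_bigr do rewrite mulrA.
  rewrite -mulr_suml ler_wpM2r //.
    by apply: prodr_ge0 => j _; rewrite exprn_ge0 ?cnorm_ge0.
  apply: le_trans (cnorm_sum _ _) _; apply: ler_sum => i _.
  by rewrite cnormM cnorm_real.
- apply/tendsP; rewrite Re_lincomb; under eq_fun do rewrite psum_lincomb Re_lincomb.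
  by apply: tends_lincomb => i; apply/tendsP; case: (H i) => _ [].
- apply/tendsP; rewrite Im_lincomb; under eq_fun do rewrite psum_lincomb Im_lincomb.
  by apply: tends_lincomb => i; apply/tendsP; case: (H i) => _ [].
Qed.

Lemma common_radius (R : realType) n (P : 'I_n -> R -> Prop) :
  (forall i, exists2 r, 0 < r & forall r', r' <= r -> P i r') ->
  exists2 r, 0 < r <= 1 & forall i r', r' <= r -> P i r'.
Proof.
elim: n P => [|n IH] P H; first by exists 1; [rewrite ltr01 lexx|case].
have [r /andP[r0 r1] Hr] := IH (fun i => P (lift ord0 i)) (fun i => H _).
have [s s0 Hs] := H ord0; exists (Num.min r s).
  by rewrite lt_min r0 s0 ge_min r1.
move=> i r'; rewrite le_min => /andP[rr rs].
by case: (unliftP ord0 i) => [j|] ->; [apply: Hr|apply: Hs].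
Qed.

Lemma near0W (R : realType) (r r' : R) (p : pt R) : r' <= r -> near0 r' p -> near0 r p.
Proof. by move=> le H j; apply: lt_le_trans (H j) le. Qed.

Lemma aut_series (R : realType) phi (r7 : R) c7 (X : vf R) :
  0 < r7 -> series_on7 phi r7 c7 -> aut (rhoG phi) X ->
  exists c4 : 'I_4 -> {ffun 'I_4 -> nat} -> R[i], exists2 r, 0 < r &
    forall r', r' <= r ->
    (forall j p, near0 r' p -> series_at (c4 j) p (X j p)) /\
    (forall p, near0 r' p -> rhoG phi p = 0 -> dphi_limit c7 p (fun j => X j p)).
Proof.
move=> r70 Hc [hX [rt [rt0 Ht]]].
have /choice[c4 H] : forall j, exists c, exists2 r, 0 < r &
    forall p, near0 r p -> series_at c p (X j p).
  by move=> j; have [r [r0 [c h]]] := hX j; exists c, r.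
have [r /andP[r0 _] Hr] : exists2 r, 0 < r <= 1 & forall j r', r' <= r ->
    forall p, near0 r' p -> series_at (c4 j) p (X j p).
  apply: common_radius => j; have [r r0 h] := H j; exists r => // r' le p np.
  exact/h/(near0W le).
exists c4, (Num.min r (Num.min rt (r7 / 2))); first by rewrite !lt_min r0 rt0 divr_gt0.
move=> r'; rewrite !le_min => /and3P[l1 l2 l3]; split=> [j p|p np rp]; first exact: Hr.
apply: (tangent_dphi_limit r70 Hc); first exact: near0W np.
by apply: Ht rp; apply: near0W np.
Qed.

(** If the first [d] coordinates vanish on [S], then among [17 - d] fields some nontrivial
    combination kills the other [16 - d] as well. Series and [dphi_limit] are linear, so
    [jet_determines] applies to this combination and makes it zero. *)
Lemma germ_dim_le_aut (R : realType) phi (S : vf R -> Prop) (d : nat) :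
  real_analytic_O4 phi -> (d <= 16)%N -> (forall X, S X -> aut (rhoG phi) X) ->
  (forall X (c : 'I_4 -> {ffun 'I_4 -> nat} -> R[i]) r, S X -> 0 < r ->
    (forall j p, near0 r p -> series_at (c j) p (X j p)) ->
    forall k, (k < d)%N -> coords c k = 0) ->
  germ_dim_le S (16 - d).
Proof.
move=> [r7 [r70 [c7 [w7 Hc]]]] d16 SA S0 B HB indep.
have /choice[c4 H] := fun i => aut_series r70 Hc (SA _ (HB i)).
have [r /andP[r0 r1] Hr] := common_radius H.
pose rr := Num.min r r7.
have rr0 : 0 < rr <= 1 by rewrite lt_min r0 r70 ge_min r1.
have {H Hr} Hr i := Hr i rr (ltac:(by rewrite ge_min lexx) : rr <= r).
have Hc' : series_on7 phi rr c7.
  move=> z1 z2 zeta u h1 h2 h3 h4; have le : rr <= r7 by rewrite ge_min lexx orbT.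
  by apply: Hc; [exact: lt_le_trans le|exact: lt_le_trans le|exact: lt_le_trans le|
    exact: lt_le_trans le].
have [lam [i0 /eqP nz] K] := lincomb_kernel (fun i (k : 'I_(16 - d)) =>
  coords (c4 i) (k + d)) (ltnSn (16 - d)).
apply: nz; apply: indep; exists rr; split; first by case/andP: rr0.
have sX j p : near0 rr p -> series_at (fun a => \sum_(i < (16 - d).+1) (lam i)%:C * c4 i j a) p
    (vf_lincomb lam B j p).
  by move=> np; apply: series_at_lincomb => i; have [h _] := Hr i; apply: h.
have lX p : near0 rr p -> rhoG phi p = 0 -> dphi_limit c7 p (fun j => vf_lincomb lam B j p).
  move=> np rp; apply: dphi_limit_lincomb => i; have [_ h] := Hr i; exact: h.
have Z := jet_determines rr0 w7 Hc' sX lX.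
move=> p np j; apply: (series_at_zero _ (sX j p np)) => a; apply: Z => k k16.
rewrite coords_lincomb; have [kd|dk] := ltnP k d.
  rewrite big1 // => i _; rewrite (S0 (B i) (c4 i) rr) ?mulr0 //; first by case/andP: rr0.
  by have [h _] := Hr i.
have kl : (k - d < 16 - d)%N by rewrite ltn_sub2r // (leq_ltn_trans dk).
by have := K (Ordinal kl); rewrite /= subnK.
Qed.

Lemma aut_dim_le (R : realType) (phi : R[i] -> R[i] -> R[i] -> R -> R) :
  real_analytic_O4 phi -> germ_dim_le (aut (rhoG phi)) 16.
Proof. by move=> H; apply: (germ_dim_le_aut (d := 0) H). Qed.

Lemma aut0_dim_le (R : realType) (phi : R[i] -> R[i] -> R[i] -> R -> R) :
  real_analytic_O4 phi -> germ_dim_le (aut0 (rhoG phi)) 9.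
Proof.
move=> H; apply: (germ_dim_le_aut (d := 7) H) => // [X []//|X c r [_ X0] r0 s].
have c0 j : c j (mexp4 0 0 0 0) = 0.
  rewrite (series_at_origin (s j (fun=> 0) _)) ?X0 // => i.
  by rewrite cnorm0.
by do 7 (case=> [|]; first by rewrite /coords c0).
Qed.

(** * The explicit algebra of Q *)

Definition rpar (R : realType) (d : R) (a b c : R[i]) (k : R) (M m : R[i]) (l : R)
    (N : R[i]) (n : R) : param R[i] :=
  Param d%:C a (cj a) b (cj b) c (cj c) k%:C M (cj M) m (cj m) l%:C N (cj N) n%:C.

Definition famX (R : realType) (p : param R[i]) : vf R :=
  fun j x => mpol (famlist (ci R) p j) x.

Definition v_m3 (R : realType) (d : R) : vf R :=
  mkvf (fun _ => 0) (fun _ => 0) (fun _ => 0) (fun _ => d%:C).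

Definition v_m2 (R : realType) (a : R[i]) : vf R :=
  mkvf (fun _ => a) (fun _ => 0) (fun _ => 0) (fun p => 2 * ci R * cj a * p izeta).

Definition v_m1 (R : realType) (b c : R[i]) (k : R) : vf R :=
  mkvf (fun p => - 2 * cj c * p iz2 + ci R * k%:C * p izeta)
     (fun _ => b) (fun _ => c)
     (fun p => 2 * ci R * cj c * p iz1 + 2 * ci R * cj b * p izeta ^+ 2).

Definition v_m1'' (R : realType) (k : R) : vf R :=
  mkvf (fun p => ci R * k%:C * p izeta) (fun _ => 0) (fun _ => 0) (fun _ => 0).

Definition v_0 (R : realType) (M m : R[i]) (l : R) : vf R :=
  mkvf (fun p => M * p iz1 + m * p izeta ^+ 2)
     (fun p => (2 * M - 3 * l%:C) * p iz2 - cj m * p izeta)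
     (fun p => (3 * l%:C - cj M) * p izeta) (fun p => 3 * l%:C * p iw).

Definition v_1 (R : realType) (N : R[i]) (n : R) : vf R :=
  mkvf (fun p => 2 * ci R * cj N * p iz1 * p izeta + N * p iw)
     (fun p => 2 * ci R * cj N * p iz2 * p izeta - ci R * N * p iz1
               + ci R * n%:C * p izeta ^+ 2)
     (fun p => ci R * cj N * p izeta ^+ 2)
     (fun p => 2 * ci R * cj N * p izeta * p iw).

Lemma famX_split (R : realType) d a b c k M m l N n (j : 'I_4) (x : pt R) :
  famX (rpar d a b c k M m l N n) j x =
  vf_add (v_m3 d) (vf_add (v_m2 a) (vf_add (v_m1 b c k) (vf_add (v_0 M m l) (v_1 N n)))) j x.
Proof.
rewrite /famX /mpol /vf_add /v_m3 /v_m2 /v_m1 /v_0 /v_1 /mkvf; elim/ord4P: j;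
  rewrite /famlist /= !big_cons big_nil /= !prod_ord4 !ffunE /mk4 /=; ring.
Qed.

Lemma famX_split0 (R : realType) k M m l N n (j : 'I_4) (x : pt R) :
  famX (rpar 0 0 0 0 k M m l N n) j x =
  vf_add (v_m1'' k) (vf_add (v_0 M m l) (v_1 N n)) j x.
Proof.
have c0 : cj (0 : R[i]) = 0 by rewrite /cj conjc0.
have d0 : (0 : R)%:C = 0 by [].
rewrite /famX /rpar c0 /mpol /vf_add /v_m1'' /v_0 /v_1 /mkvf; elim/ord4P: j;
  rewrite /famlist /= !big_cons big_nil /= !prod_ord4 !ffunE /mk4 /= ?c0 ?d0; ring.
Qed.

Lemma mpol_polyfun (C : numFieldType) (s : seq (C * {ffun 'I_4 -> nat})) :
  polyfun (mpol s).
Proof.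
apply: polyfun_sum => m; apply: polyfun_mul; first exact: polyfun_const.
by apply: polyfun_prod => j; apply: polyfun_exp; apply: polyfun_var.
Qed.

Lemma mpol_holo (R : realType) (s : seq (R[i] * {ffun 'I_4 -> nat})) n :
  (forall m, m \in s -> forall j, (m.2 j < n)%N) -> holo_germ (mpol s).
Proof.
move=> H; exists 1; split=> //; exists (mcoef s) => x _; split; [|split].
- pose G a := cnorm (mcoef s a) * \prod_(j < 4) cnorm (x j) ^+ a j.
  have P0 N : 0 <= pabs (mcoef s) x N.
    apply: sumr_ge0 => a _; rewrite mulr_ge0 ?cnorm_ge0 // prodr_ge0 // => j _.
    by rewrite exprn_ge0 ?cnorm_ge0.
  (* The absolute sums are constant from [n] on, so the sum of the values up to [n] is a bound. *)
  exists (\sum_(i < n.+1) pabs (mcoef s) x i) => N.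
  have ge (i : 'I_n.+1) : pabs (mcoef s) x i <= \sum_(i < n.+1) pabs (mcoef s) x i.
    by rewrite [leRHS](bigD1 i) //= lerDl sumr_ge0.
  have [nN|Nn] := leqP n N; last exact: (ge (Ordinal (ltnW Nn : (N < n.+1)%N))).
  rewrite (_ : pabs _ _ N = pabs (mcoef s) x n); first exact: (ge ord_max).
  apply: (box_sum_stable (G := G)) => // a j aj.
  rewrite /G /mcoef big_seq big1 ?cnorm0 ?mul0r // => m ms.
  case: eqP => [e|]; last by rewrite mulr0.
  by have := H m ms j; rewrite -e ltnNge aj.
- apply/tendsP => e e0; exists n => N nN.
  rewrite psum_mcoef ?subrr ?normr0 ?ltW // => m ms j.
  exact: leq_trans (H m ms j) nN.
- apply/tendsP => e e0; exists n => N nN.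
  rewrite psum_mcoef ?subrr ?normr0 ?ltW // => m ms j.
  exact: leq_trans (H m ms j) nN.
Qed.

Lemma famX_holo (R : realType) (p : param R[i]) : holo_vf (famX p).
Proof. by move=> j; apply: (mpol_holo (n := 3)) => m; apply: famlist_lt. Qed.

Lemma is_derive_cubic (R : realType) (K2 K3 : R) :
  is_derive (0 : R) (1 : R) (fun t : R => t ^+ 2 * K2 + t ^+ 3 * K3) 0.
Proof.
have H : is_derive (0 : R) (1 : R)
    (((@id R) ^+ 2) * cst K2 + ((@id R) ^+ 3) * cst K3) 0.
  apply: is_derive_eq.
  by rewrite /= /GRing.scale /= !(mulr0, mul0r, addr0, expr0n, exprS, mulr1).
exact: H.
Qed.

(** Along the line the constant term of [rhoQ] vanishes on [Q] and its linear term is [dQ], which is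
    zero by substituting the equation of [Q]; a quadratic and a cubic term remain. The identity is
    global, hence the arbitrary radius. *)
Lemma famX_tangent (R : realType) d a b c k M m l N n :
  tangent (@rhoQ R) (famX (rpar d a b c k M m l N n)).
Proof.
exists 1; split=> // p _ rp.
have D0 : dQ p (fun j => famX (rpar d a b c k M m l N n) j p) = 0.
  rewrite /dQ !famX_split /vf_add /v_m3 /v_m2 /v_m1 /v_0 /v_1 /mkvf /=.
  move: rp; rewrite /rhoQ => /eqP; rewrite subr_eq0 => /eqP.
  case: (p iw) => u v /= ->.
  case: (p iz1) => x1 y1; case: (p iz2) => x2 y2; case: (p izeta) => x3 y3.
  case: a => a1 a2; case: b => b1 b2; case: c => c1 c2; case: M => M1 M2.
  case: m => m1 m2; case: N => N1 N2; rewrite /cj /=; ring.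
have [K2 [K3 HK]] := rhoQ_line p (fun j => famX (rpar d a b c k M m l N n) j p).
rewrite (_ : (fun t => _) = fun t => t ^+ 2 * K2 + t ^+ 3 * K3).
  exact: is_derive_cubic.
by apply: funext => t; rewrite HK rp D0 mulr0 !add0r.
Qed.

(** The sixteen real parameters in the order of [coords]: the first seven give the value at the
    origin, the last nine span the stabilizer. *)
Definition rlist (R : realType) (l : nat -> R) : param R[i] :=
  rpar (l 0%N) (Complex (l 1%N) (l 2%N)) (Complex (l 3%N) (l 4%N))
    (Complex (l 5%N) (l 6%N)) (l 7%N) (Complex (l 8%N) (l 9%N))
    (Complex (l 10%N) (l 11%N)) (l 12%N) (Complex (l 13%N) (l 14%N)) (l 15%N).

Lemma famX_lin (R : realType) (s : R) (u v : nat -> R) j (x : pt R) :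
  famX (rlist (fun k => s * u k + v k)) j x =
  s%:C * famX (rlist u) j x + famX (rlist v) j x.
Proof.
have E a b a' b' : Complex (s * a + a') (s * b + b') = s%:C * Complex a b + Complex a' b'.
  by apply/eqP; rewrite eq_complex /= !mul0r subr0 addr0 !eqxx.
have E' a a' : (s * a + a')%:C = s%:C * a%:C + a'%:C :> R[i] by rewrite rmorphD rmorphM.
have cs : cj s%:C = s%:C by rewrite /cj /= oppr0.
rewrite /rlist !E /rpar !cjD !cjM cs !E' /famX /mpol.
move: (Complex (u 1%N) _) (Complex (u 3%N) _) (Complex (u 5%N) _) (Complex (u 8%N) _)
  (Complex (u 10%N) _) (Complex (u 13%N) _) (Complex (v 1%N) _) (Complex (v 3%N) _)
  (Complex (v 5%N) _) (Complex (v 8%N) _) (Complex (v 10%N) _) (Complex (v 13%N) _).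
move=> a b c M m N a' b' c' M' m' N'.
elim/ord4P: j; rewrite /famlist /= !big_cons !big_nil /= !prod_ord4; ring.
Qed.

Lemma famX0 (R : realType) j (x : pt R) : famX (rlist (fun=> 0)) j x = 0.
Proof.
(* With [s = -1] and zero parameters, linearity says that the value is the sum of its negative and
   itself. *)
have := famX_lin (-1) (fun=> 0) (fun=> 0) j x.
rewrite (_ : (fun k : nat => -1 * 0 + 0) = fun=> 0); last first.
  by apply: funext => k; rewrite mulr0 addr0.
by rewrite rmorphN1 mulN1r addNr.
Qed.

Lemma famX_lincomb (R : realType) n (lam : 'I_n -> R) (L : 'I_n -> nat -> R) j (x : pt R) :
  vf_lincomb lam (fun i => famX (rlist (L i))) j x =
  famX (rlist (fun k => \sum_(i < n) lam i * L i k)) j x.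
Proof.
rewrite /vf_lincomb; elim: n lam L => [|n IH] lam L.
  rewrite big_ord0 -[LHS](famX0 j x); congr (famX (rlist _) _ _).
  by apply: funext => k; rewrite big_ord0.
rewrite big_ord_recl (IH (fun i => lam (lift ord0 i)) (fun i => L (lift ord0 i))) -famX_lin.
congr (famX (rlist _) _ _).
by apply: funext => k; rewrite big_ord_recl.
Qed.

Lemma famX_germ0 (R : realType) d a b c k M m l N n :
  germ_eq (famX (rpar d a b c k M m l N n)) (@vf0 R) ->
  [/\ d = 0, a = 0, b = 0, c = 0 & k = 0] /\ [/\ M = 0, m = 0, l = 0, N = 0 & n = 0].
Proof.
set p := rpar _ _ _ _ _ _ _ _ _ _; move=> [r [r0 H]].
have Z j x : famX p j x = 0.
  apply: (polyfun_real_zero r0 (mpol_polyfun _)) => y hy.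
  by apply: H => i; rewrite cnorm_real.
have C j (e : {ffun 'I_4 -> nat}) : (forall i, (e i < 3)%N) -> mcoef (famlist (ci R) p j) e = 0.
  apply: (psum_inj (d := fun=> 0)) => x.
  rewrite psum_mcoef; last by move=> m' ms; apply: famlist_lt ms.
  rewrite -/(famX p j x) Z /psum big1 // => e' _; exact: mul0r.
have ev j i k' l' n' : (i < 3)%N -> (k' < 3)%N -> (l' < 3)%N -> (n' < 3)%N ->
    mcoef (famlist (ci R) p j) (mexp4 i k' l' n') = 0.
  by move=> *; apply: C; elim/ord4P; rewrite ffunE.
have three0 : 3 != 0 :> R[i] by rewrite pnatr_eq0.
have RE (t : R) : t%:C = 0 :> R[i] -> t = 0 by case.
have IE (t : R) : ci R * t%:C = 0 -> t = 0.
  by move/eqP; rewrite mulf_eq0 (negPf (ci_neq0 R)) => /eqP /RE.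
have TE (t : R) : 3 * t%:C = 0 :> R[i] -> t = 0.
  by move/eqP; rewrite mulf_eq0 (negPf three0) => /eqP /RE.
have := ev iw 0%N 0%N 0%N 0%N isT isT isT isT.
have := ev iz1 0%N 0%N 0%N 0%N isT isT isT isT.
have := ev iz2 0%N 0%N 0%N 0%N isT isT isT isT.
have := ev izeta 0%N 0%N 0%N 0%N isT isT isT isT.
have := ev iz1 0%N 0%N 1%N 0%N isT isT isT isT.
have := ev iz1 1%N 0%N 0%N 0%N isT isT isT isT.
have := ev iz1 0%N 0%N 2%N 0%N isT isT isT isT.
have := ev iw 0%N 0%N 0%N 1%N isT isT isT isT.
have := ev iz1 0%N 0%N 0%N 1%N isT isT isT isT.
have := ev iz2 0%N 0%N 2%N 0%N isT isT isT isT.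
rewrite /mcoef /famlist /= !big_cons !big_nil /= !mexp4_eq /= !(mulr1, mulr0, addr0, add0r).
by move=> /IE -> -> /TE -> -> -> /IE -> -> -> -> /RE ->.
Qed.

Lemma germ_eq_sym (R : realType) (X Y : vf R) : germ_eq X Y -> germ_eq Y X.
Proof. by move=> [r [r0 H]]; exists r; split=> // p np j; rewrite H. Qed.

Lemma germ_eq_trans (R : realType) (X Y Z : vf R) :
  germ_eq X Y -> germ_eq Y Z -> germ_eq X Z.
Proof.
move=> [r [r0 H]] [s [s0 G]]; exists (Num.min r s); split; first by rewrite lt_min r0.
move=> p np j; rewrite H ?G //; apply: near0W np; first by rewrite ge_min lexx orbT.
by rewrite ge_min lexx.
Qed.

Lemma germ_eq_add (R : realType) (X X' Y Y' : vf R) :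
  germ_eq X X' -> germ_eq Y Y' -> germ_eq (vf_add X Y) (vf_add X' Y').
Proof.
move=> [r [r0 H]] [s [s0 G]]; exists (Num.min r s); split; first by rewrite lt_min r0.
move=> p np j; rewrite /vf_add H ?G //; apply: near0W np; first by rewrite ge_min lexx orbT.
by rewrite ge_min lexx.
Qed.

Lemma germ_eq_ext (R : realType) (X Y : vf R) :
  (forall j p, X j p = Y j p) -> germ_eq X Y.
Proof. by move=> H; exists 1; split. Qed.

Lemma germ_eq_origin (R : realType) (X Y : vf R) : germ_eq X Y ->
  forall j, X j (fun=> 0) = Y j (fun=> 0).
Proof. by move=> [r [r0 H]] j; apply: H => i; rewrite cnorm0. Qed.

Lemma aut_germ (R : realType) (rho : pt R -> R) (X Y : vf R) :
  germ_eq X Y -> aut rho X -> aut rho Y.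
Proof.
move=> [r [r0 H]] [hX [s [s0 tX]]]; split.
  move=> j; have [t [t0 [c hc]]] := hX j; exists (Num.min r t).
  split; first by rewrite lt_min r0.
  exists c => p np; rewrite -H; last by apply: near0W np; rewrite ge_min lexx.
  by apply: hc; apply: near0W np; rewrite ge_min lexx orbT.
exists (Num.min r s); split; first by rewrite lt_min r0.
move=> p np rp.
have -> : (fun t : R => rho (fun j => p j + t%:C * Y j p)) =
          (fun t : R => rho (fun j => p j + t%:C * X j p)).
  apply: funext => t; congr rho; apply: funext => j.
  by rewrite H //; apply: near0W np; rewrite ge_min lexx.
by apply: tX rp; apply: near0W np; rewrite ge_min lexx orbT.
Qed.

Lemma famX_aut (R : realType) d a b c k M m l N n :
  aut (@rhoQ R) (famX (rpar d a b c k M m l N n)).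
Proof. by split; [apply: famX_holo|apply: famX_tangent]. Qed.

(** The shift [d] skips the first parameters: [d = 0] gives the basis of the whole algebra, [d = 7]
    that of the stabilizer. *)
Definition autQ_basis (R : realType) (d : nat) (i : nat) : vf R :=
  famX (rlist (fun k => (k == i + d)%N%:R)).

Lemma rlist_germ0 (R : realType) (l : nat -> R) :
  germ_eq (famX (rlist l)) (@vf0 R) -> forall k, (k < 16)%N -> l k = 0.
Proof.
move/famX_germ0 => [[h0 [h1 h2] [h3 h4] [h5 h6] h7] [[h8 h9] [h10 h11] h12 [h13 h14] h15]].
by do 16 (case=> [|]; first by []).
Qed.

Lemma autQ_basis_indep (R : realType) (d : nat) : (d <= 16)%N ->
  germ_indep (fun i : 'I_(16 - d) => @autQ_basis R d i).
Proof.
move=> d16 lam H i.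
have {}H : germ_eq (famX (rlist (fun k => \sum_(i < 16 - d) lam i * (k == i + d)%N%:R))) (@vf0 R).
  apply: germ_eq_trans H; apply: germ_eq_ext => j p.
  by rewrite -(famX_lincomb lam (fun i k => (k == i + d)%N%:R)).
have lt : (i + d < 16)%N by have := ltn_ord i; lia.
have := rlist_germ0 H lt; rewrite (bigD1 i) //= eqxx mulr1 big1 ?addr0 // => k ki.
by rewrite eqn_add2r; case: eqP => [/val_inj e|]; [rewrite e eqxx in ki|rewrite mulr0].
Qed.

Lemma rhoG0 (R : realType) : rhoG (fun _ _ _ _ => 0) = @rhoQ R.
Proof. by apply: funext => p; rewrite /rhoG subr0. Qed.

Lemma zero_O4 (R : realType) : real_analytic_O4 (fun _ _ _ _ => 0 : R).
Proof.
exists 1; split=> //; exists (fun=> 0); split=> [a|z1 z2 zeta u _ _ _ _].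
  by rewrite eqxx.
have p0 N x : psum (fun=> 0 : R[i]) x N = 0 :> R[i].
  by move=> *; rewrite /psum big1 // => a _; rewrite mul0r.
split; [|split].
- exists 0 => N; rewrite /pabs big1 // => a _; by rewrite cnorm0 mul0r.
- by apply/tendsP => e e0; exists 0%N => N _; rewrite p0 subrr normr0 ltW.
- by apply/tendsP => e e0; exists 0%N => N _; rewrite p0 subrr normr0 ltW.
Qed.

(** [X] and the sixteen basis fields are 17 fields in a space of dimension at most 16. In a
    nontrivial relation between them [X] has a nonzero coefficient, since the basis is independent,
    and the relation can be solved for [X]. *)
Lemma autQ_fam (R : realType) (X : vf R) : aut (@rhoQ R) X ->
  exists l, germ_eq X (famX (rlist l)).
Proof.
move=> aX; have := aut_dim_le (zero_O4 R); rewrite rhoG0.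
pose B (i : 'I_17) := if unlift ord0 i is Some j then @autQ_basis R 0 j else X.
move/(_ B); have aB i : aut (@rhoQ R) (B i).
  by rewrite /B; case: (unlift _ _) => // j; apply: famX_aut.
move/(_ aB) => ni.
have [lam [E [i nz]]] : exists lam : 'I_17 -> R,
    germ_eq (vf_lincomb lam B) (@vf0 R) /\ exists i, lam i != 0.
  apply: contra_notP ni => H lam E i; apply/eqP/negPn/negP => nz.
  by apply: H; exists lam; split=> //; exists i.
pose l (k : nat) := \sum_(i < 16) lam (lift ord0 i) * (k == i + 0)%N%:R.
have LE j p : vf_lincomb lam B j p = (lam ord0)%:C * X j p + famX (rlist l) j p.
  rewrite /vf_lincomb big_ord_recl /B unlift_none; congr (_ + _).
  rewrite -(famX_lincomb (fun i => lam (lift ord0 i)) (fun i k => (k == i + 0)%N%:R)).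
  by apply: eq_bigr => k _; rewrite liftK.
have [l0|l0] := eqVneq (lam ord0) 0.
  have {}E : germ_eq (famX (rlist l)) (@vf0 R).
    apply: germ_eq_trans E; apply: germ_eq_ext => j p.
    by rewrite LE l0 rmorph0 mul0r add0r.
  case/eqP: nz; case: (unliftP ord0 i) => [j|] -> //.
  have := rlist_germ0 E (ltn_ord j); rewrite /l (bigD1 j) //= addn0 eqxx mulr1.
  rewrite big1 ?addr0 // => k ki.
  by rewrite addn0; case: eqP => [/val_inj e|]; [rewrite e eqxx in ki|rewrite mulr0].
(* The added 0 gives the witness the shape [s * u + v] of [famX_lin]. *)
exists (fun k => - (lam ord0)^-1 * l k + 0).
have [r [r0 H]] := E; exists r; split=> // p np j.
have := H p np j; rewrite LE famX_lin famX0 addr0 /vf0 => /eqP.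
rewrite addrC addr_eq0 => /eqP ->.
by rewrite rmorphN fmorphV mulrN mulNr opprK mulKf // fmorph_eq0.
Qed.

Lemma g_sum_fam (R : realType) (X1 X2 X3 X4 X5 : vf R) :
  [/\ g_m3 X1, g_m2 X2, g_m1 X3, g_0 X4 & g_1 X5] ->
  exists d a b c k M m l N n,
   [/\ germ_eq X1 (v_m3 d), germ_eq X2 (v_m2 a), germ_eq X3 (v_m1 b c k),
       germ_eq X4 (v_0 M m l) & germ_eq X5 (v_1 N n)] /\
   germ_eq (famX (rpar d a b c k M m l N n))
     (vf_add X1 (vf_add X2 (vf_add X3 (vf_add X4 X5)))).
Proof.
move=> [[d h1] [a h2] [b [c [k h3]]] [M [m [l h4]]] [N [n h5]]].
exists d, a, b, c, k, M, m, l, N, n; split=> //.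
apply: germ_eq_trans (germ_eq_ext (famX_split d a b c k M m l N n)) _.
by do !apply: germ_eq_add; apply: germ_eq_sym.
Qed.

Lemma g_sum_fam0 (R : realType) (X3 X4 X5 : vf R) :
  [/\ g_m1'' X3, g_0 X4 & g_1 X5] ->
  exists k M m l N n,
   [/\ germ_eq X3 (v_m1'' k), germ_eq X4 (v_0 M m l) & germ_eq X5 (v_1 N n)] /\
   germ_eq (famX (rpar 0 0 0 0 k M m l N n)) (vf_add X3 (vf_add X4 X5)).
Proof.
move=> [[k h3] [M [m [l h4]]] [N [n h5]]].
exists k, M, m, l, N, n; split=> //.
apply: germ_eq_trans (germ_eq_ext (famX_split0 k M m l N n)) _.
by do !apply: germ_eq_add; apply: germ_eq_sym.
Qed.

Lemma v_zero (R : realType) : [/\ forall j p, v_m3 0 j p = @vf0 R j p,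
    forall j p, v_m2 0 j p = @vf0 R j p, forall j p, v_m1 0 0 0 j p = @vf0 R j p
  & forall j p, v_m1'' 0 j p = @vf0 R j p] /\
  (forall j p, v_0 0 0 0 j p = @vf0 R j p) /\ (forall j p, v_1 0 0 j p = @vf0 R j p).
Proof.
have c0 : cj (0 : R[i]) = 0 by rewrite /cj conjc0.
have d0 : (0 : R)%:C = 0 by [].
by do !split; elim/ord4P => p; rewrite /v_m3 /v_m2 /v_m1 /v_m1'' /v_0 /v_1 /mkvf /vf0 ?c0 ?d0 //=;
  ring.
Qed.

Lemma famX_origin (R : realType) d a b c k M m l N n :
  let Y := famX (rpar d a b c k M m l N n) in
  [/\ Y iw (fun=> 0) = d%:C, Y iz1 (fun=> 0) = a, Y iz2 (fun=> 0) = b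
    & Y izeta (fun=> 0) = c :> R[i]].
Proof.
by move=> Y; split; rewrite /Y famX_split /vf_add /v_m3 /v_m2 /v_m1 /v_0 /v_1 /mkvf /=; ring.
Qed.

Theorem theorem15 (R : realType) :
  (* (a) aut Q = g_{-3} (+) g_{-2} (+) g_{-1} (+) g_0 (+) g_1, dim = 16 *)
  ((forall X : vf R, aut (@rhoQ R) X <->
      exists X1 X2 X3 X4 X5 : vf R,
        [/\ g_m3 X1, g_m2 X2, g_m1 X3, g_0 X4 & g_1 X5] /\
        germ_eq X (vf_add X1 (vf_add X2 (vf_add X3 (vf_add X4 X5))))) /\
   (forall X1 X2 X3 X4 X5 : vf R,
        [/\ g_m3 X1, g_m2 X2, g_m1 X3, g_0 X4 & g_1 X5] ->
        germ_eq (vf_add X1 (vf_add X2 (vf_add X3 (vf_add X4 X5)))) (@vf0 R) ->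
        [/\ germ_eq X1 (@vf0 R), germ_eq X2 (@vf0 R), germ_eq X3 (@vf0 R),
            germ_eq X4 (@vf0 R) & germ_eq X5 (@vf0 R)]) /\
   germ_dim_eq (aut (@rhoQ R)) 16) /\
  (* (b) aut_0 Q = g''_{-1} (+) g_0 (+) g_1, dim = 9 *)
  ((forall X : vf R, aut0 (@rhoQ R) X <->
      exists X3 X4 X5 : vf R,
        [/\ g_m1'' X3, g_0 X4 & g_1 X5] /\
        germ_eq X (vf_add X3 (vf_add X4 X5))) /\
   (forall X3 X4 X5 : vf R,
        [/\ g_m1'' X3, g_0 X4 & g_1 X5] ->
        germ_eq (vf_add X3 (vf_add X4 X5)) (@vf0 R) ->
        [/\ germ_eq X3 (@vf0 R), germ_eq X4 (@vf0 R) & germ_eq X5 (@vf0 R)]) /\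
   germ_dim_eq (aut0 (@rhoQ R)) 9) /\
  (* (c) Gamma_0 : v = 2Re(z1 conj zeta + z2 conj zeta^2) + O(4) *)
  (forall phi : R[i] -> R[i] -> R[i] -> R -> R,
     real_analytic_O4 phi ->
     germ_dim_le (aut (rhoG phi)) 16 /\ germ_dim_le (aut0 (rhoG phi)) 9).
Proof.
have [[z3 z2 z1 z1''] [z0 zp1]] := v_zero R.
have gz (X Y : vf R) : germ_eq X Y -> (forall j p, Y j p = @vf0 R j p) -> germ_eq X (@vf0 R).
  by move=> h /germ_eq_ext; apply: germ_eq_trans.
have c0 : cj (0 : R[i]) = 0 by rewrite /cj conjc0.
split; [split; [|split]|split; [split; [|split]|]].
- move=> X; split=> [/autQ_fam[l h]|[X1 [X2 [X3 [X4 [X5 [/g_sum_fam H e]]]]]]].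
    exists (v_m3 (l 0%N)), (v_m2 (Complex (l 1%N) (l 2%N))),
      (v_m1 (Complex (l 3%N) (l 4%N)) (Complex (l 5%N) (l 6%N)) (l 7%N)),
      (v_0 (Complex (l 8%N) (l 9%N)) (Complex (l 10%N) (l 11%N)) (l 12%N)),
      (v_1 (Complex (l 13%N) (l 14%N)) (l 15%N)).
    split; last by apply: germ_eq_trans h (germ_eq_ext _) => j p; rewrite famX_split.
    by split; repeat eexists; try exact: ltr01; move=> *; reflexivity.
  have [d [a [b [c [k [M [m [l [N [n [_ h]]]]]]]]]]] := H.
  by apply: aut_germ (famX_aut d a b c k M m l N n); apply: germ_eq_trans h (germ_eq_sym e).
- move=> X1 X2 X3 X4 X5 /g_sum_fam[d [a [b [c [k [M [m [l [N [n [[h1 h2 h3 h4 h5] h]]]]]]]]]]] e.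
  (* A zero sum is a zero member of the family, so all parameters vanish, and with them each
     summand. *)
  have [[E1 E2 E3 E4 E5] [E6 E7 E8 E9 E10]] := famX_germ0 (germ_eq_trans h e).
  by subst; split; [exact: gz z3|exact: gz z2|exact: gz z1|exact: gz z0|exact: gz zp1].
- split; last by have := aut_dim_le (zero_O4 R); rewrite rhoG0.
  exists (fun i : 'I_16 => @autQ_basis R 0 i); split; first by move=> i; apply: famX_aut.
  exact: (@autQ_basis_indep R 0).
- move=> X; split=> [[/autQ_fam[l h] X0]|[X3 [X4 [X5 [/g_sum_fam0 H e]]]]].
    have o := germ_eq_origin h.
    have [+ + + +] := famX_origin (l 0%N) (Complex (l 1%N) (l 2%N)) (Complex (l 3%N) (l 4%N))
      (Complex (l 5%N) (l 6%N)) (l 7%N) (Complex (l 8%N) (l 9%N))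
      (Complex (l 10%N) (l 11%N)) (l 12%N) (Complex (l 13%N) (l 14%N)) (l 15%N).
    (* Vanishing at the origin means [d = a = b = c = 0], which leaves only the [k] part of the
       piece of weight -1. *)
    rewrite -/(rlist l) -!o !X0 => -[e0] ea eb ec.
    exists (v_m1'' (l 7%N)),
      (v_0 (Complex (l 8%N) (l 9%N)) (Complex (l 10%N) (l 11%N)) (l 12%N)),
      (v_1 (Complex (l 13%N) (l 14%N)) (l 15%N)).
    split; first by split; repeat eexists; try exact: ltr01; move=> *; reflexivity.
    apply: germ_eq_trans h (germ_eq_ext _) => j p.
    by rewrite -famX_split0 /rlist -e0 -ea -eb -ec.
  have [k [M [m [l [N [n [_ h]]]]]]] := H.
  have hX := germ_eq_trans h (germ_eq_sym e).
  split; first exact: aut_germ hX (famX_aut _ _ _ _ _ _ _ _ _ _).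
  have [v3 v0 v1 v2] := famX_origin 0 0 0 0 k M m l N n.
  by elim/ord4P; rewrite -(germ_eq_origin hX).
- move=> X3 X4 X5 /g_sum_fam0[k [M [m [l [N [n [[h3 h4 h5] h]]]]]]] e.
  have [[_ _ _ _ E5] [E6 E7 E8 E9 E10]] := famX_germ0 (germ_eq_trans h e).
  by subst; split; [exact: gz z1''|exact: gz z0|exact: gz zp1].
- split; last by have := aut0_dim_le (zero_O4 R); rewrite rhoG0.
  exists (fun i : 'I_9 => @autQ_basis R 7 i); split; last exact: (@autQ_basis_indep R 7).
  move=> i; split; first exact: famX_aut.
  (* The shift by 7 makes the parameters [d], [a], [b], [c] of each basis field vanish, and these
     are its values at the origin. *)
  have nE n : (n < 7)%N -> (n == i + 7)%N = false by move=> h; apply/negbTE/eqP; lia.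
  rewrite /autQ_basis /rlist (nE 0%N isT) (nE 1%N isT) (nE 2%N isT) (nE 3%N isT)
    (nE 4%N isT) (nE 5%N isT) (nE 6%N isT) => j.
  have [v3 v0 v1 v2] := famX_origin (0 : R) 0 0 0 (7 == i + 7)%N%:R
    (Complex (8 == i + 7)%N%:R (9 == i + 7)%N%:R) (Complex (10 == i + 7)%N%:R (11 == i + 7)%N%:R)
    (12 == i + 7)%N%:R (Complex (13 == i + 7)%N%:R (14 == i + 7)%N%:R) (15 == i + 7)%N%:R.
  by elim/ord4P: j.
- by move=> phi H; split; [apply: aut_dim_le|apply: aut0_dim_le].
Qed.
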